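(* Let $\theta,\sigma>0$ and let $u$ be the solution of the stochastic heat equation $\mathrm{d}u(t,x)=\theta u_{xx}(t,x)\,\mathrm{d}t+\sigma\,\mathrm{d}W(t,x)$, $x\in\mathbb R$, $t>0$, $u(0,x)=0$, namely $u(t,x)=\sigma\int_0^t\int_{\mathbb R}p_{t-s}(x-y)\,W(\mathrm ds,\mathrm dy)$ with $p_s(z)=(4\pi\theta s)^{-1/2}e^{-z^2/(4\theta s)}$, where $W$ is a space-time white noise. Fix $x\in\mathbb R$ and $0<c<d<\infty$, let $t_i=c+(d-c)i/n$, $i=0,\dots,n$, and define $$\widehat\theta_{n,x}=\frac{3(d-c)\sigma^4}{\pi\sum_{i=1}^n(u(t_i,x)-u(t_{i-1},x))^4},\qquad \widehat\sigma^2_{n,x}=\sqrt{\frac{\theta\pi}{3(d-c)}\sum_{i=1}^n(u(t_i,x)-u(t_{i-1},x))^4}.$$ Then, as $n\to\infty$, $\widehat\theta_{n,x}\to\theta$ almost surely, $\widehat\sigma^2_{n,x}\to\sigma^2$ almost surely, and $$\sqrt n(\widehat\theta_{n,x}-\theta)\xrightarrow{\mathcal D}\mathcal N\Big(0,\tfrac19\theta^2\check\sigma^2\Big),\qquad \sqrt n(\widehat\sigma^2_{n,x}-\sigma^2)\xrightarrow{\mathcal D}\mathcal N\Big(0,\tfrac1{36}\sigma^4\check\sigma^2\Big),$$ where $\check\sigma^2=72\check\sigma_2^2+24\check\sigma_4^2$, $\check\sigma_l^2=\lim_{n\to\infty}\frac1n\sum_{i=1}^n\sum_{j=1}^n r^l(|i-j|)$,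 and $r(m)=\tfrac12\big(|m+1|^{1/2}+|m-1|^{1/2}-2|m|^{1/2}\big)$ is the correlation function of the unit increments of a fractional Brownian motion with Hurst index $1/4$.
   Context: The statement for $\widehat\theta_{n,x}$ is with $\sigma$ regarded as known, that for $\widehat\sigma^2_{n,x}$ with $\theta$ regarded as known. $\xrightarrow{\mathcal D}$ denotes convergence in distribution. *)

(* Defs.v *)
From HB Require Import structures.
From mathcomp Require Import all_boot all_order all_algebra.
From mathcomp Require Import all_classical all_reals all_analysis.
Set Implicit Arguments. Unset Strict Implicit. Unset Printing Implicit Defensive.
Import Order.TTheory GRing.Theory Num.Theory.
Import numFieldNormedType.Exports.
Local Open Scope classical_set_scope.
Local Open Scope ring_scope.

Section defs.
Context {R : realType}.

Definition gauss_law (v : R) : set R -> \bar R :=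
  if v == 0 then (\d_ (0 : R) : set R -> \bar R) else normal_prob 0 (Num.sqrt v).

(* the time-space domain [0,oo) x R of the white noise; points are (s, y) *)
Definition st_dom : set (R * R) := [set p | 0 <= p.1].

Definition leb2 := (@lebesgue_measure R \x @lebesgue_measure R)%E.

Definition sq_integrable (h : R * R -> R) : Prop :=
  measurable_fun st_dom h /\
  (\int[leb2]_(p in st_dom) ((h p) ^+ 2)%:E < +oo)%E.

Definition L2norm2 (h : R * R -> R) : R :=
  fine (\int[leb2]_(p in st_dom) ((h p) ^+ 2)%:E)%E.

(* Space-time white noise on [0,oo) x R, as the isonormal Gaussian process
   h |-> W(h) = \int\int h(s,y) W(ds,dy) indexed by L^2([0,oo) x R). *)
Definition is_white_noise d (T : measurableType d) (P : probability T R)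
    (W : (R * R -> R) -> T -> R) : Prop :=
  (forall h, sq_integrable h ->
     measurable_fun setT (W h) /\
     forall A : set R, measurable A -> P (W h @^-1` A) = gauss_law (L2norm2 h) A)
  /\
  (forall h g (a b : R), sq_integrable h -> sq_integrable g ->
     {ae P, forall w, W (fun p => a * h p + b * g p) w = a * W h w + b * W g w}).

Definition heat_kernel (theta s z : R) : R :=
  (Num.sqrt (4 * pi * theta * s))^-1 * expR (- (z ^+ 2) / (4 * theta * s)).

Definition heat_integrand (theta t x : R) (p : R * R) : R :=
  if (0 <= p.1) && (p.1 < t) then heat_kernel theta (t - p.1) (x - p.2) else 0.

Definition mild_solution T (W : (R * R -> R) -> T -> R) (theta sigma t x : R)
  : T -> R := fun w => sigma * W (heat_integrand theta t x) w.

Definition grid (c d : R) (n i : nat) : R := c + (d - c) * i%:R / n%:R.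

Definition quartic_var T (U : R -> T -> R) (c d : R) (n : nat) (w : T) : R :=
  \sum_(i < n) (U (grid c d n i.+1) w - U (grid c d n i) w) ^+ 4.

Definition theta_hat T (U : R -> T -> R) (sigma c d : R) (n : nat) (w : T) : R :=
  3 * (d - c) * sigma ^+ 4 / (pi * quartic_var U c d n w).

Definition sigma2_hat T (U : R -> T -> R) (theta c d : R) (n : nat) (w : T) : R :=
  Num.sqrt (theta * pi / (3 * (d - c)) * quartic_var U c d n w).

(* correlation of unit increments of fBm with Hurst index 1/4 *)
Definition r_fbm (m : R) : R :=
  (Num.sqrt `|m + 1| + Num.sqrt `|m - 1| - 2 * Num.sqrt `|m|) / 2.

Definition sigma_check_l2 (l : nat) : R :=
  limn (fun n : nat => n%:R^-1 *
    \sum_(i < n) \sum_(j < n) r_fbm `|i%:R - j%:R| ^+ l).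

Definition sigma_check2 : R := 72 * sigma_check_l2 2 + 24 * sigma_check_l2 4.

Definition conv_in_distribution d (T : measurableType d) (P : probability T R)
    (X : nat -> T -> R) (mu : set R -> \bar R) : Prop :=
  forall f : R -> R, continuous f -> (exists M : R, forall y, `|f y| <= M) ->
    ((fun n => \int[P]_w (f (X n w))%:E) @ \oo --> \int[mu]_y (f y)%:E)%E.

End defs.

(* Main.v *)
(** Method of moments.  Write Y_i for the increments of u(., x), normalised so
    that their covariance rho_ij is r(i - j) + O(n^(-3/2)); this follows from
    Cov(u(t,x), u(s,x)) = const * (sqrt(t + s) - sqrt|t - s|), whose first term is
    smooth away from 0.  Both estimators are smooth functions of
    Q_n = (1/3n) sum_i Y_i^4 = 1 + S_n / (3 sqrt n) + o(1 / sqrt n) with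
    S_n = n^(-1/2) sum_i (Y_i^4 - 3 rho_ii^2).
    Gaussian integration by parts gives a recursion for the mixed moments
    E[Y_j1 ... Y_js S_n^k].  As the rows of rho are bounded in l^1 uniformly in n,
    it shows that all moments of S_n are bounded and that
    E[S_n^(k+1)] = k V E[S_n^(k-1)] + o(1), where V = lim Var(S_n) is the constant
    of the theorem; this is the recursion of the moments of N(0, V).  Convergence
    of moments yields convergence in law through the Taylor expansion of
    cos (t x + phi), the bounded continuous test functions being approximated by
    trigonometric polynomials.  The fourth moment bound on S_n and Borel-Cantelli
    give strong consistency, and the delta method the two limit laws. *)

Require Import Defs.
From HB Require Import structures.
From mathcomp Require Import all_boot all_order all_algebra.
From mathcomp Require Import all_classical all_reals all_analysis.
From mathcomp Require Import measurable_realfun ring lra zify.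
Set Implicit Arguments. Unset Strict Implicit. Unset Printing Implicit Defensive.
Import Order.TTheory GRing.Theory Num.Theory.
Import numFieldNormedType.Exports.
Local Open Scope classical_set_scope.
Local Open Scope ring_scope.

(** * Moment recursion and bounds uniform in n *)

(** Two integrations by parts in one factor of Y_i^4 - 3 rho_ii^2 cancel the centring exactly. Each
    remaining term carries a factor rho_ij, where j is either an index of the monomial, and then the
    sum over i is O(1) against n^(-1/2), or an index from another factor S_n, and then a second
    n^(-1/2) meets a double sum of order n. For the empty monomial only the second kind occurs, and
    its monomials of degree 4 and 6 decouple from S_n^(k-1) up to O(n^(-1/2)); this produces V. The
    recursion is run on abstract arrays [m] of numbers, so that every constant is chosen before n,
    rho and m. Integration by parts is proved without densities, which also covers singular
    covariances: expectations of powers of l + s Y_i are polynomials in s, and comparing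
    coefficients replaces differentiation. The increments are scaled by the leading term of their
    variance. Then [theta_hat] = theta / Q_n and [sigma2_hat] = sigma^2 sqrt(Q_n) hold exactly, and
    the mismatch rho_ii - 1 = O(n^(-3/2)) is a bias that remains negligible after multiplication by
    sqrt n. *)

Section contractions.
Context {I : Type}.

(** The possible contractions of a new Gaussian factor with the monomial of [s]; a list, so that
    repeated indices count with multiplicity. *)
Fixpoint picks (s : seq I) : seq (I * seq I) :=
  if s is j :: s' then (j, s') :: [seq (p.1, j :: p.2) | p <- picks s'] else [::].

Lemma size_picks s : size (picks s) = size s.
Proof. by elim: s => //= j s IH; rewrite size_map IH. Qed.

End contractions.

Lemma mem_picks_size (I : eqType) (s : seq I) p :
  p \in picks s -> (size p.2 < size s)%N.
Proof.
elim: s p => //= j s IH p; rewrite inE => /predU1P[->//|/mapP[q qs ->]] /=.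
by rewrite ltnS IH.
Qed.

Lemma sum_mulDZ (R : comPzRingType) (I : Type) (r : seq I) (c : R) (f g h : I -> R) :
  \sum_(i <- r) f i * (g i + c * h i) =
  \sum_(i <- r) f i * g i + c * \sum_(i <- r) f i * h i.
Proof.
rewrite mulr_sumr -big_split; apply: eq_bigr => i _ /=.
by rewrite mulrDr (mulrCA c).
Qed.

Section moment_recursion.
Context {R : realType}.

(* [m s k] stands for E[prod_(j <- s) Y_j * S_n ^ k]: [wick_cons] is Gaussian
   integration by parts in the first factor, where d S_n / d Y_j = 4 Y_j^3 / sqrt n. *)
Record wick_moments (n : nat) (rho : 'I_n -> 'I_n -> R)
    (m : seq 'I_n -> nat -> R) : Prop := WickMoments {
  wick0 : m [::] 0 = 1 ;
  wick_cons : forall i s k, m (i :: s) k =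
    \sum_(p <- picks s) rho i p.1 * m p.2 k +
    4 * k%:R / Num.sqrt n%:R * \sum_j rho i j * m [:: j, j, j & s] k.-1 ;
  wick_pow : forall s k, m s k.+1 =
    (Num.sqrt n%:R)^-1 *
      \sum_i (m [:: i, i, i, i & s] k - 3 * rho i i ^+ 2 * m s k) }.

Definition row_bounded (B : R) n (rho : 'I_n -> 'I_n -> R) :=
  forall i, \sum_j `|rho i j| <= B.

Section fixed_n.
Variables (n : nat) (rho : 'I_n -> 'I_n -> R) (m : seq 'I_n -> nat -> R).
Hypothesis W : wick_moments rho m.
Hypothesis rhoC : forall i j, rho i j = rho j i.

Lemma wick_cons0 i s : m (i :: s) 0 = \sum_(p <- picks s) rho i p.1 * m p.2 0.
Proof. by rewrite (wick_cons W) mulr0 mul0r mul0r addr0. Qed.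

Lemma wick_pair i j : m [:: i; j] 0 = rho i j.
Proof. by rewrite wick_cons0 /= !big_cons big_nil /= (wick0 W) mulr1 addr0. Qed.

Lemma wick_31 i j : m [:: j; j; j; i] 0 = 3 * rho j j * rho i j.
Proof.
by rewrite wick_cons0 /= !big_cons big_nil /= !wick_pair (rhoC j i); ring.
Qed.

Lemma wick_22 i j : m [:: j; j; i; i] 0 = rho i i * rho j j + 2 * rho i j ^+ 2.
Proof.
by rewrite wick_cons0 /= !big_cons big_nil /= !wick_pair (rhoC j i); ring.
Qed.

Lemma wick_13 i j : m [:: j; i; i; i] 0 = 3 * rho i i * rho i j.
Proof.
by rewrite wick_cons0 /= !big_cons big_nil /= !wick_pair (rhoC j i); ring.
Qed.

Lemma wick_33 i j :
  m [:: j; j; j; i; i; i] 0 = 9 * rho i i * rho j j * rho i j + 6 * rho i j ^+ 3.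
Proof.
by rewrite wick_cons0 /= !big_cons big_nil /= !wick_22 !wick_13 (rhoC j i); ring.
Qed.

(** Two integrations by parts in Y_i: the contractions inside Y_i^4 first give 3 rho_ii Y_i^2 and
    then 3 rho_ii^2, which the centring removes. The first sum collects the contractions with [s],
    the second those with another factor S_n. *)
Lemma wick_powS s k : m s k.+1 =
  (Num.sqrt n%:R)^-1 * (\sum_i \sum_(p <- picks s) rho i p.1 *
      (m [:: i, i, i & p.2] k + 3 * rho i i * m (i :: p.2) k)) +
  4 * k%:R * (Num.sqrt n%:R)^-1 ^+ 2 * \sum_i \sum_j rho i j *
      (m [:: j, j, j, i, i, i & s] k.-1 + 3 * rho i i * m [:: j, j, j, i & s] k.-1).
Proof.
rewrite (wick_pow W).
have E i : m [:: i, i, i, i & s] k - 3 * rho i i ^+ 2 * m s k =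
  \sum_(p <- picks s) rho i p.1 * (m [:: i, i, i & p.2] k + 3 * rho i i * m (i :: p.2) k) +
  4 * k%:R / Num.sqrt n%:R * \sum_j rho i j *
      (m [:: j, j, j, i, i, i & s] k.-1 + 3 * rho i i * m [:: j, j, j, i & s] k.-1).
  rewrite (wick_cons W) /= !big_cons !big_map /= (wick_cons W) /= !big_cons !big_map /=.
  by rewrite !sum_mulDZ; ring.
under eq_bigr do rewrite E.
rewrite big_split /= -mulr_sumr mulrDr; congr (_ + _).
by rewrite mulrA; congr (_ * _); ring.
Qed.

(* By the Hermite expansion of y^4, Cov(Y_i^4, Y_j^4) is the (i, j) summand. *)
Definition wick_variance := n%:R^-1 *
  \sum_i \sum_j (72 * rho i i * rho j j * rho i j ^+ 2 + 24 * rho i j ^+ 4).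

Lemma wick_varianceE : 4 * (Num.sqrt n%:R)^-1 ^+ 2 * \sum_i \sum_j rho i j *
    (m [:: j; j; j; i; i; i] 0 + 3 * rho i i * m [:: j; j; j; i] 0) =
  wick_variance.
Proof.
rewrite /wick_variance exprVn sqr_sqrtr // mulrAC mulrC; congr (_ * _).
rewrite mulr_sumr; apply: eq_bigr => i _; rewrite mulr_sumr.
by apply: eq_bigr => j _; rewrite wick_33 wick_31; ring.
Qed.

End fixed_n.

Lemma row_bounded_le B n (rho : 'I_n -> 'I_n -> R) i j :
  row_bounded B rho -> `|rho i j| <= B.
Proof.
by move=> /(_ i); apply: le_trans; rewrite (bigD1 j) //= lerDl sumr_ge0.
Qed.

Lemma invsqrt_ge0 n : 0 <= (Num.sqrt n%:R : R)^-1.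
Proof. by rewrite invr_ge0 sqrtr_ge0. Qed.

(** At n = 0 the inverse is 0 by convention, so this bound and the next hold for every n and the
    uniform estimates never separate that case. *)
Lemma invsqrt_le1 n : (Num.sqrt n%:R : R)^-1 <= 1.
Proof.
case: n => [|n]; first by rewrite sqrtr0 invr0 ler01.
by rewrite invf_le1 ?sqrtr_gt0// -[leLHS]sqrtr1 ler_wsqrtr// ler1n.
Qed.

Lemma invsqrt_sqr_le1 n : (Num.sqrt n%:R : R)^-1 ^+ 2 * n%:R <= 1.
Proof.
case: n => [|n]; first by rewrite mulr0 ler01.
by rewrite exprVn sqr_sqrtr// mulVf// pnatr_eq0.
Qed.

Lemma norm_sum_picks_le n (rho : 'I_n -> 'I_n -> R) B C i s (f : seq 'I_n -> R) :
  row_bounded B rho -> 0 <= C ->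
  (forall t, (size t < size s)%N -> `|f t| <= C) ->
  `|\sum_(p <- picks s) rho i p.1 * f p.2| <= (size s)%:R * (B * C).
Proof.
move=> rB C0 fC; apply: (le_trans (ler_norm_sum _ _ _)).
rewrite -size_picks -sum1_size natr_sum mulr_suml.
rewrite [leLHS]big_seq [leRHS]big_seq; apply: ler_sum => p ps; rewrite mul1r.
rewrite normrM ler_pM//; first exact: row_bounded_le.
exact/fC/mem_picks_size.
Qed.

Lemma norm_sum_row_le n (rho : 'I_n -> 'I_n -> R) B C i (f : 'I_n -> R) :
  row_bounded B rho -> 0 <= C -> (forall j, `|f j| <= C) ->
  `|\sum_j rho i j * f j| <= B * C.
Proof.
move=> rB C0 fC; apply: (le_trans (ler_norm_sum _ _ _)).
apply: (@le_trans _ _ (\sum_j `|rho i j| * C)).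
  by apply: ler_sum => j _; rewrite normrM ler_wpM2l.
by rewrite -mulr_suml ler_wpM2r.
Qed.

End moment_recursion.

Lemma sum_ord_const (R : pzRingType) n (c : R) : \sum_(i < n) c = n%:R * c.
Proof. by rewrite sumr_const card_ord mulr_natl. Qed.

Section moment_bounds.
Context {R : realType}.
Variable B : R.
Hypothesis B0 : 0 <= B.

Definition wick_class n (rho : 'I_n -> 'I_n -> R) (m : seq 'I_n -> nat -> R) :=
  [/\ wick_moments rho m, forall i j, rho i j = rho j i & row_bounded B rho].

Lemma wick_bounded0 d : exists2 C : R, 0 <= C &
  forall n (rho : 'I_n -> 'I_n -> R) m, wick_class rho m ->
    forall s, (size s <= d)%N -> `|m s 0| <= C.
Proof.
elim: d => [|d [C C0 IH]].
  exists 1 => // n rho m [W _ _] [|//] _.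
  by rewrite (wick0 W) normr1.
have dC : 0 <= d%:R * (B * C) by rewrite !mulr_ge0.
exists (1 + d%:R * (B * C)); first by rewrite addr_ge0.
move=> n rho m Wm [|i s] /=; have [W rhoC rB] := Wm.
  by rewrite (wick0 W) normr1 lerDl.
rewrite ltnS => sd; rewrite (wick_cons0 W).
apply: (@le_trans _ _ ((size s)%:R * (B * C))).
  by apply: (@norm_sum_picks_le _ _ rho B _ i s (fun t => m t 0)) => // t ts; apply: (IH _ _ _ Wm) => //; exact: leq_trans (ltnW ts) sd.
apply: (@le_trans _ _ (d%:R * (B * C))); last by rewrite lerDr.
by rewrite ler_wpM2r ?mulr_ge0// ler_nat.
Qed.

(** The power k drops in every term of [wick_powS] while the monomial grows by at most 6 factors;
    strong induction on k with the length bound [d] left free absorbs the growth. *)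
Lemma wick_bounded k : forall d, exists2 C : R, 0 <= C &
  forall n (rho : 'I_n -> 'I_n -> R) m, wick_class rho m ->
    forall s, (size s <= d)%N -> `|m s k| <= C.
Proof.
elim/ltn_ind: k => -[_ d|k IH d]; first exact: wick_bounded0.
have [C1 C10 H1] := IH k (ltnSn k) (d + 3)%N.
have [C2 C20 H2] := IH k.-1 (leq_ltn_trans (leq_pred k) (ltnSn k)) (d + 6)%N.
pose D1 := C1 + 3 * B * C1; pose D2 := C2 + 3 * B * C2.
have D10 : 0 <= D1 by rewrite addr_ge0 ?mulr_ge0.
have D20 : 0 <= D2 by rewrite addr_ge0 ?mulr_ge0.
exists (d%:R * (B * D1) + 4 * k%:R * (B * D2)).
  by rewrite addr_ge0 ?mulr_ge0.
move=> n rho m Wm s sd; have [W rhoC rB] := Wm.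
have bnd (c1 c2 x y : R) i : 0 <= c1 -> `|x| <= c1 -> `|y| <= c2 -> c2 <= c1 ->
    `|x + 3 * rho i i * y| <= c1 + 3 * B * c1.
  move=> c10 xc1 yc2 c21; apply: (le_trans (ler_normD _ _)); apply: lerD => //.
  rewrite !normrM (ger0_norm (ler0n _ 3)) -!mulrA ler_wpM2l// ler_pM//.
    exact: row_bounded_le.
  exact: le_trans yc2 c21.
rewrite (wick_powS W); apply: (le_trans (ler_normD _ _)); apply: lerD.
  rewrite normrM ger0_norm ?invsqrt_ge0//.
  apply: (@le_trans _ _ (1 * (d%:R * (B * D1)))); last by rewrite mul1r.
  apply: ler_pM => //; rewrite ?invsqrt_ge0 ?invsqrt_le1//.
  (* For a fixed contraction p the sum over i is, by symmetry, a row sum of rho and hence bounded by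
     B times the bound on the moments; bounding the n terms one by one would cost a factor n. *)
  rewrite exchange_big /=.
  apply: (@le_trans _ _ ((size s)%:R * (B * D1))); last first.
    by rewrite ler_wpM2r ?mulr_ge0// ler_nat.
  apply: (le_trans (ler_norm_sum _ _ _)).
  rewrite -size_picks -sum1_size natr_sum mulr_suml.
  rewrite [leLHS]big_seq [leRHS]big_seq; apply: ler_sum => p ps; rewrite mul1r.
  under eq_bigr do rewrite rhoC.
  apply: norm_sum_row_le => // j.
  have sp : (size p.2 <= d)%N := leq_trans (ltnW (mem_picks_size ps)) sd.
  apply: (bnd _ C1) => //; apply: (H1 _ _ _ Wm) => //=; move: (size p.2) sp => z; lia.
rewrite -[X in `|X|]mulrA normrM ger0_norm ?mulr_ge0// ler_wpM2l ?mulr_ge0//.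
rewrite normrM ger0_norm ?sqr_ge0//.
(* Two factors n^(-1/2) pay for the n rows, each of which contributes at most B * D2. *)
apply: (@le_trans _ _ ((Num.sqrt n%:R)^-1 ^+ 2 * (n%:R * (B * D2)))).
  rewrite ler_wpM2l ?sqr_ge0//.
  rewrite -[leRHS]sum_ord_const.
  apply: (le_trans (ler_norm_sum _ _ _)); apply: ler_sum => i _.
  apply: norm_sum_row_le => // j.
  apply: (bnd _ C2) => //; apply: (H2 _ _ _ Wm) => //=; lia.
by rewrite (mulrA (_ ^+ 2) n%:R) ler_piMl ?mulr_ge0// invsqrt_sqr_le1.
Qed.

(** Remove the factors of [s] one at a time: contractions inside [s] act alike on both terms of the
    difference, and a contraction with a factor of S_n^k costs n^(-1/2) times a bounded row sum. *)
Lemma wick_decorrelated k d : exists2 C : R, 0 <= C &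
  forall n (rho : 'I_n -> 'I_n -> R) m, wick_class rho m ->
    forall s, (size s <= d)%N ->
    `|m s k - m s 0 * m [::] k| <= C / Num.sqrt n%:R.
Proof.
elim: d => [|d [C C0 IH]].
  exists 0 => // n rho m [W _ _] [|//] _.
  by rewrite (wick0 W) mul1r subrr normr0 mul0r.
have [C1 C10 H1] := wick_bounded k.-1 (d + 3).
have dC : 0 <= d%:R * (B * C) by rewrite !mulr_ge0.
have kC : 0 <= 4 * k%:R * (B * C1) by rewrite !mulr_ge0.
exists (d%:R * (B * C) + 4 * k%:R * (B * C1)); first by rewrite addr_ge0.
move=> n rho m Wm [|i s] /=; have [W rhoC rB] := Wm.
  rewrite (wick0 W) mul1r subrr normr0 => _.
  by rewrite mulr_ge0 ?invsqrt_ge0// addr_ge0.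
rewrite ltnS => sd; rewrite (wick_cons0 W) (wick_cons W) mulr_suml.
rewrite addrAC -sumrB [leRHS]mulrDl.
apply: (le_trans (ler_normD _ _)); apply: lerD.
  under eq_bigr do rewrite -mulrA -mulrBr.
  apply: (@le_trans _ _ ((size s)%:R * (B * (C / Num.sqrt n%:R)))).
    apply: (@norm_sum_picks_le _ _ rho B _ i s (fun t => m t k - m t 0 * m [::] k)) => //.
      by rewrite mulr_ge0 ?invsqrt_ge0.
    by move=> t ts; apply: (IH _ _ _ Wm) => //; exact: leq_trans (ltnW ts) sd.
  by rewrite -!mulrA ler_wpM2r ?mulr_ge0 ?invsqrt_ge0// ler_nat.
rewrite [X in `|X|]mulrAC normrM [X in _ * X]ger0_norm ?invsqrt_ge0//.
rewrite ler_wpM2r ?invsqrt_ge0// normrM ger0_norm ?mulr_ge0// ler_wpM2l ?mulr_ge0//.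
apply: norm_sum_row_le => // j; apply: (H1 _ _ _ Wm) => //=; lia.
Qed.

(** For the empty monomial only the double sum of [wick_powS] is left. Decorrelating its monomials
    of degree 6 and 4 from S_n^(k-1) turns it into the same double sum at power 0, which
    [wick_varianceE] evaluates. *)
Lemma wick_pow_recursion k : exists2 C : R, 0 <= C &
  forall n (rho : 'I_n -> 'I_n -> R) m, wick_class rho m ->
    `|m [::] k.+1 - k%:R * wick_variance rho * m [::] k.-1| <= C / Num.sqrt n%:R.
Proof.
have [C C0 H] := wick_decorrelated k.-1 6.
pose D := C + 3 * B * C.
have D0 : 0 <= D by rewrite addr_ge0 ?mulr_ge0.
exists (4 * k%:R * (B * D)); first by rewrite !mulr_ge0.
move=> n rho m Wm; have [W rhoC rB] := Wm.
rewrite (wick_powS W) /= big1 ?mulr0 ?add0r; last by move=> i _; rewrite big_nil.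
rewrite -(wick_varianceE W rhoC).
set a := (Num.sqrt n%:R)^-1; set mk := m [::] k.-1.
set s2 := \sum_i _; set s1 := \sum_i _.
have -> : 4 * k%:R * a ^+ 2 * s1 - k%:R * (4 * a ^+ 2 * s2) * mk =
   4 * k%:R * (a ^+ 2 * (s1 - s2 * mk)) by ring.
rewrite normrM ger0_norm ?mulr_ge0// -[leRHS]mulrA ler_wpM2l ?mulr_ge0//.
rewrite normrM ger0_norm ?sqr_ge0//.
apply: (@le_trans _ _ (a ^+ 2 * (n%:R * (B * (D * a))))); last first.
  rewrite !mulrA -[leRHS]mulrA -[leLHS]mulrA ler_wpM2r ?mulr_ge0 ?invsqrt_ge0//.
  by rewrite ler_piMl// invsqrt_sqr_le1.
rewrite ler_wpM2l ?sqr_ge0// /s1 /s2 mulr_suml -sumrB.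
rewrite -[leRHS]sum_ord_const.
apply: (le_trans (ler_norm_sum _ _ _)); apply: ler_sum => i _.
rewrite mulr_suml -sumrB.
under eq_bigr do rewrite -[X in _ - X]mulrA -mulrBr.
apply: norm_sum_row_le => //; first by rewrite mulr_ge0 ?invsqrt_ge0.
move=> j.
set x := m _ k.-1; set y := m _ k.-1; set x0 := m _ 0; set y0 := m _ 0.
have -> : x + 3 * rho i i * y - (x0 + 3 * rho i i * y0) * mk =
  (x - x0 * mk) + 3 * rho i i * (y - y0 * mk) by ring.
rewrite /D [leRHS]mulrDl; apply: (le_trans (ler_normD _ _)); apply: lerD.
  by apply: (H _ _ _ Wm).
rewrite !normrM (ger0_norm (ler0n _ 3)) -!mulrA ler_wpM2l// ler_pM//.
  exact: row_bounded_le.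
by apply: (H _ _ _ Wm).
Qed.

End moment_bounds.

(** * Random variables with all moments *)

Section all_moments.
Context {R : realType} {dT : measure_display} {T : measurableType dT}.
Variable P : probability T R.

Definition all_moments (X : T -> R) :=
  measurable_fun setT X /\ forall k, P.-integrable setT (EFin \o (fun w => X w ^+ k)).

Lemma all_moments_meas X : all_moments X -> measurable_fun setT X.
Proof. by case. Qed.

Lemma all_moments_int X : all_moments X -> P.-integrable setT (EFin \o X).
Proof. by case=> _ /(_ 1%N). Qed.

(** Since |x y| <= x^2 + y^2, the product is dominated by the moments of orders 2a and 2b of the
    factors. Closure of [all_moments] under products and sums rests on this. *)
Lemma integrable_mulX X Y a b : all_moments X -> all_moments Y ->
  P.-integrable setT (EFin \o (fun w => X w ^+ a * Y w ^+ b)).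
Proof.
move=> [mX iX] [mY iY].
have iXY : P.-integrable setT
    (EFin \o (fun w => X w ^+ (2 * a) + Y w ^+ (2 * b))).
  have := integrableD measurableT (iX (2 * a)%N) (iY (2 * b)%N).
  by apply: eq_integrable.
apply: le_integrable iXY => //.
  by apply/measurable_EFinP; apply: measurable_funM; apply: measurable_funX.
move=> w _ /=; rewrite lee_fin.
rewrite !(mulnC 2) !exprM normrM.
rewrite [leRHS]ger0_norm ?addr_ge0 ?sqr_ge0//.
rewrite -(real_normK (num_real (X w ^+ a))) -(real_normK (num_real (Y w ^+ b))).
move: `|X w ^+ a| `|Y w ^+ b| (normr_ge0 (X w ^+ a)) (normr_ge0 (Y w ^+ b)) => x y x0 y0.
have := sqr_ge0 (x - y).
by nra.
Qed.

Lemma all_momentsM X Y : all_moments X -> all_moments Y ->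
  all_moments (fun w => X w * Y w).
Proof.
move=> aX aY; split; first by apply: measurable_funM; exact: all_moments_meas.
move=> k; apply: eq_integrable (integrable_mulX k k aX aY) => // w _ /=.
by rewrite exprMn.
Qed.

Lemma all_momentsD X Y : all_moments X -> all_moments Y ->
  all_moments (fun w => X w + Y w).
Proof.
move=> aX aY; split; first by apply: measurable_funD; exact: all_moments_meas.
move=> k.
have : P.-integrable setT (fun w => \sum_(i <- index_enum 'I_k.+1)
    ('C(k, i)%:R%:E * (X w ^+ (k - i) * Y w ^+ i)%:E))%E.
  apply: integrable_sum => // i _; apply: integrableZl => //.
  exact: integrable_mulX.
apply: eq_integrable => // w _ /=.
rewrite exprDn -sumEFin; apply: eq_bigr => i _.
by rewrite -EFinM mulr_natl.
Qed.

Lemma all_moments_cst c : all_moments (fun=> c).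
Proof.
split; first exact: measurable_cst.
by move=> k; exact: finite_measure_integrable_cst.
Qed.

Lemma all_momentsZ c X : all_moments X -> all_moments (fun w => c * X w).
Proof. exact/all_momentsM/all_moments_cst. Qed.

Lemma all_momentsX X k : all_moments X -> all_moments (fun w => X w ^+ k).
Proof.
move=> aX; elim: k => [|k IH].
  under eq_fun do rewrite expr0; exact: all_moments_cst.
under eq_fun do rewrite exprS; exact: all_momentsM.
Qed.

Lemma all_moments_sum (I : Type) (r : seq I) (X : I -> T -> R) :
  (forall i, all_moments (X i)) -> all_moments (fun w => \sum_(i <- r) X i w).
Proof.
move=> aX; elim: r => [|i r IH].
  under eq_fun do rewrite big_nil; exact: all_moments_cst.
under eq_fun do rewrite big_cons; exact: all_momentsD.
Qed.

Lemma expectD X Y : all_moments X -> all_moments Y ->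
  \int[P]_w (X w + Y w) = \int[P]_w X w + \int[P]_w Y w.
Proof. by move=> aX aY; rewrite RintegralD//; exact: all_moments_int. Qed.

Lemma expectB X Y : all_moments X -> all_moments Y ->
  \int[P]_w (X w - Y w) = \int[P]_w X w - \int[P]_w Y w.
Proof. by move=> aX aY; rewrite RintegralB//; exact: all_moments_int. Qed.

Lemma expectZ c X : all_moments X ->
  \int[P]_w (c * X w) = c * \int[P]_w X w.
Proof. by move=> aX; rewrite RintegralZl//; exact: all_moments_int. Qed.

Lemma expect_cst (c : R) : \int[P]_w c = c.
Proof. by rewrite Rintegral_cst// [X in fine X](probability_setT P) mulr1. Qed.

Lemma expect_sum (I : Type) (r : seq I) (X : I -> T -> R) :
  (forall i, all_moments (X i)) ->
  \int[P]_w (\sum_(i <- r) X i w) = \sum_(i <- r) \int[P]_w X i w.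
Proof.
move=> aX; elim: r => [|i r IH].
  by under eq_Rintegral do rewrite big_nil; rewrite big_nil expect_cst.
under eq_Rintegral do rewrite big_cons.
by rewrite big_cons expectD ?IH//; exact: all_moments_sum.
Qed.

End all_moments.

Lemma horner_inj (R : realType) (p q : {poly R}) : (forall s, p.[s] = q.[s]) -> p = q.
Proof.
move=> pq; apply/eqP; rewrite -subr_eq0; apply/eqP.
apply: (@roots_geq_poly_eq0 _ _ [seq i%:R | i <- iota 0 (size (p - q))]).
- by apply/allP => x _; rewrite /root hornerD hornerN pq subrr.
- by rewrite map_inj_uniq ?iota_uniq// => i j /eqP; rewrite eqr_nat => /eqP.
- by rewrite size_map size_iota.
Qed.

Fixpoint std_moment (R : realType) (k : nat) : R :=
  match k with
  | 0 => 1
  | 1 => 0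
  | k'.+2 => k'.+1%:R * std_moment R k'
  end.

(** Here [v] is the variance. The truncated half [k./2] is harmless for odd k, where [std_moment]
    vanishes. *)
Definition gauss_moment (R : realType) (k : nat) (v : R) : R :=
  std_moment R k * v ^+ k./2.

Lemma gauss_momentSS (R : realType) k (v : R) :
  gauss_moment k.+2 v = k.+1%:R * v * gauss_moment k v.
Proof. by rewrite /gauss_moment /= exprS; ring. Qed.

Lemma std_moment_odd (R : realType) k : odd k -> std_moment R k = 0.
Proof.
elim/ltn_ind: k => -[//|[//|k]] IH /=; rewrite negbK => ok.
by rewrite IH ?mulr0.
Qed.

(** * Gaussian integration by parts *)

Section wick.
Context {R : realType} {dT : measure_display} {T : measurableType dT}.
Variable P : probability T R.
Local Notation all_moments := (all_moments P).

(** Joint Gaussianity is encoded by the moments of all linear forms. The condition makes sense for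
    singular [rho], and it is a system of identities between polynomials in the coefficients [a],
    which is what integration by parts exploits. *)
Definition gaussian_family n (rho : 'I_n -> 'I_n -> R) (Y : 'I_n -> T -> R) :=
  (forall i, all_moments (Y i)) /\
  forall (a : 'I_n -> R) k, \int[P]_w (\sum_i a i * Y i w) ^+ k =
    gauss_moment k (\sum_i \sum_j a i * a j * rho i j).

(** Perturbing a linear form L by s X makes the expectation a polynomial in s. Its first coefficient
    is the derivative at 0, obtained without interchanging derivative and integral. *)
Lemma expect_pow_poly (Z L X : T -> R) N :
  all_moments Z -> all_moments L -> all_moments X ->
  exists F : {poly R}, [/\
    forall s, \int[P]_w (Z w * (L w + s * X w) ^+ N) = F.[s],
    F`_0 = \int[P]_w (Z w * L w ^+ N) &
    F`_1 = N%:R * \int[P]_w (Z w * (X w * L w ^+ N.-1))].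
Proof.
move=> aZ aL aX.
exists (\poly_(j < N.+1) ('C(N, j)%:R * \int[P]_w (Z w * (L w ^+ (N - j) * X w ^+ j)))).
have aM j : all_moments (fun w => Z w * (L w ^+ (N - j) * X w ^+ j)).
  by apply: all_momentsM => //; apply: all_momentsM; apply: all_momentsX.
split.
- move=> s; rewrite horner_poly.
  transitivity (\int[P]_w \sum_(j < N.+1)
     'C(N, j)%:R * s ^+ j * (Z w * (L w ^+ (N - j) * X w ^+ j))).
    apply: eq_Rintegral => w _; rewrite exprDn mulr_sumr; apply: eq_bigr => j _.
    by rewrite -mulr_natl exprMn; ring.
  rewrite expect_sum; last by move=> j; exact: all_momentsZ.
  by apply: eq_bigr => j _; rewrite expectZ// mulrAC.
- rewrite coef_poly /= bin0 mul1r subn0.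
  by under eq_Rintegral do rewrite expr0 mulr1.
- rewrite coef_poly; case: N {aM} => [|N]; first by rewrite /= mul0r.
  rewrite /= bin1 subn1 /=; congr (_ * _).
  by apply: eq_Rintegral => w _; rewrite expr1 (mulrC (X w)).
Qed.

Section family.
Variables (n : nat) (rho : 'I_n -> 'I_n -> R) (Y : 'I_n -> T -> R).
Hypothesis GF : gaussian_family rho Y.
Hypothesis rhoC : forall i j, rho i j = rho j i.
Variable i : 'I_n.

Let lin (a : 'I_n -> R) w := \sum_j a j * Y j w.
Let dlin (a : 'I_n -> R) := \sum_j a j * rho i j.

Let all_moments_Y j : all_moments (Y j).
Proof. by case: GF. Qed.

Let all_moments_lin a : all_moments (lin a).
Proof. by apply: all_moments_sum => j; exact: all_momentsZ. Qed.

Let shift (a : 'I_n -> R) j s k := a k + s * (k == j)%:R.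

Let linD a j s w : lin (shift a j s) w = lin a w + s * Y j w.
Proof.
rewrite /lin /shift; under eq_bigr do rewrite mulrDl.
rewrite big_split /=; congr (_ + _).
rewrite (bigD1 j) //= eqxx mulr1 big1 ?addr0// => k /negPf ->.
by rewrite mulr0 mul0r.
Qed.

Let dlinD a j s : dlin (shift a j s) = dlin a + s * rho i j.
Proof.
rewrite /dlin /shift; under eq_bigr do rewrite mulrDl.
rewrite big_split /=; congr (_ + _).
rewrite (bigD1 j) //= eqxx mulr1 big1 ?addr0// => k /negPf ->.
by rewrite mulr0 mul0r.
Qed.

Let qform (a : 'I_n -> R) := \sum_j \sum_k a j * a k * rho j k.

Let qformD a s : qform (shift a i s) = qform a + 2 * dlin a * s + rho i i * s ^+ 2.
Proof.
rewrite /qform.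
have E j k : shift a i s j * shift a i s k * rho j k = a j * a k * rho j k +
   s * ((j == i)%:R * (a k * rho j k)) + s * ((k == i)%:R * (a j * rho j k)) +
   s ^+ 2 * ((j == i)%:R * ((k == i)%:R * rho j k)) by rewrite /shift; ring.
under eq_bigr do under eq_bigr do rewrite E.
have pick1 (f : 'I_n -> R) : \sum_j (j == i)%:R * f j = f i.
  rewrite (bigD1 i) //= eqxx mul1r big1 ?addr0// => k /negPf ->.
  by rewrite mul0r.
under eq_bigr do rewrite !big_split /= -!mulr_sumr !pick1.
rewrite !big_split /= -!mulr_sumr !pick1.
have -> : \sum_j a j * rho j i = dlin a by apply: eq_bigr => j _; rewrite rhoC.
by rewrite -/(dlin a); ring.
Qed.

(* the coefficient of s in E[(l + s Y_i)^(m+1)], computed in two ways *)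
Let wick_base a m : \int[P]_w (Y i w * lin a w ^+ m) =
  m%:R * dlin a * \int[P]_w (lin a w ^+ m.-1).
Proof.
have [F [F1 F2 F3]] := expect_pow_poly m.+1 (all_moments_cst P 1)
  (all_moments_lin a) (all_moments_Y i).
pose q : {poly R} := (qform a)%:P + (2 * dlin a) *: 'X + rho i i *: 'X^2.
(* By Gaussianity the same expectation is, up to a constant, a power of [q], the variance of l + s
   Y_i, which is quadratic in s. *)
have FE : F = std_moment R m.+1 *: q ^+ (m.+1./2).
  apply: horner_inj => s; rewrite -F1 hornerZ horner_exp /q.
  rewrite !hornerD !hornerZ hornerC hornerX hornerXn.
  under eq_Rintegral do rewrite mul1r -linD.
  by rewrite (GF.2 (shift a i s)) /gauss_moment -/(qform _) qformD.
have q0 : q.[0] = qform a.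
  by rewrite /q !hornerD !hornerZ hornerC hornerX hornerXn expr0n /= !mulr0 !addr0.
have dq0 : q^`().[0] = 2 * dlin a.
  rewrite /q !derivD derivC !derivZ derivX derivXn /= expr1 !hornerD hornerC !hornerZ hornerMn hornerC hornerX; ring.
have Fd : F`_1 = F^`().[0] by rewrite horner_coef0 coef_deriv mulr1n.
have E : m.+1%:R * \int[P]_w (1 * (Y i w * lin a w ^+ m)) = std_moment R m.+1 *
    (2 * dlin a * qform a ^+ (m.+1./2).-1 * (m.+1./2)%:R).
  rewrite [LHS](esym F3) Fd FE derivZ hornerZ deriv_exp.
  by rewrite hornerMn hornerM horner_exp q0 dq0 mulr_natr.
have m1 : (m.+1%:R : R) != 0 by rewrite pnatr_eq0.
under [LHS]eq_Rintegral do rewrite -[_ * _]mul1r.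
apply: (mulfI m1); rewrite E {E F1 F2 F3 FE Fd F}.
rewrite (GF.2 a m.-1) -/(qform a) /gauss_moment.
(* For even m both sides vanish, as odd moments or through the factor m = 0; for odd m the truncated
   half of m + 1 is exact. *)
have [om|em] := boolP (odd m); last first.
  rewrite std_moment_odd//= mul0r; case: m em {m1} => [|m] /= em.
    by rewrite !mul0r mulr0.
  by rewrite std_moment_odd ?mul0r ?mulr0//; move: em; rewrite negbK.
case: m om {m1} => [//|m] /= om.
have -> : m.+2%:R = 2 * (m./2).+1%:R :> R.
  by rewrite -natrM mul2n doubleS -[in LHS](odd_double_half m) (negPf om) add0n.
by rewrite -mulr_natr; ring.
Qed.

(** [G'] is to be thought of as the derivative of [G] along [Y i]. The formula for E[Y_i G] alone
    would not pass on to Y_j G; required against every power of every linear form, it does, by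
    [ibpY]. *)
Definition ibp (G G' : T -> R) := [/\ all_moments G, all_moments G' &
  forall a m, \int[P]_w (Y i w * G w * lin a w ^+ m) =
    \int[P]_w (G' w * lin a w ^+ m) +
    m%:R * dlin a * \int[P]_w (G w * lin a w ^+ m.-1)].

Lemma ibp1 : ibp (fun=> 1) (fun=> 0).
Proof.
split; try exact: all_moments_cst.
move=> a m; under [in RHS]eq_Rintegral do rewrite mul0r.
rewrite expect_cst add0r.
under eq_Rintegral do rewrite mulr1.
under [in RHS]eq_Rintegral do rewrite mul1r.
exact: wick_base.
Qed.

(** In the formula for G at the power m + 1, replace l by l + s Y_j and compare the coefficients of
    s. Expanding the powers produces the factor Y_j, the change s rho_ij of [dlin] produces the new
    term rho_ij G, and m + 1 cancels. *)
Lemma ibpY j G G' : ibp G G' -> ibp (fun w => Y j w * G w)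
  (fun w => Y j w * G' w + rho i j * G w).
Proof.
move=> [aG aG' H]; split.
- exact: all_momentsM.
- by apply: all_momentsD; [exact: all_momentsM|exact: all_momentsZ].
move=> a m.
have aYG : all_moments (fun w => Y i w * G w) by exact: all_momentsM.
have [F [F1 _ F3]] := expect_pow_poly m.+1 aYG (all_moments_lin a) (all_moments_Y j).
have [F' [F'1 _ F'3]] := expect_pow_poly m.+1 aG' (all_moments_lin a) (all_moments_Y j).
have [K [K1 K2 K3]] := expect_pow_poly m aG (all_moments_lin a) (all_moments_Y j).
have FE : F = F' + m.+1%:R *: ((dlin a)%:P + rho i j *: 'X) * K.
  apply: horner_inj => s; rewrite -F1 hornerD hornerM hornerZ hornerD hornerC hornerZ.
  rewrite hornerX -F'1 -K1.
  under eq_Rintegral do rewrite -linD.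
  rewrite H dlinD /=; congr (_ + _).
    by apply: eq_Rintegral => w _; rewrite linD.
  by rewrite (mulrC s); congr (_ * _); apply: eq_Rintegral => w _; rewrite linD.
have := congr1 (fun p : {poly R} => p`_1) FE.
rewrite /= coefD -scalerAl coefZ mulrDl coefD coefCM -scalerAl coefZ coefXM /=.
rewrite F3 F'3 K2 K3 /= -mulrDr.
have m1 : (m.+1%:R : R) != 0 by rewrite pnatr_eq0.
move=> /(mulfI m1) E.
have L1 : \int[P]_w (Y i w * (Y j w * G w) * lin a w ^+ m) =
  \int[P]_w (Y i w * G w * (Y j w * lin a w ^+ m)).
  by apply: eq_Rintegral => w _; ring.
rewrite L1 E.
under [in RHS]eq_Rintegral do rewrite mulrDl.
rewrite expectD; last 2 first.
  by apply: all_momentsM; [exact: all_momentsM|exact: all_momentsX].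
  by apply: all_momentsM; [exact: all_momentsZ|exact: all_momentsX].
under [\int[P]_w (rho i j * G w * _)]eq_Rintegral do rewrite -mulrA.
rewrite expectZ; last by apply: all_momentsM => //; exact: all_momentsX.
rewrite [RHS]addrAC addrA.
congr (_ + _ + _).
  by apply: eq_Rintegral => w _; ring.
rewrite mulrCA mulrA; congr (_ * _).
by apply: eq_Rintegral => w _; ring.
Qed.

Lemma ibpZ c G G' : ibp G G' -> ibp (fun w => c * G w) (fun w => c * G' w).
Proof.
move=> [aG aG' H]; split; try exact: all_momentsZ.
have aL k a : all_moments (fun w => lin a w ^+ k) by exact: all_momentsX.
move=> a m.
under eq_Rintegral do rewrite (mulrCA _ c) -mulrA.
under [in RHS]eq_Rintegral do rewrite -mulrA.
under [X in _ + _ * X]eq_Rintegral do rewrite -mulrA.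
rewrite !expectZ; try by do 2 ?apply: all_momentsM.
by rewrite H; ring.
Qed.

Lemma ibpD G G' H H' : ibp G G' -> ibp H H' ->
  ibp (fun w => G w + H w) (fun w => G' w + H' w).
Proof.
move=> [aG aG' HG] [aH aH' HH]; split; try exact: all_momentsD.
have aL k a : all_moments (fun w => lin a w ^+ k) by exact: all_momentsX.
move=> a m.
under eq_Rintegral do rewrite mulrDr mulrDl.
under [in RHS]eq_Rintegral do rewrite mulrDl.
under [X in _ + _ * X]eq_Rintegral do rewrite mulrDl.
rewrite !expectD; try by do 2 ?apply: all_momentsM.
by rewrite HG HH; ring.
Qed.

(* [e'] plays the role of the derivative of [e] along [Y i]. *)
Definition ibp_mul (e e' : T -> R) := forall G G', ibp G G' ->
  ibp (fun w => e w * G w) (fun w => e w * G' w + e' w * G w).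

Lemma eq_ibp_mul e e' f f' : e =1 f -> e' =1 f' -> ibp_mul e e' -> ibp_mul f f'.
Proof. by move=> /funext -> /funext ->. Qed.

Lemma ibp_mul_cst c : ibp_mul (fun=> c) (fun=> 0).
Proof.
move=> G G' /(ibpZ c); under [X in ibp _ X -> _]eq_fun do rewrite -[_ * _]addr0.
by under [X in _ -> ibp _ X]eq_fun do rewrite mul0r.
Qed.

Lemma ibp_mul_Y j : ibp_mul (Y j) (fun=> rho i j).
Proof. exact: ibpY. Qed.

Lemma ibp_mulD e e' f f' : ibp_mul e e' -> ibp_mul f f' ->
  ibp_mul (fun w => e w + f w) (fun w => e' w + f' w).
Proof.
move=> He Hf G G' HG; have := ibpD (He _ _ HG) (Hf _ _ HG).
under [X in ibp X _ -> _]eq_fun do rewrite -mulrDl.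
under [X in ibp _ X -> _]eq_fun do rewrite addrACA -!mulrDl.
by [].
Qed.

Lemma ibp_mulM e e' f f' : ibp_mul e e' -> ibp_mul f f' ->
  ibp_mul (fun w => e w * f w) (fun w => e w * f' w + e' w * f w).
Proof.
move=> He Hf G G' HG; have := He _ _ (Hf _ _ HG).
under [X in ibp X _ -> _]eq_fun do rewrite mulrA.
under [X in ibp _ X -> _]eq_fun do rewrite mulrDr !mulrA -addrA -mulrDl.
by [].
Qed.

Lemma ibp_mulZ c e e' : ibp_mul e e' -> ibp_mul (fun w => c * e w) (fun w => c * e' w).
Proof.
move=> /(ibp_mulM (ibp_mul_cst c)).
by under [X in ibp_mul _ X -> _]eq_fun do rewrite mul0r addr0.
Qed.

Lemma ibp_mul_sum (I : Type) (r : seq I) (e e' : I -> T -> R) :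
  (forall j, ibp_mul (e j) (e' j)) ->
  ibp_mul (fun w => \sum_(j <- r) e j w) (fun w => \sum_(j <- r) e' j w).
Proof.
move=> He; elim: r => [|j r IH].
  by apply: eq_ibp_mul (ibp_mul_cst 0) => w; rewrite big_nil.
by apply: eq_ibp_mul (ibp_mulD (He j) IH) => w; rewrite big_cons.
Qed.

Lemma ibp_mulX k e e' : ibp_mul e e' ->
  ibp_mul (fun w => e w ^+ k) (fun w => k%:R * e w ^+ k.-1 * e' w).
Proof.
move=> He; elim: k => [|k IH].
  by apply: eq_ibp_mul (ibp_mul_cst 1) => w; rewrite ?expr0 ?mul0r.
apply: eq_ibp_mul (ibp_mulM He IH) => w; first by rewrite exprS.
case: k {IH} => [|k] /=; first by rewrite !expr0; ring.
by rewrite exprS -[k.+2%:R]natr1; ring.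
Qed.

Lemma ibp_expect e e' : ibp_mul e e' ->
  \int[P]_w (Y i w * e w) = \int[P]_w e' w.
Proof.
move=> /(_ _ _ ibp1) [_ _ /(_ (fun=> 0) 0)].
under [X in X = _ -> _]eq_Rintegral do rewrite expr0 !mulr1.
under [X in _ = X + _ -> _]eq_Rintegral do rewrite expr0 !mulr1 mulr0 add0r.
by move=> ->; rewrite !mul0r addr0.
Qed.

End family.
End wick.

Section wick_family.
Context {R : realType} {dT : measure_display} {T : measurableType dT}.
Variable P : probability T R.
Variables (n : nat) (rho : 'I_n -> 'I_n -> R) (Y : 'I_n -> T -> R).

Definition monomial s (w : T) := \prod_(j <- s) Y j w.

Definition quartic_sum (w : T) : R :=
  (Num.sqrt n%:R)^-1 * \sum_i (Y i w ^+ 4 - 3 * rho i i ^+ 2).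

Definition mixed_moment s k := \int[P]_w (monomial s w * quartic_sum w ^+ k).

Hypothesis GF : gaussian_family P rho Y.
Hypothesis rhoC : forall i j, rho i j = rho j i.

Lemma all_moments_monomial s : all_moments P (monomial s).
Proof.
elim: s => [|j s IH].
  rewrite [monomial _](_ : _ = fun=> 1); first exact: all_moments_cst.
  by apply/funext => w; rewrite /monomial big_nil.
rewrite [monomial _](_ : _ = fun w => Y j w * monomial s w).
  by apply: all_momentsM => //; case: GF.
by apply/funext => w; rewrite /monomial big_cons.
Qed.

Lemma all_moments_quartic_sum : all_moments P quartic_sum.
Proof.
apply: all_momentsZ; apply: all_moments_sum => i.
apply: all_momentsD; last exact: all_moments_cst.
by apply: all_momentsX; case: GF.
Qed.

Lemma ibp_mul_monomial i s : ibp_mul P rho Y i (monomial s)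
  (fun w => \sum_(p <- picks s) rho i p.1 * monomial p.2 w).
Proof.
elim: s => [|j s IH] /=.
  by apply: eq_ibp_mul (ibp_mul_cst GF 1) => w;
    rewrite /monomial big_nil.
apply: eq_ibp_mul (ibp_mulM (ibp_mul_Y GF j) IH) => w.
  by rewrite /monomial big_cons.
rewrite big_cons big_map /= addrC mulr_sumr; congr (_ + _).
by apply: eq_bigr => p _; rewrite /monomial big_cons mulrCA.
Qed.

Lemma ibp_mul_quartic_sum i : ibp_mul P rho Y i quartic_sum
  (fun w => (Num.sqrt n%:R)^-1 * \sum_j (4 * Y j w ^+ 3 * rho i j)).
Proof.
apply: ibp_mulZ => //; apply: ibp_mul_sum => // j.
have := ibp_mulD GF (ibp_mulX GF 4 (ibp_mul_Y GF (i := i) j))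
  (ibp_mul_cst GF (- (3 * rho j j ^+ 2))).
by apply: eq_ibp_mul => w //=; rewrite addr0.
Qed.

(** The product rule of [ibp_mul] for the monomial times the k-th power of [quartic_sum] gives
    [wick_cons]; expanding one factor [quartic_sum] gives [wick_pow]. *)
Lemma wick_mixed_moment : wick_moments rho mixed_moment.
Proof.
have aM := all_moments_monomial.
have aS k : all_moments P (fun w => quartic_sum w ^+ k) by exact/all_momentsX/all_moments_quartic_sum.
split.
- rewrite /mixed_moment -[RHS](expect_cst P 1); apply: eq_Rintegral => w _.
  by rewrite /monomial big_nil expr0 mulr1.
- move=> i s k.
  have := ibp_expect GF rhoC (ibp_mulM (@ibp_mul_monomial i s) (ibp_mulX GF k (@ibp_mul_quartic_sum i))).
  rewrite /mixed_moment => E.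
  transitivity (\int[P]_w (Y i w * (monomial s w * quartic_sum w ^+ k))).
    by apply: eq_Rintegral => w _; rewrite /monomial big_cons mulrA.
  rewrite E.
  transitivity (\int[P]_w (\sum_(p <- picks s) rho i p.1 * (monomial p.2 w * quartic_sum w ^+ k)
    + 4 * k%:R / Num.sqrt n%:R * \sum_j rho i j * (monomial [:: j, j, j & s] w * quartic_sum w ^+ k.-1))).
    apply: eq_Rintegral => w _; rewrite addrC; congr (_ + _).
      by rewrite mulr_suml; apply: eq_bigr => p _; rewrite mulrA.
    rewrite !mulr_sumr; apply: eq_bigr => j _.
    by rewrite /monomial !big_cons; ring.
  rewrite expectD; last 2 first.
    by apply: all_moments_sum => p; apply: all_momentsZ; exact: all_momentsM.
    by apply: all_momentsZ; apply: all_moments_sum => p; apply: all_momentsZ; exact: all_momentsM.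
  congr (_ + _).
    rewrite expect_sum; last by move=> p; apply: all_momentsZ; exact: all_momentsM.
    by apply: eq_bigr => p _; rewrite expectZ//; exact: all_momentsM.
  rewrite expectZ; last first.
    by apply: all_moments_sum => p; apply: all_momentsZ; exact: all_momentsM.
  congr (_ * _).
  rewrite expect_sum; last by move=> p; apply: all_momentsZ; exact: all_momentsM.
  by apply: eq_bigr => p _; rewrite expectZ//; exact: all_momentsM.
- move=> s k; rewrite /mixed_moment.
  transitivity (\int[P]_w ((Num.sqrt n%:R)^-1 * \sum_i (monomial [:: i, i, i, i & s] w * quartic_sum w ^+ k -
     3 * rho i i ^+ 2 * (monomial s w * quartic_sum w ^+ k)))).
    apply: eq_Rintegral => w _; rewrite exprS {1}/quartic_sum.
    rewrite mulrCA -!mulrA; congr (_ * _); rewrite mulr_suml; apply: eq_bigr => i _.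
    by rewrite /monomial !big_cons; ring.
  have aI i : all_moments P (fun w => monomial [:: i, i, i, i & s] w * quartic_sum w ^+ k).
    exact: all_momentsM.
  have aI' i : all_moments P (fun w => 3 * rho i i ^+ 2 * (monomial s w * quartic_sum w ^+ k)).
    by apply: all_momentsZ; exact: all_momentsM.
  have aB i : all_moments P (fun w => monomial [:: i, i, i, i & s] w * quartic_sum w ^+ k -
     3 * rho i i ^+ 2 * (monomial s w * quartic_sum w ^+ k)).
    apply: all_momentsD => //.
    under eq_fun do rewrite -mulN1r.
    exact: all_momentsZ.
  rewrite expectZ; last exact: all_moments_sum.
  rewrite expect_sum//; congr (_ * _); apply: eq_bigr => i _.
  rewrite expectB// expectZ//; exact: all_momentsM.
Qed.

Lemma mixed_moment_pow k : mixed_moment [::] k = \int[P]_w (quartic_sum w ^+ k).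
Proof.
by apply: eq_Rintegral => w _; rewrite /monomial big_nil mul1r.
Qed.

End wick_family.

(** * Moments of the normal law *)

Section derive_lambda.
Context {R : realType}.
Implicit Types (f g : R -> R) (x : R).
Lemma is_derive_mulfun f g x a b : is_derive x 1 f a -> is_derive x 1 g b ->
  is_derive x 1 (fun y => f y * g y) (a * g x + f x * b).
Proof.
move=> df dg; apply: (is_derive_eq (is_deriveM df dg)).
by rewrite /GRing.scale /= addrC (mulrC a).
Qed.

Lemma is_derive_cmul c f x a : is_derive x 1 f a ->
  is_derive x 1 (fun y => c * f y) (c * a).
Proof. by move=> df; exact: (is_deriveZ c df). Qed.

Lemma is_derive_expn n x : is_derive x 1 (fun y : R => y ^+ n) (n%:R * x ^+ n.-1).
Proof.
have := @is_deriveX R R^o id n x 1 1 (is_derive_id _ _).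
rewrite [X in is_derive _ _ X _](_ : _ = fun y : R => y ^+ n).
  by move=> h; apply: (is_derive_eq h); rewrite /GRing.scale /= mulr1.
elim: n => [|n IH]; first by apply/funext => y; rewrite !expr0.
by rewrite exprS IH; apply/funext => y; rewrite exprS.
Qed.
End derive_lambda.

Lemma is_derive_normal_pdf (R : realType) (s x : R) : s != 0 ->
  is_derive x 1 (normal_pdf 0 s) (- x / s ^+ 2 * normal_pdf 0 s x).
Proof.
move=> s0; rewrite normal_pdfE//.
pose c := - (s ^+ 2 *+ 2)^-1.
have E y : normal_fun 0 s y = expR (c * y ^+ 2).
  by rewrite /normal_fun subr0; congr expR; rewrite /c; ring.
under [X in is_derive _ _ X _]eq_fun do rewrite E.
have h := is_derive_cmul (normal_peak s)
  (is_derive1_comp (is_derive_expR _) (is_derive_cmul c (is_derive_expn 2 x))).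
apply: (is_derive_eq h).
rewrite /= E expr1; move: (expR _) => e; rewrite /c -(mulr_natr (s ^+ 2)); field.
exact: s0.
Qed.

Section normal_moments.
Context {R : realType}.
Local Notation mu := (@lebesgue_measure R).

Lemma ge0_integral_normal_prob (m s : R) (f : R -> \bar R) :
  measurable_fun setT f -> (forall x, (0 <= f x)%E) ->
  (\int[normal_prob m s]_x f x = \int[mu]_x (f x * (normal_pdf m s x)%:E))%E.
Proof.
move=> mf f0.
rewrite -(Radon_Nikodym_SigmaFinite.change_of_variables (normal_prob_dominates m s))//.
have dom := normal_prob_dominates m s.
apply: ae_eq_integral => //.
- apply: emeasurable_funM => //; apply: (measurable_int mu).
  exact: Radon_Nikodym_SigmaFinite.f_integrable.
- by apply: emeasurable_funM => //; apply/measurable_EFinP; exact: measurable_normal_pdf.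
- apply: ae_eqe_mul2l; apply: integral_ae_eq => //.
  + exact: Radon_Nikodym_SigmaFinite.f_integrable.
  + by apply/measurable_EFinP; exact: measurable_normal_pdf.
  + by move=> E _ mE; rewrite -Radon_Nikodym_SigmaFinite.f_integral.
Qed.

Lemma integral_normal_prob (m s : R) (f : R -> \bar R) :
  (normal_prob m s).-integrable setT f ->
  (\int[normal_prob m s]_x f x = \int[mu]_x (f x * (normal_pdf m s x)%:E))%E.
Proof.
move=> intf; have mf := measurable_int _ intf.
have dom := normal_prob_dominates m s.
rewrite -(Radon_Nikodym_change_of_variables dom)//.
apply: ae_eq_integral => //.
- exact: emeasurable_funM.
- by apply: emeasurable_funM => //; apply/measurable_EFinP; exact: measurable_normal_pdf.
- apply: ae_eqe_mul2l; apply: integral_ae_eq => //.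
  + exact: Radon_Nikodym_integrable.
  + by apply/measurable_EFinP; exact: measurable_normal_pdf.
  + by move=> E _ mE; rewrite -Radon_Nikodym_integral.
Qed.

(** Split exp(-x^2/(2 s^2)) = exp(-y) exp(-x^2/(8 s^2)) with y = 3 x^2/(8 s^2); the power of x is
    absorbed by y^(k+1)/(k+1)! <= exp(y). This domination gives both the integrability and the decay
    of the boundary terms below. *)
Lemma even_power_normal_pdf_le (s : R) k : s != 0 -> exists2 C : R, 0 <= C &
  forall x, x ^+ (2 * k.+1) * normal_pdf 0 s x <= C * normal_pdf 0 (2 * s) x.
Proof.
move=> s0; have s20 : 2 * s != 0 by rewrite mulf_neq0.
have s2 : 0 < s ^+ 2 by rewrite exprn_even_gt0.
pose b := k.+1`!%:R * (8 * s ^+ 2 / 3) ^+ k.+1.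
have b0 : 0 <= b by rewrite /b mulr_ge0// exprn_ge0// divr_ge0// mulr_ge0// ltW.
exists (b * (normal_peak s / normal_peak (2 * s))).
  by rewrite mulr_ge0// divr_ge0// normal_peak_ge0.
move=> x; rewrite !normal_pdfE// /normal_fun !subr0.
have p0 := normal_peak_gt0 s0; have p20 := normal_peak_gt0 s20.
have -> : b * (normal_peak s / normal_peak (2 * s)) * (normal_peak (2 * s) *
    expR (- x ^+ 2 / ((2 * s) ^+ 2 *+ 2))) =
  normal_peak s * (b * expR (- x ^+ 2 / ((2 * s) ^+ 2 *+ 2))).
  by field; rewrite gt_eqF.
rewrite mulrCA ler_pM2l//.
pose y := x ^+ 2 * (3 / (8 * s ^+ 2)).
have y0 : 0 <= y by rewrite mulr_ge0 ?sqr_ge0// divr_ge0// mulr_ge0// ltW.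
have -> : - x ^+ 2 / (s ^+ 2 *+ 2) = - y + - x ^+ 2 / ((2 * s) ^+ 2 *+ 2).
  rewrite /y -(mulr_natr (s ^+ 2)) -(mulr_natr ((2 * s) ^+ 2)) exprMn; field; exact: s0.
rewrite expRD mulrA ler_wpM2r ?expR_ge0// expRN ler_pdivrMr ?expR_gt0//.
have := expR_ge1Dxn k y0; rewrite -lerBrDl => h.
have {}h : y ^+ k.+1 / k.+1`!%:R <= expR y by apply: le_trans h _; rewrite gerBl.
have -> : x ^+ (2 * k.+1) = b * (y ^+ k.+1 / k.+1`!%:R).
  rewrite /b /y exprM -mulrA mulrCA (mulrC _ (_ ^+ k.+1 / _)) -!mulrA.
  rewrite mulVf ?mulr1 ?pnatr_eq0 -?lt0n ?fact_gt0// -exprMn; congr (_ ^+ _).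
  by field; exact: s0.
by rewrite ler_wpM2l.
Qed.

Lemma integrable_power_normal_pdf (s : R) k : s != 0 ->
  mu.-integrable setT (EFin \o (fun x => x ^+ k * normal_pdf 0 s x)).
Proof.
move=> s0; have [C C0 HC] := even_power_normal_pdf_le k s0.
have i1 : mu.-integrable setT (EFin \o (normal_pdf (0:R) s)) by exact: integrable_normal_pdf.
have i2 : mu.-integrable setT (fun x => C%:E * (normal_pdf (0:R) (2 * s) x)%:E)%E.
  by apply: integrableZl => //; exact: integrable_normal_pdf.
apply: le_integrable (integrableD measurableT i1 i2) => //.
  apply/measurable_EFinP; apply: measurable_funM; last exact: measurable_normal_pdf.
  exact: measurable_funX.
move=> x _ /=; rewrite lee_fin normrM.
have p0 := normal_pdf_ge0 0 s x; have p20 := normal_pdf_ge0 0 (2 * s) x.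
rewrite (ger0_norm p0) [leRHS]ger0_norm ?addr_ge0 ?mulr_ge0//.
apply: (le_trans _ (lerD (lexx _) (HC x))).
rewrite -[X in _ <= X + _]mul1r -mulrDl ler_wpM2r// normrX.
rewrite mulnC exprM -(real_normK (num_real (x ^+ k.+1))) normrX.
have [x1|x1] := leP `|x| 1.
  by rewrite (le_trans (exprn_ile1 _ _ x1))// lerDl sqr_ge0.
rewrite -exprM (le_trans (_ : _ <= `|x| ^+ (k.+1 * 2)))//.
  by rewrite ler_eXn2l//; lia.
by rewrite lerDr.
Qed.

(** The difference of the two integrands is the derivative of F(x) = - s^2 x^k pdf(x). Its integral
    over [-n-1, n+1] is a boundary term tending to 0, and dominated convergence passes to the whole
    line. For k = 0 the factor k annihilates the last integral. *)
Lemma normal_pdf_moment_rec (s : R) k : s != 0 ->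
  \int[mu]_x (x ^+ k.+1 * normal_pdf 0 s x) =
  k%:R * s ^+ 2 * \int[mu]_x (x ^+ k.-1 * normal_pdf 0 s x).
Proof.
move=> s0.
pose f x : R := x ^+ k.+1 * normal_pdf 0 s x - k%:R * s ^+ 2 * (x ^+ k.-1 * normal_pdf 0 s x).
pose F x : R := - s ^+ 2 * (x ^+ k * normal_pdf 0 s x).
have i1 := integrable_power_normal_pdf k.-1 s0.
have i2 := integrable_power_normal_pdf k.+1 s0.
have i1' : mu.-integrable setT (EFin \o (fun x => k%:R * s ^+ 2 * (x ^+ k.-1 * normal_pdf 0 s x))).
  by apply: eq_integrable (integrableZl measurableT (k%:R * s ^+ 2) i1).
have iF : mu.-integrable setT (EFin \o f) 
  by apply: eq_integrable (integrableB measurableT i2 i1').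
apply/eqP; rewrite -subr_eq0 -RintegralZl// -RintegralB//; apply/eqP; rewrite -/f.
have dF (x : R) : is_derive x 1 F (f x).
  have h := is_derive_cmul (- s ^+ 2)
    (is_derive_mulfun (is_derive_expn k x) (is_derive_normal_pdf x s0)).
  apply: (is_derive_eq h).
  by rewrite /f !exprS /=; field; exact: s0.
have cf : continuous f.
  move=> x; apply: cvgB.
    apply: cvgM; first exact: exprn_continuous.
    exact: continuous_normal_pdf.
  apply: cvgM; first exact: cvg_cst.
  apply: cvgM; first exact: exprn_continuous.
  exact: continuous_normal_pdf.
pose A (n : nat) : set R := `[- n.+1%:R, n.+1%:R]%classic.
have FTC n : (\int[mu]_(x in A n) (f x)%:E = (F n.+1%:R - F (- n.+1%:R))%:E)%E.
  rewrite (@continuous_FTC2 _ f F) ?EFinB//.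
  - by rewrite gtrN ?ltr0n.
  - exact: continuous_subspaceT.
  - split.
    + by move=> x _; case: (dF x).
    + by apply: cvg_at_right_filter; apply/differentiable_continuous/derivable1_diffP; case: (dF (- n.+1%:R)).
    + by apply: cvg_at_left_filter; apply/differentiable_continuous/derivable1_diffP; case: (dF n.+1%:R).
  - by move=> x _; rewrite derive1E; apply: derive_val.
have [C C0 HC] := even_power_normal_pdf_le k s0.
have s20 : 2 * s != 0 by rewrite mulf_neq0.
pose D := s ^+ 2 * (C * normal_peak (2 * s)).
(* For |x| = n + 1 >= 1, multiplying by n + 1 raises |x|^k to |x|^(k+1) <= x^(2(k+1)), to which [HC]
   applies; decay of order 1/n suffices. *)
have FD n (x : R) : `|x| = n.+1%:R -> `|F x| <= D * n.+1%:R^-1.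
  move=> xn; rewrite /F !normrM normrN (ger0_norm (sqr_ge0 s)) /D -[leRHS]mulrA ler_wpM2l ?sqr_ge0//.
  rewrite (ger0_norm (normal_pdf_ge0 _ _ _)) normrX ler_pdivlMr ?ltr0n// mulrAC xn -exprSr.
  apply: (@le_trans _ _ (x ^+ (2 * k.+1) * normal_pdf 0 s x)).
    rewrite ler_wpM2r ?normal_pdf_ge0// exprM -(real_normK (num_real x)) -exprM xn.
    by rewrite ler_weXn2l ?ler1n//; lia.
  apply: le_trans (HC x) _; rewrite ler_wpM2l//.
  exact: normal_pdf_ub.
have F0 : (fun n => (F n.+1%:R - F (- n.+1%:R))%:E) @ \oo --> 0%:E.
  apply/cvg_EFin; first by near=> n.
  have h : (fun n => 2 * D * n.+1%:R^-1) @ \oo --> (0 : R).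
    rewrite -[X in _ --> X](mulr0 (2 * D)); apply: cvgM; first exact: cvg_cst.
    exact: cvg_harmonic.
  have h' : (fun n => - (2 * D * n.+1%:R^-1)) @ \oo --> (0 : R).
    by rewrite -oppr0; exact: cvgN.
  apply: squeeze_cvgr h' h; near=> n; rewrite -ler_norml /=.
  apply: (le_trans (ler_normB _ _)); rewrite -mulrA mulr_natl mulr2n.
  by apply: lerD; apply: FD; rewrite ?normrN ger0_norm.
have cvI : (fun n => \int[mu]_(x in A n) (f x)%:E)%E @ \oo --> (\int[mu]_x (f x)%:E)%E.
  under eq_fun do rewrite integral_mkcond.
  have mf := measurable_int _ iF.
  have mA n : measurable_fun [set: measurableTypeR R] ((EFin \o f) \_ (A n)).
    have mAn : measurable (A n : set (measurableTypeR R)) by exact: measurable_itv.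
    exact: (iffLR (measurable_restrictT (EFin \o f) mAn) (measurable_funTS mf)).
  have cA : {ae mu, forall x, setT x -> (fun n => ((EFin \o f) \_ (A n)) x) @ \oo --> (f x)%:E}.
    apply: aeW => x _; apply: cvg_near_cst; near=> n.
    rewrite patchE ifT// inE /A /= in_itv /= -ler_norml.
    rewrite (@le_trans _ _ n%:R) ?ler_nat//; near: n; exact: nbhs_infty_ger.
  have dA : {ae mu, forall x n, setT x -> (`|((EFin \o f) \_ (A n)) x| <= `|(f x)%:E|)%E}.
    apply: aeW => x n _; rewrite patchE; case: ifPn => // _.
    by rewrite abse0 abse_ge0.
  by have [_ _] := @dominated_convergence _ (measurableTypeR R) R mu setT
    measurableT _ _ _ mA mf cA (integrable_abse iF) dA.
have F0' : (fun n => \int[mu]_(x in A n) (f x)%:E)%E @ \oo --> 0%E.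
  by under eq_fun do rewrite FTC.
have := cvg_unique _ cvI F0'.
by rewrite /Rintegral => ->.
Unshelve. all: by end_near. Qed.

Lemma ge0_normal_prob_integrable (s : R) (f : R -> R) : measurable_fun setT f ->
  mu.-integrable setT (EFin \o (fun x => f x * normal_pdf 0 s x)) ->
  (normal_prob 0 s).-integrable setT (EFin \o f).
Proof.
move=> mf /integrableP[_ fi]; apply/integrableP; split; first exact/measurable_EFinP.
rewrite ge0_integral_normal_prob//; last first.
  by apply/measurableT_comp => //; exact/measurable_EFinP.
move: fi; under [X in (X < _)%E -> _]eq_integral do
  rewrite /= normrM (ger0_norm (normal_pdf_ge0 _ _ _)) EFinM.
by [].
Qed.

Lemma normal_prob_all_moments (s : R) : s != 0 ->
  all_moments (normal_prob 0 s) (@id R).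
Proof.
move=> s0; split => // k.
apply: ge0_normal_prob_integrable; first exact: exprn_measurable.
exact: integrable_power_normal_pdf.
Qed.

Lemma normal_prob_moment (s : R) k : s != 0 ->
  \int[normal_prob 0 s]_x (x ^+ k) = gauss_moment k (s ^+ 2).
Proof.
move=> s0.
have E j : \int[normal_prob 0 s]_x (x ^+ j) = \int[mu]_x (x ^+ j * normal_pdf 0 s x).
  rewrite /Rintegral integral_normal_prob//.
  exact: (normal_prob_all_moments s0).2.
elim/ltn_ind: k => -[_|[_|k IH]].
- under eq_Rintegral do rewrite expr0.
  by rewrite expect_cst /gauss_moment /= expr0 mulr1.
- rewrite E normal_pdf_moment_rec// !mul0r.
  by rewrite /gauss_moment /= mul0r.
- rewrite E normal_pdf_moment_rec// -E IH//.
  by rewrite gauss_momentSS.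
Qed.

(** [gauss_law] is a bare set function, whereas integration lemmas ask for a bundled probability.
    For v = 0 it is a Dirac mass, whose moments fit [gauss_moment] because 0^0 = 1. *)
Lemma gauss_law_measure (v : R) : 0 <= v ->
  exists m : probability (measurableTypeR R) R,
    [/\ (m : set R -> \bar R) = gauss_law v, all_moments m (@id R) &
        forall k, \int[m]_x (x ^+ k) = gauss_moment k v].
Proof.
move=> v0; rewrite /gauss_law; case: ifPn => [/eqP ->|vn0].
  exists (@dirac _ (measurableTypeR R) 0 R); split => //.
  - split; first exact: measurable_id.
    move=> k; apply/integrableP; split; first by apply/measurable_EFinP; exact: exprn_measurable.
    rewrite integral_dirac//; last by do 2 apply/measurableT_comp => //; exact: exprn_measurable.
    by rewrite diracT mul1e ltry.
  - move=> k; rewrite /Rintegral integral_dirac//; last first.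
      by apply/measurable_EFinP; exact: exprn_measurable.
    rewrite diracT mul1e /= /gauss_moment; case: k => [|[|k]] /=.
    + by rewrite !expr0 mulr1.
    + by rewrite expr1 mul0r.
    + by rewrite exprS mul0r exprS mul0r mulr0.
have s0 : Num.sqrt v != 0 by rewrite sqrtr_eq0 -ltNge lt_def vn0.
exists (normal_prob 0 (Num.sqrt v)); split => //.
- exact: normal_prob_all_moments.
- by move=> k; rewrite normal_prob_moment// sqr_sqrtr.
Qed.

Lemma gauss_law_moments d (T : measurableType d) (P : probability T R) (X : T -> R) (v : R) :
  0 <= v -> measurable_fun setT X ->
  (forall A : set R, measurable A -> P (X @^-1` A) = gauss_law v A) ->
  all_moments P X /\ forall k, \int[P]_w (X w ^+ k) = gauss_moment k v.
Proof.
move=> v0 mX lawX; pose X' : T -> measurableTypeR R := X.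
have mX' : measurable_fun setT X' := mX.
have [m [mE [_ im] mm]] := gauss_law_measure v0.
have mf k : measurable_fun [set: measurableTypeR R] (EFin \o (fun x : R => x ^+ k)).
  by apply/measurable_EFinP; exact: exprn_measurable.
have pm (A : set (measurableTypeR R)) : measurable A -> A `<=` setT -> m A = pushforward P X' A.
  by move=> mA _; rewrite /pushforward lawX// -mE.
have E (f : measurableTypeR R -> \bar R) : (\int[m]_x f x = \int[pushforward P X']_x f x)%E.
  by rewrite (eq_measure_integral (pushforward P X') pm).
have aX : all_moments P X.
  split => // k; apply/integrableP; split.
    by apply/measurable_EFinP; exact: measurable_funX.
  have /integrableP[_] := im k.
  rewrite E.
  by rewrite ge0_integral_pushforward//; apply: measurableT_comp => //; exact: mf.
split => // k; rewrite -mm /Rintegral.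
rewrite E.
have [_ iX] := aX.
by rewrite (integral_pushforward mX' (D := setT) (mf k) (iX k) measurableT).
Qed.

End normal_moments.

(** * From convergence of moments to convergence in law *)

Section calculus.
Context {R : realType}.
Implicit Types (f g : R -> R) (x : R).

(** The second point y may leave the segment, as f is continuous within the whole line at each point
    of the segment; [delta_method] uses such a y. *)
Lemma unif_continuous_segment f (a b e : R) :
  (forall x, x \in `[a, b] -> {for x, continuous f}) -> 0 < e ->
  exists2 d, 0 < d & forall x y, x \in `[a, b] -> `|x - y| < d -> `|f x - f y| < e.
Proof.
move=> cf e0.
have H : \forall d \near 0^'+, `[a, b]%classic `<=` (fun x => forall y, `|x - y| < d -> `|f x - f y| < e).
  apply: (iffLR (compact_near_coveringP _) (@segment_compact R a b) _ _
    (fun d x => forall y, `|x - y| < d -> `|f x - f y| < e)).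
  move=> x xab; have /cvgrPdist_lt /(_ _ (divr_gt0 e0 (ltr0n _ 2))) := cf x xab.
  move=> /nbhs_ballP[d /= d0 H].
  exists (ball x (d / 2), [set t | t < d / 2]) => /=.
    split; first by apply: nbhsx_ballx; rewrite divr_gt0.
    by apply: nbhs_right_lt; rewrite divr_gt0.
  move=> [z t] /= []; rewrite /ball /= => xz td y zy.
  have h1 : `|f x - f z| < e / 2.
    by apply: H; rewrite /ball /= (lt_trans xz)// ltr_pdivrMr// ltr_pMr// ltr1n.
  have h2 : `|f x - f y| < e / 2.
    apply: H; rewrite /ball /= (_ : x - y = (x - z) + (z - y)); last by ring.
    by rewrite (le_lt_trans (ler_normD _ _))// [d]splitr ltrD// (lt_trans zy).
  rewrite (_ : f z - f y = (f x - f y) - (f x - f z)); last by ring.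
  by rewrite (le_lt_trans (ler_normB _ _))// [e]splitr ltrD.
have : \forall d \near 0^'+, 0 < d /\ `[a, b]%classic `<=` (fun x => forall y, `|x - y| < d -> `|f x - f y| < e).
  by apply: filterI H; exact: nbhs_right_gt.
move=> /filter_ex[d [d0 Hd]].
by exists d => // x y xab; exact: Hd.
Qed.

Lemma le0_of_derive f f' : (forall x, is_derive x 1 f (f' x)) -> f 0 = 0 ->
  (forall x, 0 <= x -> 0 <= f' x) -> forall x, 0 <= x -> 0 <= f x.
Proof.
move=> df f0 f'0 x; rewrite le_eqVlt => /predU1P[<-|x0]; first by rewrite f0.
have cf : {within `[0, x], continuous f}.
  apply: continuous_subspaceT => y; apply/differentiable_continuous/derivable1_diffP.
  by case: (df y).
have [c] := MVT x0 (fun y _ => df y) cf.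
rewrite in_itv /= f0 !subr0 => /andP[c0 _] ->.
by rewrite mulr_ge0 ?f'0// ltW.
Qed.

(** Induction over the shifted family of derivatives: the bound at order N controls the derivative
    of the remainder at order N + 1, and [le0_of_derive] integrates this inequality from 0. *)
Lemma taylor_bound_ge0 N : forall (f : nat -> R -> R) (M : R),
  (forall k x, is_derive x 1 (f k) (f k.+1 x)) -> (forall x, `|f N x| <= M) ->
  forall x, 0 <= x ->
  `|f 0 x - \sum_(k < N) f k 0 * (x ^+ k / k`!%:R)| <= M * (x ^+ N / N`!%:R).
Proof.
elim: N => [|N IH] f M df fM x x0.
  by rewrite big_ord0 subr0 expr0 fact0 divr1 mulr1.
have dpow k (y : R) : is_derive y 1 (fun y : R => y ^+ k.+1 / k.+1`!%:R) (y ^+ k / k`!%:R).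
  have h := is_derive_cmul (k.+1`!%:R^-1) (is_derive_expn k.+1 y).
  rewrite [X in is_derive _ _ X _](_ : _ = fun y => k.+1`!%:R^-1 * y ^+ k.+1).
    apply: (is_derive_eq h); rewrite factS natrM /=; field.
    by rewrite nat1r !pnatr_eq0 -lt0n fact_gt0.
  by apply/funext => z; rewrite mulrC.
pose h y := f 0 y - \sum_(k < N.+1) f k 0 * (y ^+ k / k`!%:R).
pose h' y := f 1 y - \sum_(k < N) f k.+1 0 * (y ^+ k / k`!%:R).
have dh (y : R) : is_derive y 1 h (h' y).
  have ds : is_derive y 1 (fun z => \sum_(k < N.+1) f k 0 * (z ^+ k / k`!%:R))
      (\sum_(k < N) f k.+1 0 * (y ^+ k / k`!%:R)).
    elim: (N) => [|m IHm].
      rewrite [X in is_derive _ _ X _](_ : _ = cst (f 0%N 0)); last first.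
        by apply/funext => z; rewrite big_ord_recl big_ord0 addr0 expr0 fact0 divr1 mulr1.
      by rewrite big_ord0; exact: is_derive_cst.
    rewrite [X in is_derive _ _ X _](_ : _ = (fun z => \sum_(k < m.+1) f k 0 * (z ^+ k / k`!%:R)) +
       (fun z => f m.+1 0 * (z ^+ m.+1 / m.+1`!%:R))); last first.
      by apply/funext => z; rewrite big_ord_recr.
    rewrite [X in is_derive _ _ _ X]big_ord_recr /=.
    exact: is_deriveD IHm (is_derive_cmul _ (dpow m y)).
  exact: is_deriveB (df 0 y) ds.
have h0 : h 0 = 0.
  rewrite /h big_ord_recl expr0 fact0 divr1 mulr1 big1 ?addr0 ?subrr// => k _.
  by rewrite exprS mul0r mul0r mulr0.
have h'b y : 0 <= y -> `|h' y| <= M * (y ^+ N / N`!%:R).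
  exact: (IH (fun k => f k.+1) M).
pose p y : R := M * (y ^+ N.+1 / N.+1`!%:R).
have dp (y : R) : is_derive y 1 p (M * (y ^+ N / N`!%:R)) := is_derive_cmul M (dpow N y).
have p0 : p 0 = 0 by rewrite /p exprS mul0r mul0r mulr0.
rewrite -/(h x) -/(p x) ler_norml; apply/andP; split.
  rewrite -subr_ge0 opprK.
  apply: (@le0_of_derive (fun y => h y + p y)) (fun y => h' y + M * (y ^+ N / N`!%:R)) _ _ _ _ x0.
  - by rewrite h0 p0 addr0.
  - by move=> y /h'b; rewrite ler_norml -subr_ge0 opprK => /andP[].
rewrite -subr_ge0.
apply: (@le0_of_derive (fun y => p y - h y)) (fun y => M * (y ^+ N / N`!%:R) - h' y) _ _ _ _ x0.
- by rewrite h0 p0 subrr.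
- by move=> y /h'b; rewrite ler_norml subr_ge0 => /andP[].
Qed.

(** Writing the derivative as a phase shift by pi / 2 keeps all derivatives in one family, in which
    the k-th is bounded by |t|^k. *)
Lemma is_derive_cos_affine (t phi x : R) :
  is_derive x 1 (fun y => cos (t * y + phi)) (t * cos (t * x + (phi + pi / 2))).
Proof.
have h : is_derive x 1 (fun y => t * y + phi) t.
  have h1 := is_deriveD (is_derive_cmul t (is_derive_id x (1 : R))) (is_derive_cst phi x (1 : R)).
  by apply: (is_derive_eq h1); rewrite mulr1 addr0.
have h2 := @is_derive1_comp R cos (fun y => t * y + phi) x _ _ (is_derive_cos _) h.
apply: (is_derive_eq h2); rewrite addrA cosDpihalf; ring.
Qed.

(** The order is even so that the remainder, without absolute values, is a multiple of x^(2N) and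
    integrates to a moment. *)
Lemma cos_affine_taylor (t phi : R) N : exists c : nat -> R, forall x,
  `|cos (t * x + phi) - \sum_(k < 2 * N) c k * x ^+ k| <=
  (t * x) ^+ (2 * N) / (2 * N)`!%:R.
Proof.
pose f k (x : R) : R := t ^+ k * cos (t * x + (phi + k%:R * (pi / 2))).
pose g k (x : R) : R := (- t) ^+ k * cos (- t * x + (phi + k%:R * (pi / 2))).
have df u k x : is_derive x 1 (fun x => u ^+ k * cos (u * x + (phi + k%:R * (pi / 2))))
    (u ^+ k.+1 * cos (u * x + (phi + k.+1%:R * (pi / 2)))).
  apply: (is_derive_eq (is_derive_cmul (u ^+ k) (is_derive_cos_affine u _ x))).
  rewrite exprSr -mulrA; congr (_ * (_ * cos (_ + _))).
  by rewrite -[k.+1%:R]natr1; ring.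
have fb u k x : `|u ^+ k * cos (u * x + (phi + k%:R * (pi / 2)))| <= `|u| ^+ k.
  by rewrite normrM normrX ler_piMr ?exprn_ge0// ler_norml cos_geN1 cos_le1.
exists (fun k => f k 0 / k`!%:R) => x.
have -> : cos (t * x + phi) = f 0 x by rewrite /f expr0 mul1r mul0r addr0.
have ev (y : R) : `|y| ^+ (2 * N) = y ^+ (2 * N).
  by rewrite !exprM real_normK ?num_real.
have [x0|x0] := leP 0 x.
  have := taylor_bound_ge0 (df t) (fb t (2 * N)%N) x0.
  have -> : (t * x) ^+ (2 * N) / (2 * N)`!%:R = `|t| ^+ (2 * N) * (x ^+ (2 * N) / (2 * N)`!%:R).
    by rewrite ev exprMn mulrA.
  apply: le_trans.
  rewrite le_eqVlt; apply/orP; left; apply/eqP; congr (`|_ - _|).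
  by apply: eq_bigr => k _; rewrite -/(f k 0); ring.
(* For negative x the expansion is applied to -t and -x; the signs (-1)^k cancel in pairs. *)
have x0' : 0 <= - x by rewrite oppr_ge0 ltW.
have := taylor_bound_ge0 (df (- t)) (fb (- t) (2 * N)%N) x0'.
have -> : (t * x) ^+ (2 * N) / (2 * N)`!%:R = `|- t| ^+ (2 * N) * ((- x) ^+ (2 * N) / (2 * N)`!%:R).
  by rewrite ev mulrA -exprMn mulrNN.
apply: le_trans.
rewrite le_eqVlt; apply/orP; left; apply/eqP; congr (`|_ - _|).
  by rewrite /f !expr0 mulrNN.
apply: eq_bigr => k _; rewrite /f !mulr0 exprNn [(- x) ^+ _]exprNn.
have : (-1 : R) ^+ k * (-1) ^+ k = 1 by rewrite -exprMn mulrNN mulr1 expr1n.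
move: ((-1) ^+ k) (cos _) => s c s1.
transitivity (s * s * (t ^+ k * c / k`!%:R * x ^+ k)); last by ring.
by rewrite s1 mul1r.
Qed.

End calculus.

Lemma integrable_bounded {R : realType} d (T : measurableType d) (P : probability T R)
    (g : T -> R) B : measurable_fun setT g -> (forall w, `|g w| <= B) ->
  P.-integrable setT (EFin \o g).
Proof.
move=> mg gB; apply: (@le_integrable _ _ _ _ _ _ _ (EFin \o cst B)) => //.
- exact/measurable_EFinP.
- by move=> w _ /=; rewrite lee_fin (le_trans (gB w))// ler_norm.
- exact: finite_measure_integrable_cst.
Qed.

(** Serves the truncation arguments below: n tends to infinity at a fixed truncation level K, and
    only then does K. *)
Lemma squeeze_family {R : realType} (e : nat -> R) (dl : nat -> R) :
  (forall K, exists2 d : nat -> R, (\forall n \near \oo, `|e n| <= d n) & d @ \oo --> dl K) ->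
  dl @ \oo --> (0 : R) -> e @ \oo --> (0 : R).
Proof.
move=> H dl0; apply/cvgrPdist_lt => eps eps0.
have e2 : 0 < eps / 2 by rewrite divr_gt0.
move/cvgrPdist_lt : dl0 => /(_ _ e2) [K _ /(_ K (leqnn K))].
rewrite sub0r normrN => dK; have [d ed /cvgrPdist_lt /(_ _ e2)] := H K.
apply: filterS2 ed => n edn dn; rewrite sub0r normrN (le_lt_trans edn)//.
have -> : d n = dl K - (dl K - d n) by ring.
rewrite [eps]splitr (le_lt_trans (ler_norm _))// (le_lt_trans (ler_normB _ _))//.
exact: ltrD.
Qed.

Lemma cvg_scale {R : realType} (c : R) (u : nat -> R) (l : R) :
  u @ \oo --> l -> (fun n => c * u n) @ \oo --> c * l.
Proof. by move=> ul; apply: cvgM => //; exact: cvg_cst. Qed.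

Section method_of_moments.
Context {R : realType} {dT : measure_display} {T : measurableType dT}.
Variables (P : probability T R) (X : nat -> T -> R).
Variable m : probability (measurableTypeR R) R.
Hypothesis aX : forall n, all_moments P (X n).
Hypothesis am : all_moments m (@id R).
Hypothesis cvX : forall k, (fun n => \int[P]_w (X n w ^+ k)) @ \oo --> \int[m]_x (x ^+ k).
Hypothesis growth : forall t : R,
  (fun N => t ^+ (2 * N) / (2 * N)`!%:R * \int[m]_x (x ^+ (2 * N))) @ \oo --> (0 : R).

Definition cvg_expect (g : R -> R) := [/\ measurable_fun setT g,
  exists B, forall x, `|g x| <= B &
  (fun n => \int[P]_w g (X n w)) @ \oo --> \int[m]_x g x].

Let mX n : measurable_fun setT (X n).
Proof. by case: (aX n). Qed.

Let intX (g : R -> R) n : measurable_fun setT g -> (exists B, forall x, `|g x| <= B) ->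
  P.-integrable setT (EFin \o (fun w => g (X n w))).
Proof.
by move=> mg [B gB]; apply: integrable_bounded (fun w => gB (X n w)); exact: measurableT_comp.
Qed.

Let intm (g : R -> R) : measurable_fun setT g -> (exists B, forall x, `|g x| <= B) ->
  m.-integrable setT (EFin \o g).
Proof. by move=> mg [B gB]; exact: (@integrable_bounded R _ (measurableTypeR R) m g B mg gB). Qed.

Lemma cvg_expectZD c g h : cvg_expect g -> cvg_expect h ->
  cvg_expect (fun x => c * g x + h x).
Proof.
move=> [mg bg cg] [mh bh ch]; split.
- by apply: measurable_funD => //; apply: measurable_funM.
- have [B gB] := bg; have [B' hB] := bh; exists (`|c| * B + B') => x.
  by rewrite (le_trans (ler_normD _ _))// lerD// normrM ler_wpM2l.
- have mc : measurable_fun setT (fun x => c * g x) by exact: measurable_funM.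
  have bc : exists B, forall x, `|c * g x| <= B.
    by have [B gB] := bg; exists (`|c| * B) => x; rewrite normrM ler_wpM2l.
  have E n : \int[P]_w (c * g (X n w) + h (X n w)) =
      c * \int[P]_w g (X n w) + \int[P]_w h (X n w).
    by rewrite RintegralD// ?RintegralZl//; [exact: intX|exact: intX mc bc|exact: intX].
  have -> : \int[m]_x (c * g x + h x) = c * \int[m]_x g x + \int[m]_x h x.
    by rewrite RintegralD// ?RintegralZl//; [exact: intm|exact: intm mc bc|exact: intm].
  under eq_fun do rewrite E.
  by apply: cvgD => //; apply: cvgM => //; exact: cvg_cst.
Qed.

Lemma cvg_expect_cst c : cvg_expect (fun=> c).
Proof.
split; first exact: measurable_cst.
  by exists `|c|.
rewrite (expect_cst P) (expect_cst m); exact: cvg_cst.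
Qed.

Lemma cvg_expectZ c g : cvg_expect g -> cvg_expect (fun x => c * g x).
Proof.
move=> /cvg_expectZD /(_ (cvg_expect_cst 0)) => /(_ c).
by under eq_fun do rewrite addr0.
Qed.

(** Under either law the cosine differs from its Taylor polynomial by at most t^(2N)/(2N)! times the
    moment of order 2N. The polynomial part and the moment in the remainder converge by [cvX];
    [growth] removes the remainder as N grows. *)
Lemma cvg_expect_cos t phi : cvg_expect (fun x => cos (t * x + phi)).
Proof.
have mc : measurable_fun [set: R] (fun x : R => cos (t * x + phi)).
  apply: continuous_measurable_fun => x.
  apply: (@continuous_comp _ _ _ (fun x => t * x + phi) cos); last exact: continuous_cos.
  by apply: cvgD; [apply: cvgM; [exact: cvg_cst|exact: cvg_id]|exact: cvg_cst].
have bc : exists B : R, forall x, `|cos (t * x + phi)| <= B.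
  by exists 1 => x; rewrite ler_norml cos_geN1 cos_le1.
split => //; apply/subr_cvg0.
pose tl N := t ^+ (2 * N) / (2 * N)`!%:R.
have approx d' (T' : measurableType d') (Q : probability T' R) (Y : T' -> R) N (c : nat -> R) :
    all_moments Q Y ->
    (forall x, `|cos (t * x + phi) - \sum_(k < 2 * N) c k * x ^+ k| <=
       (t * x) ^+ (2 * N) / (2 * N)`!%:R) ->
  `|\int[Q]_w cos (t * Y w + phi) - \sum_(k < 2 * N) c k * \int[Q]_w (Y w ^+ k)| <=
     tl N * \int[Q]_w (Y w ^+ (2 * N)).
  move=> aY Hc.
  have aYk k : all_moments Q (fun w => c k * Y w ^+ k) by exact/all_momentsZ/all_momentsX.
  have aS : all_moments Q (fun w => \sum_(k < 2 * N) c k * Y w ^+ k) by exact: all_moments_sum.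
  have iC : Q.-integrable setT (EFin \o (fun w => cos (t * Y w + phi))).
    have [B HB] := bc; apply: integrable_bounded (fun w => HB (Y w)).
    by apply: (measurableT_comp mc); case: aY.
  have -> : \sum_(k < 2 * N) c k * \int[Q]_w (Y w ^+ k) =
      \int[Q]_w (\sum_(k < 2 * N) c k * Y w ^+ k).
    rewrite expect_sum//; apply: eq_bigr => k _.
    by rewrite expectZ//; exact: all_momentsX.
  rewrite -RintegralB//; last exact: all_moments_int.
  rewrite -expectZ; last exact: all_momentsX.
  have iB : Q.-integrable setT (EFin \o (fun w => cos (t * Y w + phi) - \sum_(k < 2 * N) c k * Y w ^+ k)).
    by apply: eq_integrable (integrableB measurableT iC (all_moments_int aS)).
  apply: le_trans (le_normr_Rintegral _ iB) _ => //.
  apply: le_Rintegral => //.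
  - by have := integrable_abse iB; apply: eq_integrable.
  - by apply: all_moments_int; apply: all_momentsZ; exact: all_momentsX.
  - by move=> w _; rewrite (le_trans (Hc _))// exprMn /tl mulrAC.
(* The factor 2: one remainder comes from X n, whose moment of order 2N tends to that of [m], the
   other from [m] itself. *)
apply: (@squeeze_family _ _ (fun N => 2 * (tl N * \int[m]_x (x ^+ (2 * N))))); last first.
  rewrite -[X in _ --> X](mulr0 2); apply: cvgM; first exact: cvg_cst.
  exact: growth.
move=> N; have [c Hc] := cos_affine_taylor t phi N.
pose a n k := \int[P]_w (X n w ^+ k); pose b k := \int[m]_x (x ^+ k).
exists (fun n => tl N * a n (2 * N)%N + tl N * b (2 * N)%N +
   `|\sum_(k < 2 * N) c k * a n k - \sum_(k < 2 * N) c k * b k|).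
  apply: nearW => n; have H1 := approx _ _ P (X n) N c (aX n) Hc.
  have H2 := approx _ _ m (@id R) N c am Hc.
  set s1 := \sum_(k < _) _; set s2 := \sum_(k < _) _.
  set x1 := \int[m]_x _; set x2 := \int[P]_w _.
  have -> : x2 - x1 = ((x2 - s1) - (x1 - s2)) + (s1 - s2) by ring.
  apply: le_trans (ler_normD _ _) _; rewrite lerD2r.
  by apply: le_trans (ler_normB _ _) _; exact: lerD.
have -> : 2 * (tl N * b (2 * N)%N) = tl N * b (2 * N)%N + tl N * b (2 * N)%N + 0.
  by rewrite addr0 mulr_natl mulr2n.
apply: cvgD.
  apply: cvgD; last exact: cvg_cst.
  exact: (cvg_scale (@cvX _)).
rewrite -(normr0 R); apply: cvg_norm; apply/subr_cvg0.
apply: cvg_big => [|k _]; first exact: add_continuous.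
exact: (cvg_scale (@cvX _)).
Qed.

(* The arbitrary frequency [t] makes this class stable under multiplication by cosines. *)
Definition cvg_trig (g : R -> R) :=
  forall t phi, cvg_expect (fun x => g x * cos (t * x + phi)).

Lemma cvg_trig_cst c : cvg_trig (fun=> c).
Proof. by move=> t phi; exact/cvg_expectZ/cvg_expect_cos. Qed.

Lemma cvg_trigZD c g h : cvg_trig g -> cvg_trig h -> cvg_trig (fun x => c * g x + h x).
Proof.
move=> Hg Hh t phi; under eq_fun do rewrite mulrDl -mulrA.
exact: cvg_expectZD.
Qed.

(** Product-to-sum formula: the hypothesis on g is applied at the frequencies s + t and s - t. *)
Lemma cvg_trig_cos g s psi : cvg_trig g -> cvg_trig (fun x => cos (s * x + psi) * g x).
Proof.
move=> Hg t phi.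
have E x : cos (s * x + psi) * g x * cos (t * x + phi) =
  2^-1 * (g x * cos ((s + t) * x + (psi + phi))) +
  2^-1 * (g x * cos ((s - t) * x + (psi - phi))).
  have -> : (s + t) * x + (psi + phi) = (s * x + psi) + (t * x + phi) by ring.
  have -> : (s - t) * x + (psi - phi) = (s * x + psi) - (t * x + phi) by ring.
  by move: (s * x + psi) (t * x + phi) => A B; rewrite cosD cosB; field.
under eq_fun do rewrite E.
by apply: cvg_expectZD => //; exact: cvg_expectZ.
Qed.

Lemma cvg_trig_expect g : cvg_trig g -> cvg_expect g.
Proof.
move=> /(_ 0 0); under eq_fun do rewrite mul0r addr0 cos0 mulr1.
by [].
Qed.

End method_of_moments.

(** * Approximation of bounded continuous functions by trigonometric polynomials *)

Section bernstein.
Context {R : realType}.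

(* [bern n g w] is the expectation of [g] under the binomial law (n, w) *)
Fixpoint bern (n : nat) (g : nat -> R) (w : R) : R :=
  if n is n'.+1 then (1 - w) * bern n' g w + w * bern n' (g \o S) w else g 0%N.

Lemma bernD n g h w : bern n (fun k => g k + h k) w = bern n g w + bern n h w.
Proof. by elim: n g h => [//|n IH] g h /=; rewrite !IH; ring. Qed.

Lemma bernZ n c g w : bern n (fun k => c * g k) w = c * bern n g w.
Proof. by elim: n g => [//|n IH] g /=; rewrite !IH; ring. Qed.

Lemma bern_cst n c w : bern n (fun=> c) w = c.
Proof.
elim: n => [//|n IH] /=.
rewrite (_ : (fun=> c) \o S = (fun=> c))// IH; ring.
Qed.

Lemma bern_le n g h w : 0 <= w <= 1 -> (forall k, g k <= h k) ->
  bern n g w <= bern n h w.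
Proof.
move=> w01; elim: n g h => [|n IH] g h gh /=; first exact: gh.
have /andP[w0 w1] := w01.
by rewrite lerD// ler_wpM2l// ?subr_ge0// IH// => k /=.
Qed.

(** Squared bias plus variance of the binomial law; in the induction a success shifts c by 1. *)
Lemma bern_sqr n c w :
  bern n (fun k => (k%:R - c) ^+ 2) w = (n%:R * w - c) ^+ 2 + n%:R * w * (1 - w).
Proof.
elim: n c => [|n IH] c /=; first by ring.
have -> : (fun k : nat => (k%:R - c) ^+ 2) \o S = fun k : nat => (k%:R - (c - 1)) ^+ 2.
  by apply/funext => k /=; rewrite -natr1; ring.
by rewrite !IH -natr1; ring.
Qed.

(** Bernstein's argument: where k/(n+1) is within d of w the modulus e applies; elsewhere 2B is at
    most 2B times the squared deviation over d^2, whose mean is a binomial variance. *)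
Lemma bern_approx n (h : R -> R) B e d w : 0 <= w <= 1 -> 0 < d -> 0 <= e ->
  (forall v, `|h v| <= B) -> (forall v v', `|v - v'| < d -> `|h v - h v'| <= e) ->
  `|bern n.+1 (fun k => h (k%:R / n.+1%:R)) w - h w| <= e + 2 * B / d ^+ 2 / n.+1%:R.
Proof.
move=> w01 d0 e0 hB hd; have /andP[w0 w1] := w01.
have B0 : 0 <= B := le_trans (normr_ge0 _) (hB 0).
have n0 : (n.+1%:R : R) != 0 by rewrite pnatr_eq0.
pose A := 2 * B / d ^+ 2 / n.+1%:R ^+ 2.
have A0 : 0 <= A by rewrite /A !mulr_ge0// invr_ge0 exprn_ge0// ltW.
have key k : `|h (k%:R / n.+1%:R) - h w| <= e + A * (k%:R - n.+1%:R * w) ^+ 2.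
  have [kd|kd] := ltP `|k%:R / n.+1%:R - w| d.
    by rewrite (le_trans (hd _ _ kd))// lerDl mulr_ge0 ?sqr_ge0.
  apply: (le_trans (ler_normB _ _)); apply: (@le_trans _ _ (2 * B)).
    by rewrite (_ : 2 * B = B + B); [exact: lerD|ring].
  have -> : A * (k%:R - n.+1%:R * w) ^+ 2 = 2 * B * ((k%:R / n.+1%:R - w) ^+ 2 / d ^+ 2).
    by rewrite /A; field; rewrite (gt_eqF d0) nat1r n0.
  rewrite -[leLHS]add0r lerD// ler_peMr ?mulr_ge0// ler_pdivlMr ?exprn_gt0// mul1r.
  by rewrite -(real_normK (num_real (_ - w))) lerXn2r ?nnegrE// ltW.
have bb : bern n.+1 (fun k => e + A * (k%:R - n.+1%:R * w) ^+ 2) w <= e + 2 * B / d ^+ 2 / n.+1%:R.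
  rewrite bernD bern_cst bernZ bern_sqr subrr expr0n add0r lerD2l.
  have -> : A * (n.+1%:R * w * (1 - w)) = 2 * B / d ^+ 2 / n.+1%:R * (w * (1 - w)).
    by rewrite /A; field; rewrite (gt_eqF d0) nat1r n0.
  have C0 : 0 <= 2 * B / d ^+ 2 / n.+1%:R by rewrite !mulr_ge0// invr_ge0// exprn_ge0// ltW.
  by rewrite ler_piMr//; nra.
have -> : bern n.+1 (fun k => h (k%:R / n.+1%:R)) w - h w = bern n.+1 (fun k => h (k%:R / n.+1%:R) + - h w) w.
  by rewrite bernD bern_cst.
apply: le_trans bb; rewrite ler_norml; apply/andP; split.
  rewrite -mulN1r -bernZ; apply: bern_le => // k.
  by have := key k; rewrite ler_norml mulN1r => /andP[].
by apply: bern_le => // k; have := key k; rewrite ler_norml => /andP[].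
Qed.

Lemma bern_norm n g B w : 0 <= w <= 1 -> (forall k, `|g k| <= B) -> `|bern n g w| <= B.
Proof.
move=> w01 gB; rewrite ler_norml -[leLHS](bern_cst n (- B) w) -[X in _ && (_ <= X)](bern_cst n B w).
by rewrite !bern_le// => k; have := gB k; rewrite ler_norml => /andP[].
Qed.

(** This is (1 + sin(a x))/2, a success probability for [bern]; it is written through cos so that
    [cvg_trig_cos] applies. *)
Definition sin_weight (a x : R) : R := 2^-1 + 2^-1 * cos (a * x + - (pi / 2)).

Lemma sin_weight01 a x : 0 <= sin_weight a x <= 1.
Proof.
rewrite /sin_weight; have := cos_geN1 (a * x + - (pi / 2)); have := cos_le1 (a * x + - (pi / 2)).
by move: (cos _) => c c1 c2; lra.
Qed.

Lemma sin_weightE a x : 2 * sin_weight a x - 1 = sin (a * x).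
Proof.
rewrite /sin_weight mulrDr mulrA divff ?pnatr_eq0// mul1r addrAC subrr add0r.
by rewrite cosBpihalf.
Qed.

Lemma clamp_lipschitz (s : R) : 0 < s -> forall y z,
  `|Num.max (- s) (Num.min s y) - Num.max (- s) (Num.min s z)| <= `|y - z|.
Proof.
move=> s0 y z.
have h1 := ler_norm (y - z); have h2 := ler_norm (- (y - z)).
rewrite normrN in h2; move: `|y - z| h1 h2 => D h1 h2; rewrite ler_norml .
case: (leP s y) => hy; case: (leP s z) => hz.
- by case: (leP (- s) s) => ?; case: (leP (- s) s) => ?; lra.
- by case: (leP (- s) s) => ?; case: (leP (- s) z) => ?; lra.
- by case: (leP (- s) y) => ?; case: (leP (- s) s) => ?; lra.
- by case: (leP (- s) y) => ?; case: (leP (- s) z) => ?; lra.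
Qed.

(** On [-M, M] the function f factors through sin(a x), since a = pi/(4 M) keeps a x where sin is
    injective. A Bernstein polynomial in [sin_weight] approximates f there and stays bounded by B
    everywhere, so outside [-M, M] the error is at most 2B <= 2 B x^2/M^2, which second moments
    control. *)
Lemma trig_approx (f : R -> R) B M e : continuous f -> (forall x, `|f x| <= B) ->
  0 < M -> 0 < e -> exists a n g, (forall k, `|g k| <= B) /\
  forall x, `|f x - bern n g (sin_weight a x)| <= e + 2 * B * x ^+ 2 / M ^+ 2.
Proof.
move=> cf fB M0 e0.
have B0 : 0 <= B := le_trans (normr_ge0 _) (fB 0).
have e2 : 0 < e / 2 by rewrite divr_gt0.
have pi0 := @pi_gt0 R.
pose a : R := pi / 4 / M; have a0 : 0 < a by rewrite !divr_gt0.
pose s : R := sin (pi / 4).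
have mono (x y : R) : x \in `[- (pi / 2), pi / 2] -> y \in `[- (pi / 2), pi / 2] ->
    x <= y -> sin x <= sin y.
  by move=> hx hy xy; rewrite leNgt ltr_sin// -leNgt.
have s0 : 0 < s.
  by apply: sin_gt0_pi; lra.
have s1 : s < 1.
  by rewrite -[X in _ < X]sin_pihalf ltr_sin ?in_itv/=; lra.
(* Clamping to [-s, s] with s = sin(pi/4) < 1 stays away from the endpoints of asin and turns
   f(asin(y)/a) into a bounded, uniformly continuous function on the line. *)
pose cl y := Num.max (- s) (Num.min s y).
have clI y : cl y \in `[- s, s].
  rewrite in_itv /= le_max lexx /= ge_max ge_min lexx /= andbT.
  by rewrite (le_trans _ (ltW s0))// oppr_le0 ltW.
have clid y : y \in `[- s, s] -> cl y = y.
  by rewrite in_itv /= => /andP[y1 y2]; rewrite /cl min_r// max_r.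
have clL := clamp_lipschitz s0.
pose q y := f (asin y / a).
have cq y : y \in `[- s, s] -> {for y, continuous q}.
  rewrite in_itv /= => /andP[y1 y2]; apply: continuous_comp; last exact: cf.
  apply: cvgM; last exact: cvg_cst.
  by apply: continuous_asin; lra.
have [d d0 Hd] := unif_continuous_segment cq e2.
pose h v := q (cl (2 * v - 1)).
have hB v : `|h v| <= B by exact: fB.
have hd v v' : `|v - v'| < d / 2 -> `|h v - h v'| <= e / 2.
  move=> vv; rewrite ltW// Hd// (le_lt_trans (clL _ _))//.
  have -> : 2 * v - 1 - (2 * v' - 1) = 2 * (v - v') by ring.
  by rewrite normrM ger0_norm// mulrC -ltr_pdivlMr.
have hE x : `|x| <= M -> h (sin_weight a x) = f x.
  move=> xM; have aM : `|a * x| <= pi / 4.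
    rewrite normrM (gtr0_norm a0) /a mulrAC ler_pdivrMr// ler_wpM2l//.
    by rewrite divr_ge0// ltW.
  move: aM; rewrite ler_norml => /andP[aM1 aM2].
  rewrite /h sin_weightE clid.
    by rewrite /q sinK ?(mulrC a) ?mulfK ?gt_eqF// in_itv /=; lra.
  by rewrite in_itv /= /s -sinN !mono// in_itv /=; lra.
have d20 : 0 < d / 2 by rewrite divr_gt0.
pose C := 2 * B / (d / 2) ^+ 2.
have [n Cn] : exists n : nat, C / n.+1%:R <= e / 2.
  have [n Hn] : exists n : nat, C / (e / 2) <= n.+1%:R.
    exists (Num.truncn (C / (e / 2))); apply/ltW.
    by have := truncnS_gt (C / (e/2)).
  by exists n; rewrite ler_pdivrMr// mulrC -ler_pdivrMr.
exists a, n.+1, (fun k => h (k%:R / n.+1%:R)); split => // x.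
have [xM|xM] := leP `|x| M.
  rewrite distrC -(hE _ xM).
  apply: (le_trans (bern_approx n (sin_weight01 a x) d20 (ltW e2) hB hd)).
  apply: (@le_trans _ _ e); first by rewrite [leRHS]splitr lerD2l.
  by rewrite lerDl mulr_ge0 ?invr_ge0 ?sqr_ge0// mulr_ge0 ?sqr_ge0// mulr_ge0.
apply: (le_trans (ler_normB _ _)); apply: (@le_trans _ _ (2 * B)).
  rewrite (_ : 2 * B = B + B); last by ring.
  apply: lerD => //; apply: bern_norm => //; exact: sin_weight01.
rewrite -[leLHS]add0r lerD ?(ltW e0)// -mulrA ler_peMr ?mulr_ge0//.
rewrite ler_pdivlMr ?exprn_gt0// mul1r -(real_normK (num_real x)).
by rewrite lerXn2r ?nnegrE ?(ltW M0) ?(ltW xM).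
Qed.

End bernstein.

Section moment_limit.
Context {R : realType} {dT : measure_display} {T : measurableType dT}.
Variables (P : probability T R) (X : nat -> T -> R).
Variable m : probability (measurableTypeR R) R.
Hypothesis aX : forall n, all_moments P (X n).
Hypothesis am : all_moments m (@id R).
Hypothesis cvX : forall k, (fun n => \int[P]_w (X n w ^+ k)) @ \oo --> \int[m]_x (x ^+ k).
Hypothesis growth : forall t : R,
  (fun N => t ^+ (2 * N) / (2 * N)`!%:R * \int[m]_x (x ^+ (2 * N))) @ \oo --> (0 : R).

(** Each step of the recursion of [bern] multiplies by [sin_weight] or its complement, that is, by a
    constant plus a multiple of a cosine; [cvg_trig] is stable under both. *)
Lemma cvg_trig_bern a n g : cvg_trig P X m (fun x => bern n g (sin_weight a x)).
Proof.
elim: n g => [|n IH] g /=.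
  exact: (@cvg_trig_cst R _ _ P X m aX am cvX growth).
have E x : (1 - sin_weight a x) * bern n g (sin_weight a x) +
   sin_weight a x * bern n (g \o S) (sin_weight a x) =
   2^-1 * bern n g (sin_weight a x) + (2^-1 * bern n (g \o S) (sin_weight a x) +
    (2^-1 * (cos (a * x + - (pi / 2)) * bern n (g \o S) (sin_weight a x)) +
     (- 2^-1 * (cos (a * x + - (pi / 2)) * bern n g (sin_weight a x)) + 0))).
  rewrite [in X in X * _](_ : sin_weight a x = 2^-1 + 2^-1 * cos (a * x + - (pi / 2)))//.
  rewrite [in X in _ + X * _](_ : sin_weight a x = 2^-1 + 2^-1 * cos (a * x + - (pi / 2)))//.
  by field.
under eq_fun do rewrite E.
apply: (cvg_trigZD aX); first exact: IH.
apply: (cvg_trigZD aX); first exact: IH.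
apply: (cvg_trigZD aX); first exact: (cvg_trig_cos aX a (- (pi / 2)) (IH _)).
apply: (cvg_trigZD aX); first exact: (cvg_trig_cos aX a (- (pi / 2)) (IH _)).
exact: (@cvg_trig_cst R _ _ P X m aX am cvX growth).
Qed.

(** [trig_approx] is used with M = K + 1 and accuracy 1/(K + 1). The trigonometric polynomial G
    stays fixed while n grows, and the convergent second moments govern the term in x^2. *)
Lemma cvg_expect_continuous (f : R -> R) B : continuous f -> (forall x, `|f x| <= B) ->
  (fun n => \int[P]_w f (X n w)) @ \oo --> \int[m]_x f x.
Proof.
move=> cf fB; have B0 : 0 <= B := le_trans (normr_ge0 _) (fB 0).
have mf : measurable_fun [set: R] f by exact: continuous_measurable_fun.
apply/subr_cvg0.
pose b2 := \int[m]_x (x ^+ 2).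
pose D (K : nat) : R := 2 * B / K.+1%:R ^+ 2.
pose dl K := (K.+1%:R^-1 + D K * b2) + (K.+1%:R^-1 + D K * b2).
apply: (@squeeze_family _ _ dl); last first.
  have h1 : (fun K : nat => K.+1%:R^-1 : R) @ \oo --> (0 : R) by exact: cvg_harmonic.
  have h2 : (fun K => D K * b2) @ \oo --> (0 : R).
    rewrite [X in X @ _ --> _](_ : _ = fun K => 2 * B * b2 * (K.+1%:R^-1 * K.+1%:R^-1)); last first.
      by apply/funext => K; rewrite /D -expr2 exprVn mulrAC.
    rewrite -[X in _ --> X](mulr0 (2 * B * b2)); apply: cvg_scale.
    by rewrite -[X in _ --> X](mulr0 0); exact: cvgM.
  have h3 : (fun K => K.+1%:R^-1 + D K * b2) @ \oo --> (0 : R).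
    by rewrite -[X in _ --> X](addr0 0); exact: cvgD.
  by rewrite -[X in _ --> X](addr0 0); exact: cvgD.
move=> K; have K0 : 0 < K.+1%:R :> R by [].
have K0' : 0 < K.+1%:R^-1 :> R by rewrite invr_gt0.
have [a [N [g [gB Hg]]]] := trig_approx cf fB K0 K0'.
pose G x := bern N g (sin_weight a x).
have [mG bG cG] : cvg_expect P X m G := cvg_trig_expect (cvg_trig_bern a N g).
have approx d' (T' : measurableType d') (Q : probability T' R) (Y : T' -> R) :
    all_moments Q Y ->
  `|\int[Q]_w f (Y w) - \int[Q]_w G (Y w)| <= K.+1%:R^-1 + D K * \int[Q]_w (Y w ^+ 2).
  move=> aY; have mY := all_moments_meas aY.
  have iF : Q.-integrable setT (EFin \o (fun w => f (Y w))).
    by apply: integrable_bounded (fun w => fB (Y w)); exact: measurableT_comp.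
  have iG : Q.-integrable setT (EFin \o (fun w => G (Y w))).
    by have [C HC] := bG; apply: integrable_bounded (fun w => HC (Y w)); exact: measurableT_comp.
  have aY2 : all_moments Q (fun w => Y w ^+ 2) by exact: all_momentsX.
  rewrite -RintegralB// -(expectZ _ aY2) -[X in X + _](expect_cst Q).
  rewrite -expectD; [|exact: all_moments_cst|exact: all_momentsZ].
  have iB : Q.-integrable setT (EFin \o (fun w => f (Y w) - G (Y w))).
    by apply: eq_integrable (integrableB measurableT iF iG).
  apply: le_trans (le_normr_Rintegral _ iB) _ => //.
  apply: le_Rintegral => //.
  - by have := integrable_abse iB; apply: eq_integrable.
  - by apply/all_moments_int/all_momentsD; [exact: all_moments_cst|exact: all_momentsZ].
  - move=> w _; rewrite (le_trans (Hg _))// lerD2l /D.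
    by rewrite [leRHS]mulrAC.
pose a2 n := \int[P]_w (X n w ^+ 2).
exists (fun n => (K.+1%:R^-1 + D K * a2 n) + (K.+1%:R^-1 + D K * b2) +
    `|\int[P]_w G (X n w) - \int[m]_x G x|).
  apply: nearW => n; have H1 := approx _ _ P (X n) (aX n); have H2 := approx _ _ m (@id R) am.
  have -> : \int[P]_w f (X n w) - \int[m]_x f x =
     (\int[P]_w f (X n w) - \int[P]_w G (X n w)) - (\int[m]_x f x - \int[m]_x G x) +
     (\int[P]_w G (X n w) - \int[m]_x G x) by ring.
  apply: le_trans (ler_normD _ _) _; rewrite lerD2r.
  by apply: le_trans (ler_normB _ _) _; exact: lerD.
rewrite -[X in _ --> X]addr0; apply: cvgD.
  apply: cvgD; last exact: cvg_cst.
  apply: cvgD; first exact: cvg_cst.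
  exact: (cvg_scale (@cvX 2)).
by rewrite -(normr0 R); apply: cvg_norm; apply/subr_cvg0.
Qed.

End moment_limit.

Section gauss_growth.
Context {R : realType}.

Lemma std_moment_even N : std_moment R (2 * N) * (2 ^+ N * N`!%:R) = (2 * N)`!%:R.
Proof.
elim: N => [|N IH]; first by rewrite muln0 /= !fact0 expr0 !mulr1.
have -> : (2 * N.+1 = (2 * N).+2)%N by rewrite mulnS.
have e : (2 * N).+2%:R = 2 * N.+1%:R :> R by rewrite -natrM mulnS.
by rewrite /= !factS !natrM -IH exprS e; ring.
Qed.

(** The moment of order 2N is (2N)!/(2^N N!) v^N, so the sequence is the general term of the
    exponential series at t^2 v/2. *)
Lemma gauss_moment_growth (v t : R) :
  (fun N => t ^+ (2 * N) / (2 * N)`!%:R * gauss_moment (2 * N) v) @ \oo --> (0 : R).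
Proof.
rewrite [X in X @ _ --> _](_ : _ = exp_coeff (t ^+ 2 * v / 2)).
  exact: cvg_series_cvg_0 (is_cvg_series_exp_coeff _).
apply/funext => N; transitivity ((t ^+ 2 * v / 2) ^+ N / N`!%:R) => //; rewrite /gauss_moment.
have f0 k : (k`!%:R : R) != 0 by rewrite pnatr_eq0 -lt0n fact_gt0.
have -> : ((2 * N)./2 = N)%N by rewrite mul2n doubleK.
rewrite -(std_moment_even N) (exprMn _ _ 2^-1) (exprMn _ (t ^+ 2)) exprVn exprM.
have : std_moment R (2 * N) != 0.
  by have := f0 (2 * N)%N; rewrite -std_moment_even mulf_eq0 => /norP[].
move: (std_moment R (2 * N)) => s s0.
by field; rewrite s0 f0 expf_neq0 ?pnatr_eq0.
Qed.

Lemma gauss_momentZ k (c v : R) : c ^+ k * gauss_moment k v = gauss_moment k (c ^+ 2 * v).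
Proof.
rewrite /gauss_moment; case: (boolP (odd k)) => ok.
  by rewrite std_moment_odd// !mul0r mulr0.
rewrite exprMn -exprM mul2n -[in c ^+ k](odd_double_half k) (negPf ok) add0n; ring.
Qed.

End gauss_growth.

Lemma cvg_invsqrt (R : realType) : (fun n => (Num.sqrt n%:R)^-1 : R) @ \oo --> (0 : R).
Proof.
apply/cvgrPdist_lt => e e0; near=> n; rewrite sub0r normrN ger0_norm ?invsqrt_ge0//.
have h : (e^-1) ^+ 2 < n%:R by near: n; exact: nbhs_infty_gtr.
have n0 : 0 < n%:R :> R by apply: le_lt_trans h; exact: sqr_ge0.
rewrite -[ltRHS]invrK ltf_pV2 ?posrE ?invr_gt0 ?sqrtr_gt0//.
have -> : e^-1 = Num.sqrt (e^-1 ^+ 2) by rewrite sqrtr_sqr ger0_norm// invr_ge0 ltW.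
by rewrite ltr_sqrt.
Unshelve. all: by end_near. Qed.

Lemma cvg_invn (R : realType) : (fun n => n%:R^-1 : R) @ \oo --> (0 : R).
Proof.
rewrite [X in X @ _ --> _](_ : _ = fun n => (Num.sqrt n%:R)^-1 * (Num.sqrt n%:R)^-1); last first.
  by apply/funext => n; rewrite -invfM -expr2 sqr_sqrtr.
by rewrite -[X in _ --> X](mulr0 0); apply: cvgM; exact: cvg_invsqrt.
Qed.

(** * Limits of the quartic sums *)

Section quartic_clt.
Context {R : realType} {dT : measure_display} {T : measurableType dT}.
Variables (P : probability T R).
Variables (rho : forall n : nat, 'I_n -> 'I_n -> R) (Y : forall n : nat, 'I_n -> T -> R).
Variables (B V : R).
Hypothesis GF : forall n, gaussian_family P (@rho n) (@Y n).
Hypothesis rhoC : forall n (i j : 'I_n), rho i j = rho j i.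
Hypothesis rB : forall n, row_bounded B (@rho n).
Hypothesis B0 : 0 <= B.
Hypothesis cV : (fun n => wick_variance (@rho n)) @ \oo --> V.

Let Sn n := quartic_sum (@rho n) (@Y n).

Let wick n : wick_class B (@rho n) (mixed_moment P (@rho n) (@Y n)).
Proof. by split => //; exact: wick_mixed_moment. Qed.

Lemma quartic_sum_bounded k : exists2 C : R, 0 <= C &
  forall n, `|\int[P]_w (Sn n w ^+ k)| <= C.
Proof.
have [C C0 H] := wick_bounded B0 k 0.
exists C => // n; have := H n (@rho n) _ (wick n) [::] (leqnn _).
by rewrite mixed_moment_pow.
Qed.

(** In the limit [wick_pow_recursion] becomes the recursion of [gauss_momentSS]; at exponent 1 its
    coefficient 0 yields a vanishing mean. *)
Lemma cvg_quartic_sum k : (fun n => \int[P]_w (Sn n w ^+ k)) @ \oo --> gauss_moment k V.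
Proof.
have cvs := @cvg_invsqrt R.
suff H : forall k, (fun n => mixed_moment P (@rho n) (@Y n) [::] k) @ \oo --> gauss_moment k V.
  under eq_fun do rewrite -mixed_moment_pow; exact: H.
move=> {}k; elim/ltn_ind: k => -[_|k IH].
  under eq_fun => n do rewrite (wick0 (wick_mixed_moment (@GF n) (@rhoC n))).
  by rewrite /gauss_moment expr0 mulr1; exact: cvg_cst.
have [C C0 H] := wick_pow_recursion B0 k.
have h : (fun n => k%:R * wick_variance (@rho n) * mixed_moment P (@rho n) (@Y n) [::] k.-1)
    @ \oo --> gauss_moment k.+1 V.
  have -> : gauss_moment k.+1 V = k%:R * V * gauss_moment k.-1 V.
    by case: k {IH H} => [|k]; [rewrite /gauss_moment /= !mul0r|rewrite gauss_momentSS].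
  have hk := IH k.-1 (leq_ltn_trans (leq_pred k) (ltnSn k)).
  exact: cvgM (cvg_scale cV) hk.
have d0 : (fun n => mixed_moment P (@rho n) (@Y n) [::] k.+1 -
   k%:R * wick_variance (@rho n) * mixed_moment P (@rho n) (@Y n) [::] k.-1) @ \oo --> (0 : R).
  apply: (@squeeze_family _ _ (fun=> 0)); last exact: cvg_cst.
  move=> _; exists (fun n => C * (Num.sqrt n%:R)^-1).
    by apply: nearW => n; exact: H (wick n).
  by have := @cvg_scale _ C _ _ cvs; rewrite mulr0.
rewrite -[gauss_moment _ _]add0r.
under eq_fun => n do rewrite -[mixed_moment _ _ _ _ _](subrK
  (k%:R * wick_variance (@rho n) * mixed_moment P (@rho n) (@Y n) [::] k.-1)).
exact: cvgD d0 h.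
Unshelve. all: by end_near. Qed.

End quartic_clt.

(** * Transfer from the quartic sums to functions of the quartic mean *)

Section delta_method.
Context {R : realType} {dT : measure_display} {T : measurableType dT}.
Variables (P : probability T R) (S Q : nat -> T -> R) (b : nat -> R) (C : R).
Hypothesis aS : forall n, all_moments P (S n).
Hypothesis SC : forall n, \int[P]_w (S n w ^+ 2) <= C.
Hypothesis QE : forall n w, (0 < n)%N -> Q n w = 1 + S n w / (3 * Num.sqrt n%:R) + b n.
Hypothesis b0 : (fun n => Num.sqrt n%:R * b n) @ \oo --> (0 : R).

Let C0 : 0 <= C.
Proof. by apply: le_trans (SC 0); apply: Rintegral_ge0 => w _; exact: sqr_ge0. Qed.

Let cvb : b @ \oo --> (0 : R).
Proof.
apply: (@squeeze_family _ _ (fun=> 0)); last exact: cvg_cst.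
move=> _; exists (fun n => `|Num.sqrt n%:R * b n|); last by rewrite -(normr0 R); exact: cvg_norm.
near=> n; rewrite normrM ler_peMl// ger0_norm ?sqrtr_ge0//.
rewrite -[leLHS]sqrtr1 ler_wsqrtr// ler1n.
by near: n; exact: nbhs_infty_gt.
Unshelve. all: by end_near. Qed.

(** Where |S_n| <= M and |Q_n - 1| <= g, the linearisation of F and the uniform continuity of f make
    the difference at most 1/M. Elsewhere 2B is dominated pointwise by a multiple of S_n^2 plus a
    null sequence, so a second moment bound suffices. M = K + 1 grows after n. *)
Lemma delta_method (F f : R -> R) (lam : R) :
  measurable_fun setT F ->
  (forall e, 0 < e -> exists2 g, 0 < g &
     forall q, `|q - 1| <= g -> `|F q - F 1 - lam * (q - 1)| <= e * `|q - 1|) ->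
  (forall n, measurable_fun setT (Q n)) ->
  continuous f -> (exists B, forall x, `|f x| <= B) ->
  (fun n => \int[P]_w f (Num.sqrt n%:R * (F (Q n w) - F 1)) -
            \int[P]_w f (lam / 3 * S n w)) @ \oo --> (0 : R).
Proof.
move=> mF dF mQ cf [B fB]; have B0 : 0 <= B := le_trans (normr_ge0 _) (fB 0).
have mf : measurable_fun [set: R] f by exact: continuous_measurable_fun.
pose D (K : nat) : R := K.+1%:R^-1 + 2 * B * C / K.+1%:R ^+ 2.
apply: (@squeeze_family _ _ D); last first.
  have h1 : (fun K : nat => K.+1%:R^-1 : R) @ \oo --> (0 : R) by exact: cvg_harmonic.
  have h2 : (fun K : nat => 2 * B * C / K.+1%:R ^+ 2) @ \oo --> (0 : R).
    rewrite [X in X @ _ --> _](_ : _ = fun K => 2 * B * C * (K.+1%:R^-1 * K.+1%:R^-1)); last first.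
      by apply/funext => K; rewrite -expr2 exprVn.
    rewrite -[X in _ --> X](mulr0 (2 * B * C)); apply: cvg_scale.
    by rewrite -[X in _ --> X](mulr0 0); exact: cvgM.
  by rewrite -[X in _ --> X]addr0; exact: cvgD.
move=> K; pose M : R := K.+1%:R; have M0 : 0 < M by [].
have e0 : 0 < M^-1 by rewrite invr_gt0.
pose L := `|lam / 3| * M.
have cfx x : x \in `[- L, L] -> {for x, continuous f} by move=> _; exact: cf.
have [d d0 Hd] := unif_continuous_segment cfx e0.
(* On the good event sqrt n |Q_n - 1| <= M + 1, so a slope error [eta] contributes at most d / 2;
   the drift lam sqrt n b_n takes the other half of d. *)
pose eta := d / 2 / (M + 1); have eta0 : 0 < eta by rewrite !divr_gt0// addr_gt0.
have [g g0 Hg] := dF _ eta0.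
(* Chebyshev weights: M^(-2) S_n^2 exceeds 1 where |S_n| > M, and (Q_n - 1)^2 <= 2 S_n^2/(9 n) + 2
   b_n^2 exceeds g^2 where |Q_n - 1| > g. *)
pose al n := 2 * B * (M^-1 ^+ 2 + 2 / (9 * n%:R * g ^+ 2)).
pose be n := 4 * B * b n ^+ 2 / g ^+ 2.
exists (fun n => M^-1 + (al n * C + be n)); last first.
  have -> : D K = M^-1 + (2 * B * (M^-1 ^+ 2 + 0) * C + 0).
    by rewrite /D -exprVn; ring.
  apply: cvgD; first exact: cvg_cst.
  apply: cvgD.
    rewrite [X in X @ _ --> _](_ : _ = fun n => 2 * B * C * (M^-1 ^+ 2 + 2 / (9 * g ^+ 2) * n%:R^-1)); last first.
      by apply/funext => n; rewrite /al !invfM; ring.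
    rewrite [X in _ --> X](_ : _ = 2 * B * C * (M^-1 ^+ 2 + 2 / (9 * g ^+ 2) * 0)); last by ring.
    apply: cvg_scale; apply: cvgD; first exact: cvg_cst.
    exact: cvg_scale (@cvg_invn R).
  rewrite [X in X @ _ --> _](_ : _ = fun n => 4 * B / g ^+ 2 * (b n * b n)); last first.
    by apply/funext => n; rewrite /be; ring.
  rewrite -[X in _ --> X](mulr0 (4 * B / g ^+ 2)); apply: cvg_scale.
  by rewrite -[X in _ --> X](mulr0 0); exact: (cvgM cvb cvb).
have d20 : 0 < d / 2 by rewrite divr_gt0.
have bl' : \forall n \near \oo, `|lam| * `|Num.sqrt n%:R * b n| < d / 2.
  have h : (fun n => `|lam| * `|Num.sqrt n%:R * b n|) @ \oo --> (0 : R).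
    rewrite -[X in _ --> X](mulr0 `|lam|) -[X in _ * X](normr0 R).
    by apply: cvg_scale; exact: cvg_norm.
  move/cvgrPdist_lt : h => /(_ _ d20); apply: filterS => n.
  by rewrite sub0r normrN ger0_norm// mulr_ge0.
near=> n.
have n0 : (0 < n)%N by near: n; exact: nbhs_infty_gt.
have nR : 0 < n%:R :> R by rewrite ltr0n.
have sn0 : 0 < Num.sqrt n%:R :> R by rewrite sqrtr_gt0.
have bn : `|Num.sqrt n%:R * b n| < 1.
  near: n; move/cvgrPdist_lt : b0 => /(_ 1 ltr01).
  by apply: filterS => n; rewrite sub0r normrN.
have bl : `|lam| * `|Num.sqrt n%:R * b n| < d / 2 by near: n; exact: bl'.
have gn0 : 0 <= 2 / (9 * n%:R * g ^+ 2).
  by rewrite divr_ge0// mulr_ge0 ?sqr_ge0// mulr_ge0.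
have al0 : 0 <= al n.
  by rewrite /al mulr_ge0 ?mulr_ge0// addr_ge0 ?sqr_ge0.
have be0 : 0 <= be n 
  by apply: divr_ge0; [apply: mulr_ge0; [exact: mulr_ge0|exact: sqr_ge0]|exact: sqr_ge0].
have key w : `|f (Num.sqrt n%:R * (F (Q n w) - F 1)) - f (lam / 3 * S n w)| <=
    M^-1 + (al n * S n w ^+ 2 + be n).
  set s := S n w; set X := Num.sqrt n%:R * _.
  have Q1 : Q n w - 1 = s / (3 * Num.sqrt n%:R) + b n by rewrite QE// -/s; move: (s / _) (b n) => y z; ring.
  have bad : 2 * B <= al n * s ^+ 2 + be n -> `|f X - f (lam / 3 * s)| <= M^-1 + (al n * s ^+ 2 + be n).
    move=> h; apply: (le_trans (ler_normB _ _)); apply: (@le_trans _ _ (2 * B)).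
      by rewrite (_ : 2 * B = B + B); [exact: lerD|ring].
    by apply: le_trans h _; rewrite lerDr ltW.
  have [sM|sM] := leP `|s| M; last first.
    apply: bad; rewrite -[leLHS]addr0 lerD//.
    apply: (@le_trans _ _ (2 * B * (M^-1 ^+ 2 * s ^+ 2))).
      rewrite ler_peMr ?mulr_ge0// -exprMn -(real_normK (num_real (_ * s))) normrM.
      rewrite (gtr0_norm e0) -[leLHS](expr1n _ 2) lerXn2r ?nnegrE// ?mulr_ge0 ?(ltW e0)//.
      by rewrite mulrC ler_pdivlMr// mul1r ltW.
    by rewrite /al -[leRHS]mulrA ler_wpM2l ?mulr_ge0// ler_wpM2r ?sqr_ge0// lerDl.
  have [qg|qg] := leP `|Q n w - 1| g; last first.
    apply: bad.
    have q2 : g ^+ 2 <= 2 * s ^+ 2 / (9 * n%:R) + 2 * b n ^+ 2.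
      apply: (@le_trans _ _ ((s / (3 * Num.sqrt n%:R) + b n) ^+ 2)).
        rewrite -Q1 -(real_normK (num_real (Q n w - 1))).
        by rewrite lerXn2r ?nnegrE ?(ltW g0) ?(ltW qg).
      have -> : 2 * s ^+ 2 / (9 * n%:R) = 2 * (s / (3 * Num.sqrt n%:R)) ^+ 2.
        rewrite -[in LHS](@sqr_sqrtr _ n%:R)//; field; rewrite gt_eqF//.
      move: (s / _) (b n) => x y; have := sqr_ge0 (x - y); nra.
    have -> : al n * s ^+ 2 + be n = 2 * B * ((M^-1 * s) ^+ 2 +
       (2 * s ^+ 2 / (9 * n%:R) + 2 * b n ^+ 2) / g ^+ 2).
      by rewrite /al /be; field; rewrite !gt_eqF.
    rewrite ler_peMr ?mulr_ge0// -[leLHS]add0r lerD ?sqr_ge0//.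
    by rewrite ler_pdivlMr ?exprn_gt0// mul1r.
  have nn : 0 <= al n * s ^+ 2 + be n := addr_ge0 (mulr_ge0 al0 (sqr_ge0 _)) be0.
  rewrite -[leLHS]addr0 lerD//.
  rewrite ltW// distrC Hd//.
    rewrite in_itv /= -ler_norml normrM ler_wpM2l//.
  have -> : lam / 3 * s - X = - (Num.sqrt n%:R * (F (Q n w) - F 1 - lam * (Q n w - 1)) +
      lam * (Num.sqrt n%:R * b n)).
    by rewrite /X Q1; field; rewrite gt_eqF.
  rewrite normrN (le_lt_trans (ler_normD _ _))// [d]splitr ler_ltD//; last by rewrite normrM.
  rewrite normrM (gtr0_norm sn0).
  have h1 : Num.sqrt n%:R * `|Q n w - 1| <= M + 1.
    rewrite -[X in X * _](gtr0_norm sn0) -normrM Q1.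
    have -> : Num.sqrt n%:R * (s / (3 * Num.sqrt n%:R) + b n) = s / 3 + Num.sqrt n%:R * b n.
      by field; rewrite gt_eqF.
    rewrite (le_trans (ler_normD _ _))// lerD ?(ltW bn)//.
    rewrite normrM normfV (ger0_norm (ler0n _ 3)) (le_trans _ sM)// ler_piMr//.
    by rewrite invf_le1// ler1n.
  apply: (@le_trans _ _ (Num.sqrt n%:R * (eta * `|Q n w - 1|))).
    by rewrite ler_wpM2l ?sqrtr_ge0// Hg.
  rewrite mulrCA; apply: (@le_trans _ _ (eta * (M + 1))).
    by rewrite ler_wpM2l// ltW.
  by rewrite /eta divfK// gt_eqF// addr_gt0.
have iX : P.-integrable setT (EFin \o (fun w => f (Num.sqrt n%:R * (F (Q n w) - F 1)))).
  apply: integrable_bounded (fun w => fB _); apply: (measurableT_comp mf).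
  by apply: measurable_funM => //; apply: measurable_funB => //; exact: measurableT_comp.
have iS : P.-integrable setT (EFin \o (fun w => f (lam / 3 * S n w))).
  apply: integrable_bounded (fun w => fB _); apply: (measurableT_comp mf).
  by apply: measurable_funM => //; case: (aS n).
have iB : P.-integrable setT (EFin \o (fun w => f (Num.sqrt n%:R * (F (Q n w) - F 1)) - f (lam / 3 * S n w))).
  by apply: eq_integrable (integrableB measurableT iX iS).
have aS2 : all_moments P (fun w => S n w ^+ 2) by exact: all_momentsX.
have aa : all_moments P (fun w => al n * S n w ^+ 2 + be n).
  by apply: all_momentsD; [exact: all_momentsZ|exact: all_moments_cst].
rewrite -RintegralB//; apply: le_trans (le_normr_Rintegral _ iB) _ => //.
apply: (@le_trans _ _ (\int[P]_w (M^-1 + (al n * S n w ^+ 2 + be n)))).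
  apply: le_Rintegral => //.
  - by have := integrable_abse iB; apply: eq_integrable.
  - by apply/all_moments_int/all_momentsD => //; exact: all_moments_cst.
rewrite expectD//; last exact: all_moments_cst.
rewrite expectD; [|exact: all_momentsZ|exact: all_moments_cst].
rewrite !expect_cst expectZ// lerD2l lerD2r ler_wpM2l//.
Unshelve. all: by end_near. Qed.

End delta_method.

(** * Almost sure convergence from fourth moments *)

Section almost_sure.
Context {R : realType} {dT : measure_display} {T : measurableType dT}.
Variables (P : probability T R).

Lemma sum_inv_sqr_le n : \sum_(0 <= k < n) (k.+1%:R^-1 ^+ 2 : R) <= 2.
Proof.
(* The constant bound 2 is not inductive; 2 - 2/(n + 1) is. *)
suff H : \sum_(0 <= k < n) (k.+1%:R^-1 ^+ 2 : R) <= 2 - 2 / n.+1%:R.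
  by apply: le_trans H _; rewrite gerBl divr_ge0.
elim: n => [|n IH]; first by rewrite big_geq// divr1 subrr.
rewrite big_nat_recr//=; apply: le_trans (lerD IH (lexx _)) _.
have n1 : 0 < n.+1%:R :> R by [].
have -> : n.+2%:R = n.+1%:R + 1 :> R by rewrite natr1.
have n1' : 1 <= n.+1%:R :> R by rewrite ler1n.
move: (n.+1%:R : R) n1 n1' => x x0 x1.
have -> : 2 - 2 / x + x^-1 ^+ 2 = 2 - 2 / (x + 1) - (x - 1) * (x * x * (x + 1))^-1.
  by field; rewrite !gt_eqF// addr_gt0.
rewrite gerBl mulr_ge0 ?subr_ge0// invr_ge0 !mulr_ge0// ?(ltW x0)// addr_ge0// ltW//.
Qed.

(** Borel-Cantelli in integrated form: the series of the E[U_n^4] converges, so the series of the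
    U_n^4 is finite almost surely and its terms tend to 0. *)
Lemma ae_cvg0_of_moment4 (U : nat -> T -> R) (C : R) :
  (forall n, all_moments P (U n)) ->
  (forall n, \int[P]_w (U n w ^+ 4) <= C * n.+1%:R^-1 ^+ 2) ->
  {ae P, forall w, (fun n => U n w) @ \oo --> (0 : R)}.
Proof.
move=> aU UC.
have C0 : 0 <= C.
  have := UC 0%N; rewrite invr1 expr1n mulr1; apply: le_trans.
  by apply: Rintegral_ge0 => w _; rewrite (exprM _ 2 2) sqr_ge0.
have u0 n w : 0 <= U n w ^+ 4 by rewrite (exprM _ 2 2) sqr_ge0.
have mU n : measurable_fun setT (fun w => (U n w ^+ 4)%:E).
  by apply/measurable_EFinP; apply: measurable_funX; exact: all_moments_meas (aU n).
have fin : (\int[P]_w (\sum_(0 <= n <oo) (U n w ^+ 4)%:E) < +oo)%E.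
  rewrite integral_nneseries//; last by move=> n w _; rewrite lee_fin.
  apply: (@le_lt_trans _ _ (C * 2)%:E); last exact: ltry.
  apply: lime_le.
    by apply: is_cvg_nneseries => n _ _; apply: integral_ge0 => w _; rewrite lee_fin.
  apply: nearW => n.
  have E k : (\int[P]_w (U k w ^+ 4)%:E = (\int[P]_w (U k w ^+ 4))%:E)%E.
    rewrite /Rintegral fineK//; apply: integrable_fin_num => //.
    exact: all_moments_int (all_momentsX 4 (aU k)).
  under eq_bigr do rewrite E.
  rewrite sumEFin lee_fin; apply: (@le_trans _ _ (C * \sum_(0 <= k < n) (k.+1%:R^-1 ^+ 2))).
    by rewrite mulr_sumr; apply: ler_sum => k _; exact: UC.
  by rewrite ler_wpM2l// sum_inv_sqr_le.
have ms : measurable_fun setT (fun w => \sum_(0 <= n <oo) (U n w ^+ 4)%:E)%E.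
  by apply: ge0_emeasurable_sum => // n w _ _; rewrite lee_fin.
have s0 w : (0 <= \sum_(0 <= n <oo) (U n w ^+ 4)%:E)%E.
  by apply: nneseries_ge0 => n _ _; rewrite lee_fin.
have : P.-integrable setT (fun w => \sum_(0 <= n <oo) (U n w ^+ 4)%:E)%E.
  apply/integrableP; split => //.
  by under eq_integral do rewrite gee0_abs//.
move=> /(integrable_ae measurableT); apply: filterS => w /(_ I) sfin.
have cs : cvgn (series (fun n => U n w ^+ 4)).
  apply: nondecreasing_is_cvgn.
    by move=> a b ab; rewrite /series /= (big_cat_nat (leq0n a) ab)//= lerDl sumr_ge0.
  exists (fine (\sum_(0 <= n <oo) (U n w ^+ 4)%:E)%E) => _ [n _ <-].
  rewrite -lee_fin fineK// /series /= -sumEFin.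
  by apply: nneseries_lim_ge => k _ _; rewrite lee_fin.
have := cvg_series_cvg_0 cs => c4.
apply/cvgrPdist_lt => e e0; move/cvgrPdist_lt : c4 => /(_ (e ^+ 4)).
rewrite exprn_gt0// => /(_ isT); apply: filterS => n.
rewrite !sub0r !normrN normrX => h.
by rewrite -(ltr_pXn2r (n := 4)) ?nnegrE// ltW.
Qed.

End almost_sure.

Section weak_limits.
Context {R : realType} {dT : measure_display} {T : measurableType dT}.
Variables (P : probability T R).

Lemma conv_in_distribution_expect (X : nat -> T -> R) (m : probability (measurableTypeR R) R)
    (mu : set R -> \bar R) :
  (m : set R -> \bar R) = mu -> (forall n, measurable_fun setT (X n)) ->
  (forall f : R -> R, continuous f -> (exists B, forall x, `|f x| <= B) ->
    (fun n => \int[P]_w f (X n w)) @ \oo --> \int[m]_x f x) ->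
  conv_in_distribution P X mu.
Proof.
move=> <- mX H f cf bf; have := H f cf bf; have [B fB] := bf.
have mf : measurable_fun [set: R] f by exact: continuous_measurable_fun.
have iX n : P.-integrable setT (EFin \o (fun w => f (X n w))).
  by apply: integrable_bounded (fun w => fB _); exact: (measurableT_comp mf).
have im : m.-integrable setT (EFin \o f).
  exact: (@integrable_bounded R _ (measurableTypeR R) m f B mf fB).
have EX n : (\int[P]_w (f (X n w))%:E = (\int[P]_w f (X n w))%:E)%E.
  by rewrite /Rintegral fineK//; exact: integrable_fin_num (iX n).
have Em : (\int[m]_x (f x)%:E = (\int[m]_x f x)%:E)%E.
  by rewrite /Rintegral fineK//; exact: integrable_fin_num im.
pose j : measurableTypeR R -> R := idfun.
have mj : measurable_fun setT j by move=> _ A mA; rewrite setTI; exact: mA.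
(* [conv_in_distribution] integrates over the default measurable structure of [R] *)
have pE : (\int[pushforward m j]_x (f x)%:E = \int[m]_x (f x)%:E)%E.
  by rewrite integral_pushforward//; exact/measurable_EFinP.
move=> h; have h' : ((fun n => (\int[P]_w f (X n w))%:E) @ \oo --> \int[pushforward m j]_x (f x)%:E)%E.
  by rewrite pE Em; apply: cvg_EFin => //; exact: nearW.
under eq_fun do rewrite EX.
exact: h'.
Qed.

End weak_limits.

(** * Covariance of the mild solution *)

Section heat_covariance.
Context {R : realType}.
Local Notation mu := (@lebesgue_measure R).
Local Notation RR := (measurableTypeR R * measurableTypeR R)%type.

Lemma measurable_inv : measurable_fun [set: R] (@GRing.inv R).
Proof.
rewrite (_ : GRing.inv = fun x : R => x * (x ^+ 2) `^ (-1)).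
  apply: measurable_funM => //.
  exact: (measurableT_comp (measurable_powR (-1)) (exprn_measurable 2)).
apply/funext => x; rewrite powR_inv1 ?sqr_ge0//.
have [->|x0] := eqVneq x 0; first by rewrite mul0r invr0.
by field.
Qed.

Lemma measurable_sqrt : measurable_fun [set: R] (@Num.sqrt R).
Proof. by apply: continuous_measurable_fun => x; exact: sqrt_continuous. Qed.

Variables (theta x : R).
Hypothesis theta0 : 0 < theta.

Lemma measurable_heat_integrand t : measurable_fun [set: RR] (heat_integrand theta t x).
Proof.
have m1 : measurable_fun [set: RR] (fun p : RR => p.1 : R) by exact: measurable_fst.
have m2 : measurable_fun [set: RR] (fun p : RR => p.2 : R) by exact: measurable_snd.
apply: measurable_fun_ifT => //=.
  apply: measurable_and.
    by apply: measurable_fun_ler.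
  by apply: measurable_fun_ltr.
have ms c : measurable_fun [set: RR] (fun p : RR => c * (t - p.1) : R).
  by apply: measurable_funM => //; apply: measurable_funB.
apply: measurable_funM.
  apply: (measurableT_comp measurable_inv); exact: (measurableT_comp measurable_sqrt).
apply: (measurableT_comp (@measurable_expR R)); apply: measurable_funM.
  apply: measurableT_comp => //; apply: measurable_funX; exact: measurable_funB.
exact: (measurableT_comp measurable_inv).
Qed.

Lemma heat_kernel_ge0 s z : 0 <= heat_kernel theta s z.
Proof. by rewrite /heat_kernel mulr_ge0 ?invr_ge0 ?sqrtr_ge0 ?expR_ge0. Qed.

Lemma heat_integrand_ge0 t p : 0 <= heat_integrand theta t x p.
Proof. by rewrite /heat_integrand; case: ifP => // _; exact: heat_kernel_ge0. Qed.

(** The semigroup property at the origin: in y, the product is p_(a+b)(0) times the normal density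
    with mean x and variance v = 2 theta a b/(a + b). *)
Lemma integral_heat_kernelM a b : 0 < a -> 0 < b ->
  (\int[mu]_y (heat_kernel theta a (x - y) * heat_kernel theta b (x - y))%:E =
   ((Num.sqrt (4 * pi * theta * (a + b)))^-1)%:E)%E.
Proof.
move=> a0 b0; have ab0 : 0 < a + b by exact: addr_gt0.
have p0 := @pi_gt0 R.
pose v := 2 * theta * a * b / (a + b).
have v0 : 0 < v by rewrite divr_gt0// !mulr_gt0.
pose s := Num.sqrt v; have s2 : s ^+ 2 = v by rewrite sqr_sqrtr// ltW.
have sn0 : s != 0 by rewrite sqrtr_eq0 -ltNge.
pose k := (Num.sqrt (4 * pi * theta * (a + b)))^-1.
have E y : heat_kernel theta a (x - y) * heat_kernel theta b (x - y) =
    k * normal_pdf x s y.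
  rewrite normal_pdfE// /normal_peak /normal_fun s2 /heat_kernel.
  rewrite mulrACA -expRD mulrA; congr (_ * expR _); last first.
    rewrite /v -(mulr_natr (_ / _)); field.
    by rewrite !gt_eqF.
  rewrite /k -!invfM -!sqrtrM ?mulr_ge0 ?(ltW a0) ?(ltW b0) ?(ltW ab0) ?(ltW p0) ?(ltW theta0)//.
  congr (Num.sqrt _)^-1; rewrite /v -(mulr_natr (_ * pi)); field.
  by rewrite gt_eqF.
under eq_integral do rewrite E EFinM.
rewrite ge0_integralZl//.
- by rewrite integral_normal_pdf mule1.
- by apply/measurable_EFinP; exact: measurable_normal_pdf.
- by move=> y _; rewrite lee_fin normal_pdf_ge0.
- by rewrite lee_fin invr_ge0 sqrtr_ge0.
Qed.

(** For t = s the integrand blows up at r = s. Hence the fundamental theorem is applied on [0, z n]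
    with z n increasing to s, and monotone convergence gives the rest. *)
Lemma integral_time_heat s t : 0 < s -> s <= t ->
  (\int[mu]_(r in `[0%R, s[) ((Num.sqrt (4 * pi * theta * (t + s - 2 * r)))^-1)%:E =
   ((Num.sqrt (4 * pi * theta))^-1 * (Num.sqrt (t + s) - Num.sqrt (t - s)))%:E)%E.
Proof.
move=> s0 st; have p0 := @pi_gt0 R.
pose c := 4 * pi * theta; have c0 : 0 < c by rewrite !mulr_gt0.
pose f (r : R) := (Num.sqrt (c * (t + s - 2 * r)))^-1.
pose F (r : R) := - c^-1 * Num.sqrt (c * (t + s - 2 * r)).
(* The factor 1/2 keeps z 0 = s/2 positive. *)
pose z n : R := s * (1 - n.+1%:R^-1 / 2).
have z0 n : 0 < z n.
  rewrite mulr_gt0// subr_gt0 ltr_pdivrMr// mul1r.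
  by rewrite (@le_lt_trans _ _ 1) ?ltr1n// invf_le1// ler1n.
have zs n : z n < s by rewrite gtr_pMr// gtrDl oppr_lt0 divr_gt0// invr_gt0.
have zmono m n : (m <= n)%N -> z m <= z n.
  by move=> mn; rewrite ler_pM2l// lerD2l lerN2 ler_pM2r// lef_pV2 ?posrE// ler_nat.
have cz : z @ \oo --> s.
  have h := @cvg_harmonic R.
  have -> : s = s * (1 - 0 / 2) by rewrite mul0r subr0 mulr1.
  apply: cvgM; first exact: cvg_cst.
  apply: cvgB; first exact: cvg_cst.
  by apply: cvgM; [exact: h|exact: cvg_cst].
have pos r : r < s -> 0 < c * (t + s - 2 * r) by move=> rs; rewrite mulr_gt0//; lra.
have dF (r : R) : r < s -> is_derive r 1 F (f r).
  move=> rs; have h1 : is_derive r 1 (fun r => c * (t + s - 2 * r)) (c * (- 2)).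
    apply: (is_derive_eq (is_derive_cmul c (is_deriveB (is_derive_cst (t + s) r (1 : R)) (is_derive_cmul 2 (is_derive_id r (1 : R)))))).
    by rewrite mulr1 sub0r.
  have h2 := is_derive_cmul (- c^-1) (@is_derive1_comp R Num.sqrt _ r _ _ (is_derive1_sqrt (pos r rs)) h1).
  apply: (is_derive_eq h2); rewrite /f; field.
  by rewrite !gt_eqF ?sqrtr_gt0 ?pos.
have cdF (r : R) : r < s -> {for r, continuous F}.
  by move=> rs; apply/differentiable_continuous/derivable1_diffP; case: (dF r rs).
have cf (r : R) : r < s -> {for r, continuous f}.
  move=> rs; apply: cvgV; first by rewrite gt_eqF// sqrtr_gt0 pos.
  apply: (cvg_comp (fun r => c * (t + s - 2 * r)) Num.sqrt); last exact: sqrt_continuous.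
  by apply: cvgM; [exact: cvg_cst|apply: cvgB; [exact: cvg_cst|apply: cvgM; [exact: cvg_cst|exact: cvg_id]]].
have FTC n : (\int[mu]_(r in `[0%R, z n]) (f r)%:E = (F (z n) - F 0)%:E)%E.
  rewrite (@continuous_FTC2 _ f F) ?EFinB//.
  - apply: continuous_in_subspaceT => r; rewrite inE /= in_itv /= => /andP[_ rz].
    by apply: cf; exact: le_lt_trans rz (zs n).
  - split.
    + by move=> r; rewrite in_itv /= => /andP[_ rz]; case: (dF r (lt_trans rz (zs n))).
    + by apply: cvg_at_right_filter; exact: cdF.
    + by apply: cvg_at_left_filter; exact: cdF.
  - by move=> r; rewrite in_itv /= => /andP[_ rz]; rewrite derive1E; have := dF r (lt_trans rz (zs n)) => ?; exact: derive_val.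
have U : \bigcup_n `[0%R, z n]%classic = `[0%R, s[%classic.
  apply/seteqP; split => [r [n _]|r] /=; rewrite !in_itv /= => /andP[r0 rz].
    by rewrite r0 (le_lt_trans rz (zs n)).
  have sr : 0 < s - r by rewrite subr_gt0.
  move/cvgrPdist_lt : cz => /(_ _ sr) [n _ /(_ n (leqnn n))] /=.
  rewrite ger0_norm ?subr_ge0 ?(ltW (zs n))// => zn.
  by exists n => //=; rewrite in_itv /= r0 /=; lra.
have mf : measurable_fun [set: measurableTypeR R] (fun r => (f r)%:E).
  apply/measurable_EFinP; apply: (measurableT_comp measurable_inv); apply: (measurableT_comp measurable_sqrt).
  by apply: measurable_funM => //; apply: measurable_funB => //; apply: measurable_funM.
have := @ge0_nondecreasing_set_cvg_integral _ (measurableTypeR R) R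
  (fun n => `[0%R, z n]%classic) (fun r => (f r)%:E) mu.
rewrite U => H.
have {}H : (fun n => \int[mu]_(r in `[0%R, z n]) (f r)%:E)%E @ \oo --> (\int[mu]_(r in `[0%R, s[) (f r)%:E)%E.
  apply: H.
  - move=> m n mn; apply/subsetPset; apply: subset_itvl.
    by rewrite bnd_simp zmono.
  - by move=> i; exact: measurable_itv.
  - by move=> i; exact: measurable_funTS.
  - by move=> i r _; rewrite lee_fin invr_ge0 sqrtr_ge0.
have H2 : (fun n => \int[mu]_(r in `[0%R, z n]) (f r)%:E)%E @ \oo --> (F s - F 0)%:E.
  under eq_fun do rewrite FTC.
  apply: cvg_EFin; first exact: nearW.
  apply: cvgB; last exact: cvg_cst.
  apply: cvgM; first exact: cvg_cst.
  apply: (cvg_comp (fun n => c * (t + s - 2 * z n)) Num.sqrt); last exact: sqrt_continuous.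
  apply: cvgM; first exact: cvg_cst.
  apply: cvgB; first exact: cvg_cst.
  by apply: cvgM => //; exact: cvg_cst.
transitivity (F s - F 0)%:E; first exact: cvg_unique H H2.
have FE r : F r = - (c^-1 * (Num.sqrt c * Num.sqrt (t + s - 2 * r))).
  by rewrite /F sqrtrM ?(ltW c0)// mulNr.
congr EFin; rewrite !FE.
have -> : t + s - 2 * s = t - s by ring.
have -> : t + s - 2 * 0 = t + s by ring.
have sc : Num.sqrt c != 0 by rewrite sqrtr_eq0 -ltNge.
rewrite -/c; have -> : c^-1 = (Num.sqrt c)^-1 * (Num.sqrt c)^-1.
  by rewrite -invfM -expr2 sqr_sqrtr// ltW.
by field.
Qed.

(** Tonelli: at time r the space integral is p_(t+s-2r)(0), since (t - r) + (s - r) = t + s - 2r,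
    and the product of integrands vanishes unless 0 <= r < s. *)
Lemma heat_inner_le s t : 0 < s -> s <= t ->
  (\int[@leb2 R]_(p in st_dom) (heat_integrand theta t x p * heat_integrand theta s x p)%:E =
   ((Num.sqrt (4 * pi * theta))^-1 * (Num.sqrt (t + s) - Num.sqrt (t - s)))%:E)%E.
Proof.
move=> s0 st; rewrite integral_mkcond /leb2.
have mh u := measurable_heat_integrand u.
rewrite [X in integral _ _ X](_ : _ = fun p : RR =>
    (heat_integrand theta t x p * heat_integrand theta s x p)%:E); last first.
  apply/funext => p; rewrite patchE; case: ifPn => //.
  rewrite notin_setE /st_dom /= => /negP/negbTE p0.
  by rewrite /heat_integrand p0 /= mul0r.
rewrite fubini_tonelli1; last 2 first.
- by apply/measurable_EFinP; exact: measurable_funM.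
- by move=> p; rewrite lee_fin mulr_ge0// heat_integrand_ge0.
rewrite -(integral_time_heat s0 st) [RHS]integral_mkcond.
apply: eq_integral => r _; rewrite /fubini_F /= patchE mem_setE in_itv /=.
rewrite /heat_integrand /=; case: (boolP (0 <= r)) => r0 /=; last first.
  by under eq_integral do rewrite mul0r; rewrite integral0.
case: (ltP r s) => rs; last first.
  by under eq_integral do rewrite mulr0; rewrite integral0.
rewrite (lt_le_trans rs st) integral_heat_kernelM ?subr_gt0//; last exact: lt_le_trans st.
by congr (Num.sqrt (_ * _))^-1%:E; ring.
Qed.

Lemma heat_inner s t : 0 < s -> 0 < t ->
  (\int[@leb2 R]_(p in st_dom) (heat_integrand theta t x p * heat_integrand theta s x p)%:E =
   ((Num.sqrt (4 * pi * theta))^-1 * (Num.sqrt (t + s) - Num.sqrt `|t - s|))%:E)%E.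
Proof.
move=> s0 t0; have [st|/ltW ts] := leP s t.
  by rewrite heat_inner_le// ger0_norm ?subr_ge0.
under eq_integral do rewrite mulrC.
by rewrite heat_inner_le// distrC ger0_norm ?subr_ge0// (addrC s t).
Qed.

End heat_covariance.

(** * Finite families of white noise integrals *)

Section white_noise.
Context {R : realType} {dT : measure_display} {T : measurableType dT}.
Variables (P : probability T R) (W : (R * R -> R) -> T -> R).
Hypothesis HW : is_white_noise P W.
Local Notation RR := (measurableTypeR R * measurableTypeR R)%type.
Local Notation mu := (@lebesgue_measure R).
Local Notation mu2 := (mu \x mu)%E.
Implicit Types (h g f : R * R -> R) (a b : R).

Lemma measurable_st_dom : measurable (st_dom : set RR).
Proof.
rewrite (_ : st_dom = setT `&` (fst @^-1` `[0%R, +oo[%classic)); last first.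
  by apply/seteqP; split=> p /=; rewrite in_itv /= andbT ?setTI//; case.
by apply: (@measurable_fst _ _ (measurableTypeR R) (measurableTypeR R)) => //; exact: measurable_itv.
Qed.

Lemma sq_integrable_measurable h : sq_integrable h -> measurable_fun (st_dom : set RR) h.
Proof. by case. Qed.

Lemma sq_integrable_int h : sq_integrable h ->
  mu2.-integrable (st_dom : set RR) (fun p => ((h p) ^+ 2)%:E).
Proof.
move=> hh; have mh := sq_integrable_measurable hh; case: hh => _ fin.
apply/integrableP; split; first by apply/measurable_EFinP; exact: measurable_funX.
by under eq_integral do rewrite /= ger0_norm ?sqr_ge0//.
Qed.

Lemma sq_integrable_intM h g : sq_integrable h -> sq_integrable g ->
  mu2.-integrable (st_dom : set RR) (fun p => (h p * g p)%:E).
Proof.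
move=> hh hg; have mD := measurable_st_dom.
have iS := integrableD mD (sq_integrable_int hh) (sq_integrable_int hg).
apply: le_integrable iS => //.
  by apply/measurable_EFinP; apply: measurable_funM; exact: sq_integrable_measurable.
move=> p _ /=; rewrite lee_fin [leRHS]ger0_norm ?addr_ge0 ?sqr_ge0// normrM.
rewrite -(real_normK (num_real (h p))) -(real_normK (num_real (g p))).
have := sqr_ge0 (`|h p| - `|g p|); have := normr_ge0 (h p); have := normr_ge0 (g p).
by move: `|h p| `|g p| => a b; nra.
Qed.

Lemma sq_integrableD a b h g : sq_integrable h -> sq_integrable g ->
  sq_integrable (fun p => a * h p + b * g p).
Proof.
move=> hh hg; have mD := measurable_st_dom.
have mh := sq_integrable_measurable hh; have mg := sq_integrable_measurable hg.
have m : measurable_fun (st_dom : set RR) (fun p => a * h p + b * g p).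
  by apply: measurable_funD; apply: measurable_funM.
split; first exact: m.
have iS := integrableD mD (integrableZl mD (2 * a ^+ 2) (sq_integrable_int hh))
  (integrableZl mD (2 * b ^+ 2) (sq_integrable_int hg)).
have /integrableP[_] := iS; apply: le_lt_trans.
rewrite /leb2; apply: ge0_le_integral => //=.
- by move=> p _; rewrite lee_fin sqr_ge0.
- by apply/measurable_EFinP; exact: measurable_funX.
- apply/measurable_EFinP; apply: measurableT_comp => //; apply: measurable_funD;
    by apply: measurable_funM => //; exact: measurable_funX.
- move=> p _; rewrite lee_fin; apply: le_trans (ler_norm _).
  by have := sqr_ge0 (a * h p - b * g p); nra.
Qed.

Lemma sq_integrable0 : sq_integrable (fun=> 0 : R).
Proof.
split; first exact: measurable_cst.
by under eq_integral do rewrite expr0n /=; rewrite integral0.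
Qed.

Definition inner h g := (\int[mu2]_(p in (st_dom : set RR)) (h p * g p))%R.

Lemma innerC h g : inner h g = inner g h.
Proof. by rewrite /inner; apply: eq_Rintegral => p _; rewrite mulrC. Qed.

Lemma L2norm2_inner h : L2norm2 h = inner h h.
Proof.
by rewrite /L2norm2 /inner /Rintegral; congr fine; apply: eq_integral => p _; rewrite expr2.
Qed.

Lemma innerDl a b h g f : sq_integrable h -> sq_integrable g -> sq_integrable f ->
  inner (fun p => a * h p + b * g p) f = a * inner h f + b * inner g f.
Proof.
move=> hh hg hf; have mD := measurable_st_dom.
have i1 := sq_integrable_intM hh hf; have i2 := sq_integrable_intM hg hf.
rewrite /inner -RintegralZl// -RintegralZl// -RintegralD//.
- by apply: eq_Rintegral => p _; ring.
- by apply: eq_integrable (integrableZl mD a i1).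
- by apply: eq_integrable (integrableZl mD b i2).
Qed.

Section finite_family.
Variables (I : Type) (h : I -> R * R -> R).
Hypothesis hh : forall i, sq_integrable (h i).

Lemma white_noise_sum (a : I -> R) (r : seq I) :
  sq_integrable (fun p => \sum_(i <- r) a i * h i p) /\
  {ae P, forall w, W (fun p => \sum_(i <- r) a i * h i p) w = \sum_(i <- r) a i * W (h i) w}.
Proof.
elim: r => [|i r [IH1 IH2]].
  rewrite (_ : (fun p => _) = (fun=> 0)); last by apply/funext => p; rewrite big_nil.
  split; first exact: sq_integrable0.
  (* Linearity with both coefficients 0 gives W(0) = 0 almost surely. *)
  have := HW.2 _ _ 0 0 sq_integrable0 sq_integrable0.
  rewrite (_ : (fun p => _) = (fun=> 0)); last by apply/funext => p; rewrite !mul0r addr0.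
  by apply: filterS => w; rewrite !mul0r addr0 big_nil.
have E : (fun p => \sum_(j <- i :: r) a j * h j p) =
    (fun p => a i * h i p + 1 * \sum_(j <- r) a j * h j p).
  by apply/funext => p; rewrite big_cons mul1r.
rewrite E; split; first exact: sq_integrableD.
have := HW.2 _ _ (a i) 1 (hh i) IH1; apply: filterS2 IH2 => w IH2w ->.
by rewrite IH2w mul1r big_cons.
Qed.

Lemma inner_suml (a : I -> R) (r : seq I) g : sq_integrable g ->
  inner (fun p => \sum_(i <- r) a i * h i p) g = \sum_(i <- r) a i * inner (h i) g.
Proof.
move=> hg; elim: r => [|i r IH].
  rewrite big_nil /inner; under eq_Rintegral do rewrite big_nil mul0r.
  by rewrite /Rintegral integral0.
rewrite big_cons -IH -[X in _ = _ + X]mul1r -innerDl//.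
  by congr inner; apply/funext => p; rewrite big_cons mul1r.
exact: (white_noise_sum a r).1.
Qed.

End finite_family.

Lemma inner_ge0 h : 0 <= inner h h.
Proof. by apply: Rintegral_ge0 => p _; rewrite -expr2 sqr_ge0. Qed.

Lemma white_noise_moments h : sq_integrable h ->
  all_moments P (W h) /\ forall k, \int[P]_w (W h w ^+ k) = gauss_moment k (inner h h).
Proof.
move=> hh; have [mW law] := HW.1 h hh; rewrite -L2norm2_inner.
by apply: gauss_law_moments => //; rewrite L2norm2_inner inner_ge0.
Qed.

(** W is linear only almost surely, hence Y_i may differ from W(h_i) on a null set. A linear form in
    Y is then almost surely W of a single function, whose squared norm is the quadratic form of the
    inner products. *)
Lemma gaussian_family_white_noise n (h : 'I_n -> R * R -> R) (Y : 'I_n -> T -> R) :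
  (forall i, sq_integrable (h i)) -> (forall i, all_moments P (Y i)) ->
  (forall i, {ae P, forall w, W (h i) w = Y i w}) ->
  gaussian_family P (fun i j => inner (h i) (h j)) Y.
Proof.
move=> hh aY hY; split => // a k.
have [H1 H2] := white_noise_sum hh a (index_enum 'I_n).
have [aW mW] := white_noise_moments H1.
have -> : \sum_i \sum_j a i * a j * inner (h i) (h j) =
   inner (fun p => \sum_i a i * h i p) (fun p => \sum_i a i * h i p).
  rewrite inner_suml//; apply: eq_bigr => i _; rewrite innerC inner_suml// mulr_sumr.
  by apply: eq_bigr => j _; rewrite innerC mulrA.
rewrite -mW /Rintegral; congr fine; apply: ae_eq_integral => //.
- apply/measurable_EFinP; apply: measurable_funX; apply: all_moments_meas.
  by apply: all_moments_sum => i; exact: all_momentsZ.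
- by apply/measurable_EFinP; apply: measurable_funX; exact: all_moments_meas aW.
have hYall : {ae P, forall w, forall i, W (h i) w = Y i w}.
  have : {ae P, forall w, forall i, i \in index_enum 'I_n -> W (h i) w = Y i w}.
    elim: (index_enum 'I_n) => [|i r IH]; first exact: aeW.
    apply: filterS2 IH (hY i) => w IHw hw j; rewrite inE => /predU1P[->//|]; exact: IHw.
  by apply: filterS => w hw i; apply: hw; rewrite mem_index_enum.
apply: filterS2 hYall H2 => w hw -> _.
by congr (_ ^+ _)%:E; apply: eq_bigr => i _; rewrite hw.
Qed.

End white_noise.

(** * Comparison with the increments of fractional Brownian motion *)

Section fbm_correlation.
Context {R : realType}.

Lemma r_fbm_norm (m : R) : r_fbm `|m| = r_fbm m.
Proof.
have [m0|m0] := leP 0 m; first by rewrite ger0_norm.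
rewrite ltr0_norm// /r_fbm normrN -(normrN (- m + 1)) -(normrN (- m - 1)) !opprD !opprK.
by rewrite (addrC (Num.sqrt `|m - 1|)).
Qed.

Lemma r_fbm0 : r_fbm 0 = 1 :> R.
Proof. by rewrite /r_fbm add0r sub0r normrN normr0 sqrtr0 normr1 sqrtr1; field. Qed.

(** Concavity of the square root; for |m| >= 1 the points m - 1, m, m + 1 lie on one side of 0. *)
Lemma r_fbm_le0 (m : R) : 1 <= `|m| -> r_fbm m <= 0.
Proof.
move=> m1; rewrite -r_fbm_norm /r_fbm normr_id; move: `|m| m1 => {}m m1.
rewrite !ger0_norm; [|lra|lra].
rewrite pmulr_lle0// subr_le0.
have a0 : 0 <= m + 1 by lra.
have b0 : 0 <= m - 1 by lra.
have m0 : 0 <= m by lra.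
rewrite -(ler_sqr (x := _ + _)) ?nnegrE ?addr_ge0 ?mulr_ge0 ?sqrtr_ge0//.
rewrite exprMn sqr_sqrtr//.
have := sqr_sqrtr a0; have := sqr_sqrtr b0; have := sqr_ge0 (Num.sqrt (m + 1) - Num.sqrt (m - 1)).
move: (Num.sqrt (m + 1)) (Num.sqrt (m - 1)) => y z; nra.
Qed.

Lemma dist_nat_ge1 (i j : nat) : i != j -> 1 <= `|i%:R - j%:R| :> R.
Proof.
move=> ij; have [lt|lt|eq] := ltngtP i j.
- by rewrite distrC ger0_norm ?subr_ge0 ?ler_nat ?(ltnW lt)// lerBrDl natr1 ler_nat.
- by rewrite ger0_norm ?subr_ge0 ?ler_nat ?(ltnW lt)// lerBrDl natr1 ler_nat.
- by rewrite eq eqxx in ij.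
Qed.

(** Off the diagonal all correlations have the same sign, so their absolute values are second
    differences whose sum telescopes. This takes the place of a decay estimate r(m) =
    O(|m|^(-3/2)). *)
Lemma sum_r_fbm_le (n i : nat) : (i < n)%N ->
  \sum_(0 <= j < n) `|r_fbm (i%:R - j%:R : R)| <= 2.
Proof.
move=> iltn.
pose D (j : nat) : R := Num.sqrt `|i%:R - j%:R + 1| - Num.sqrt `|i%:R - j%:R|.
have rD (j : nat) : r_fbm (i%:R - j%:R) = 2^-1 * (D j - D j.+1).
  rewrite /r_fbm /D.
  have -> : i%:R - j.+1%:R + 1 = i%:R - j%:R :> R by rewrite -natr1; ring.
  have -> : i%:R - j.+1%:R = i%:R - j%:R - 1 :> R by rewrite -natr1; ring.
  by field.
(* At j = i the telescoping expression is -1 whereas |r(0)| = 1, whence the correction 2. *)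
have E (j : nat) : `|r_fbm (i%:R - j%:R : R)| = 2^-1 * (D j.+1 - D j) + 2 * (j == i)%:R.
  have [->|ji] := eqVneq j i.
    by have := rD i; rewrite subrr r_fbm0 normr1 /= => e; lra.
  rewrite ler0_norm ?r_fbm_le0 ?dist_nat_ge1// 1?eq_sym// rD /=; ring.
under eq_bigr do rewrite E.
rewrite big_split /= -!mulr_sumr telescope_sumr//.
have -> : \sum_(0 <= j < n) (j == i)%:R = 1 :> R.
  rewrite big_mkord (bigD1 (Ordinal iltn)) //= eqxx big1 ?addr0// => j.
  by rewrite -val_eqE /= => /negPf ->.
rewrite mulr1 gerDr pmulr_rle0// subr_le0 /D subr0.
have ni : i%:R - n%:R + 1 <= 0 :> R.
  by have : i.+1%:R <= n%:R :> R; [rewrite ler_nat|rewrite -natr1; lra].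
apply: (@le_trans _ _ 0).
  by rewrite subr_le0 ler_wsqrtr// !ler0_norm//; lra.
rewrite subr_ge0 ler_wsqrtr// !ger0_norm ?addr_ge0//; lra.
Qed.

Lemma r_fbm_norm_le2 (i j : nat) : `|r_fbm (i%:R - j%:R : R)| <= 2.
Proof.
have iltn : (i < (maxn i j).+1)%N by rewrite ltnS leq_maxl.
apply: le_trans (sum_r_fbm_le iltn).
have jltn : (j < (maxn i j).+1)%N by rewrite ltnS leq_maxr.
by rewrite big_mkord (bigD1 (Ordinal jltn)) //= lerDl sumr_ge0.
Qed.

(** As [sigma_check_l2] is a [limn], existence must be shown. From n to n + 1 the double sum grows
    by r(0)^l plus twice the sum of r(m)^l over 1 <= m <= n, which is nondecreasing for even l and
    bounded by [sum_r_fbm_le]; Cesaro's theorem concludes. *)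
Lemma cvg_sigma_check_l2 (l : nat) : ~~ odd l -> (0 < l)%N ->
  (fun n : nat => n%:R^-1 * \sum_(i < n) \sum_(j < n) r_fbm (`|i%:R - j%:R| : R) ^+ l)
    @ \oo --> (sigma_check_l2 l : R).
Proof.
move=> el l0.
pose f (m : nat) : R := r_fbm m%:R ^+ l.
have f0 m : 0 <= f m by rewrite /f exprn_even_ge0.
pose b n := \sum_(i < n) \sum_(j < n) r_fbm (`|i%:R - j%:R| : R) ^+ l.
pose e n := f 0%N + 2 * \sum_(1 <= m < n.+1) f m.
have bS n : b n.+1 - b n = e n.
  rewrite /b big_ord_recr /=.
  under eq_bigr do rewrite big_ord_recr /=.
  rewrite big_split /= big_ord_recr /= subrr normr0.
  have E1 : \sum_(i < n) r_fbm `|i%:R - n%:R| ^+ l = \sum_(1 <= m < n.+1) f m.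
    rewrite big_add1 /= big_mkord (reindex_inj rev_ord_inj); apply: eq_bigr => i _ /=.
    rewrite /f natrB ?ltn_ord//; congr (r_fbm _ ^+ l).
    by rewrite addrAC subrr sub0r normrN ger0_norm.
  have E2 : \sum_(i < n) r_fbm `|n%:R - i%:R| ^+ l = \sum_(1 <= m < n.+1) f m.
    by rewrite -E1; apply: eq_bigr => i _; rewrite distrC.
  by rewrite E1 E2 /e /f; ring.
have eB n : e n <= f 0%N + 2 ^+ l * 2 * 2.
  rewrite lerD2l mulrC ler_wpM2r//.
  have -> : \sum_(1 <= m < n.+1) f m = \sum_(1 <= m < n.+1) `|r_fbm (0%:R - m%:R : R)| ^+ l.
    apply: eq_bigr => m _; rewrite /f sub0r -normrX [RHS]ger0_norm ?exprn_even_ge0//.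
    by rewrite -(r_fbm_norm (- _)) normrN r_fbm_norm.
  apply: (@le_trans _ _ (2 ^+ l * \sum_(1 <= m < n.+1) `|r_fbm (0%:R - m%:R : R)|)).
    rewrite mulr_sumr; apply: ler_sum => m _.
    have := r_fbm_norm_le2 0 m; case: l l0 {el f f0 b e bS} => // l _ h.
    rewrite !exprS [leLHS]mulrC ler_wpM2r//.
    apply: le_trans (_ : 2 ^+ l <= _); first by rewrite lerXn2r ?nnegrE.
    by rewrite ler_peMl// ?exprn_ge0// ler1n.
  rewrite ler_wpM2l ?exprn_ge0//.
  apply: le_trans (sum_r_fbm_le (ltn0Sn n)).
  by rewrite [leRHS]big_ltn//= lerDr.
have ce : cvgn e.
  apply: nondecreasing_is_cvgn.
    move=> m n mn; rewrite lerD2l ler_wpM2l// (@big_cat_nat _ _ _ m.+1 1 n.+1)//=.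
    by rewrite lerDl sumr_ge0.
  by exists (f 0%N + 2 ^+ l * 2 * 2) => _ [n _ <-]; exact: eB.
suff : cvgn (fun n : nat => n%:R^-1 * b n) by [].
apply/cvg_ex; exists (limn e); rewrite -cvg_shiftS.
have := cesaro ce; apply: cvg_trans; apply: near_eq_cvg; apply: nearW => n.
rewrite /arithmetic_mean /= /series /=; congr (_ * _).
under eq_bigr do rewrite -bS.
by rewrite telescope_sumr// /b big_ord0 subr0.
Qed.

End fbm_correlation.

(** Rationalisation: with x, y, z the three roots, the second difference is -2
    h^2/((x+y)(y+z)(x+z)), and each factor of the denominator is at least 2 sqrt c. *)
Lemma second_difference_sqrt {R : rcfType} (c a h : R) : 0 < c -> c <= a -> 0 <= h ->
  `|Num.sqrt (a + 2 * h) - 2 * Num.sqrt (a + h) + Num.sqrt a| <= h ^+ 2 / (c * Num.sqrt c).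
Proof.
move=> c0 ca h0.
have ca1 : c <= a + h by lra.
have ca2 : c <= a + 2 * h by lra.
have E0 : Num.sqrt a ^+ 2 = a by rewrite sqr_sqrtr//; lra.
have E1 : Num.sqrt (a + h) ^+ 2 = a + h by rewrite sqr_sqrtr//; lra.
have E2 : Num.sqrt (a + 2 * h) ^+ 2 = a + 2 * h by rewrite sqr_sqrtr//; lra.
have Ec : c = Num.sqrt c ^+ 2 by rewrite sqr_sqrtr// ltW.
have c1 : 0 < Num.sqrt c by rewrite sqrtr_gt0.
have {}ca := ler_wsqrtr ca; have {}ca1 := ler_wsqrtr ca1; have {}ca2 := ler_wsqrtr ca2.
have -> : c * Num.sqrt c = Num.sqrt c ^+ 2 * Num.sqrt c by rewrite -Ec.
move: (Num.sqrt c) c1 ca ca1 ca2 => r r0.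
move: (Num.sqrt a) (Num.sqrt (a + h)) (Num.sqrt (a + 2 * h)) E0 E1 E2 => x y z E0 E1 E2 rx ry rz.
have xy : 0 < x + y by lra.
have yz : 0 < y + z by lra.
have xz : 0 < x + z by lra.
have e1 : y - x = h / (x + y).
  apply: (mulIf (lt0r_neq0 xy)); rewrite mulfVK ?lt0r_neq0//.
  have : y ^+ 2 - x ^+ 2 = h by lra.
  by move=> <-; ring.
have e2 : z - y = h / (y + z).
  apply: (mulIf (lt0r_neq0 yz)); rewrite mulfVK ?lt0r_neq0//.
  have : z ^+ 2 - y ^+ 2 = h by lra.
  by move=> <-; ring.
have e3 : z - x = 2 * h / (x + z).
  apply: (mulIf (lt0r_neq0 xz)); rewrite mulfVK ?lt0r_neq0//.
  have : z ^+ 2 - x ^+ 2 = 2 * h by lra.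
  by move=> <-; ring.
have -> : z - 2 * y + x = - (2 * h ^+ 2 / ((x + y) * (y + z) * (x + z))).
  have -> : z - 2 * y + x = (z - y) - (y - x) by ring.
  rewrite e1 e2.
  have -> : h / (y + z) - h / (x + y) = - (h * (z - x) / ((x + y) * (y + z))).
    by field; rewrite !lt0r_neq0.
  by rewrite e3; field; rewrite !lt0r_neq0.
rewrite normrN ger0_norm; last by rewrite divr_ge0 ?mulr_ge0 ?sqr_ge0// ltW.
rewrite ler_pdivrMr ?mulr_gt0// mulrAC ler_pdivlMr ?mulr_gt0 ?exprn_gt0//.
have D : 8 * (r ^+ 2 * r) <= (x + y) * (y + z) * (x + z).
  have -> : 8 * (r ^+ 2 * r) = (2 * r) * (2 * r) * (2 * r) by ring.
  by apply: ler_pM; rewrite ?mulr_ge0 ?(ltW r0)//; [apply: ler_pM; rewrite ?mulr_ge0 ?(ltW r0)//; lra|lra].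
have h2 := sqr_ge0 h.
have r3 : 0 <= r ^+ 2 * r by rewrite mulr_ge0 ?sqr_ge0// ltW.
have := ler_wpM2l h2 D; have := mulr_ge0 h2 r3; lra.
Qed.

Section quarter_fbm_approximation.
Context {R : realType}.
Variables (rho : forall n : nat, 'I_n -> 'I_n -> R) (E : R).
Hypothesis E0 : 0 <= E.
Hypothesis rhoE : forall n (i j : 'I_n),
  `|rho i j - r_fbm (i%:R - j%:R)| <= E * n%:R^-1 * (Num.sqrt n%:R)^-1.

Lemma row_bounded_fbm n : row_bounded (2 + E) (@rho n).
Proof.
move=> i; apply: (@le_trans _ _ (\sum_(j < n) (`|r_fbm (i%:R - j%:R)| +
    E * n%:R^-1 * (Num.sqrt n%:R)^-1))).
  by apply: ler_sum => j _; rewrite -lerBlDl; apply: le_trans (rhoE i j); exact: lerB_dist.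
rewrite big_split /= sum_ord_const lerD//.
  by rewrite -(big_mkord xpredT (fun j => `|r_fbm (i%:R - j%:R : R)|)) sum_r_fbm_le.
have n0 : (n%:R : R) != 0 by rewrite pnatr_eq0 -lt0n; case: i => i /=; exact: leq_ltn_trans.
have -> : n%:R * (E * n%:R^-1 * (Num.sqrt n%:R)^-1) = E * (Num.sqrt n%:R)^-1 :> R by rewrite !mulrA (mulrC n%:R) mulfK.
by rewrite ler_piMr// invsqrt_le1.
Qed.

Lemma norm_mulB_le (B e1 e2 a b a' b' : R) : `|b| <= B -> `|a'| <= B ->
  `|a - a'| <= e1 -> `|b - b'| <= e2 -> `|a * b - a' * b'| <= B * (e1 + e2).
Proof.
move=> bB aB h1 h2; have -> : a * b - a' * b' = (a - a') * b + a' * (b - b') by ring.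
apply: le_trans (ler_normD _ _) _; rewrite !normrM mulrDr lerD//.
  by rewrite mulrC ler_pM.
by rewrite ler_pM.
Qed.

Lemma norm_mul_le (B B' a b : R) : `|a| <= B -> `|b| <= B' -> `|a * b| <= B * B'.
Proof. by move=> aB bB; rewrite normrM ler_pM. Qed.

(** There are n^2 entrywise errors of order n^(-3/2); the division by n leaves n^(-1/2). *)
Lemma cvg_wick_variance : (fun n => wick_variance (@rho n)) @ \oo --> (sigma_check2 : R).
Proof.
pose B := 2 + E.
have B0 : 0 <= B by rewrite addr_ge0.
pose v n : R := 72 * (n%:R^-1 * \sum_(i < n) \sum_(j < n) r_fbm (`|i%:R - j%:R| : R) ^+ 2) +
  24 * (n%:R^-1 * \sum_(i < n) \sum_(j < n) r_fbm (`|i%:R - j%:R| : R) ^+ 4).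
have cv : v @ \oo --> (sigma_check2 : R).
  by apply: cvgD; apply: cvg_scale; exact: cvg_sigma_check_l2.
suff H : (fun n => wick_variance (@rho n) - v n) @ \oo --> (0 : R).
  rewrite [X in X @ _ --> _](_ : _ = (fun n => (wick_variance (@rho n) - v n) + v n)).
    by rewrite -[X in _ --> X]add0r; apply: cvgD.
  by apply/funext => n; rewrite subrK.
(* Each difference of fourfold products is at most 4 B^3 ep, and the weights add up to 72 + 24 = 96,
   whence 384. *)
apply: (@squeeze_cvgr _ _ _ _ (fun n => - (384 * B ^+ 3 * E * (Num.sqrt n%:R)^-1))
   (fun n => 384 * B ^+ 3 * E * (Num.sqrt n%:R)^-1)); last 2 first.
- by rewrite -oppr0; apply: cvgN; rewrite -(mulr0 (384 * B ^+ 3 * E)); exact/cvg_scale/cvg_invsqrt.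
- by rewrite -(mulr0 (384 * B ^+ 3 * E)); exact/cvg_scale/cvg_invsqrt.
apply: nearW => n; rewrite -ler_norml.
set ep := E * n%:R^-1 * (Num.sqrt n%:R)^-1.
have -> : wick_variance (@rho n) - v n = n%:R^-1 * \sum_(i < n) \sum_(j < n)
   (72 * (rho i i * rho j j * (rho i j * rho i j) -
          1 * 1 * (r_fbm (i%:R - j%:R) * r_fbm (i%:R - j%:R))) +
    24 * (rho i j * rho i j * (rho i j * rho i j) -
          r_fbm (i%:R - j%:R) * r_fbm (i%:R - j%:R) * (r_fbm (i%:R - j%:R) * r_fbm (i%:R - j%:R)))).
  rewrite /wick_variance /v ![_ * (n%:R^-1 * _)]mulrCA -mulrDr -mulrBr; congr (_ * _).
  rewrite !mulr_sumr -big_split /= -sumrB; apply: eq_bigr => i _.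
  rewrite !mulr_sumr -big_split /= -sumrB; apply: eq_bigr => j _.
  by rewrite r_fbm_norm; ring.
have rB (i j : 'I_n) : `|rho i j| <= B := row_bounded_le i j (@row_bounded_fbm n).
have fB (i j : 'I_n) : `|r_fbm (i%:R - j%:R : R)| <= B.
  by apply: le_trans (r_fbm_norm_le2 i j) _; rewrite lerDl.
have dB (i : 'I_n) : `|rho i i - 1| <= ep by have := rhoE i i; rewrite subrr r_fbm0.
have oneB : `|1 : R| <= B by rewrite normr1 (le_trans (ler1n _ 2)) // lerDl.
have T (i j : 'I_n) : `|72 * (rho i i * rho j j * (rho i j * rho i j) -
          1 * 1 * (r_fbm (i%:R - j%:R) * r_fbm (i%:R - j%:R))) +
    24 * (rho i j * rho i j * (rho i j * rho i j) -
          r_fbm (i%:R - j%:R) * r_fbm (i%:R - j%:R) * (r_fbm (i%:R - j%:R) * r_fbm (i%:R - j%:R)))|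
    <= 384 * B ^+ 3 * ep.
  have h1 : `|rho i j * rho i j - r_fbm (i%:R - j%:R) * r_fbm (i%:R - j%:R)| <= B * (ep + ep).
    by apply: norm_mulB_le.
  have h2 : `|rho i i * rho j j - 1 * 1| <= B * (ep + ep) by apply: norm_mulB_le.
  have h3 : `|rho i i * rho j j * (rho i j * rho i j) -
          1 * 1 * (r_fbm (i%:R - j%:R) * r_fbm (i%:R - j%:R))| <= B * B * (B * (ep + ep) + B * (ep + ep)).
    by apply: norm_mulB_le => //; apply: norm_mul_le.
  have h4 : `|rho i j * rho i j * (rho i j * rho i j) -
          r_fbm (i%:R - j%:R) * r_fbm (i%:R - j%:R) * (r_fbm (i%:R - j%:R) * r_fbm (i%:R - j%:R))|
       <= B * B * (B * (ep + ep) + B * (ep + ep)).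
    by apply: norm_mulB_le => //; apply: norm_mul_le.
  apply: le_trans (ler_normD _ _) _; rewrite !normrM (ger0_norm (_ : 0 <= 72))// (ger0_norm (_ : 0 <= 24))//.
  apply: (le_trans (lerD (ler_wpM2l _ h3) (ler_wpM2l _ h4))) => //.
  by rewrite le_eqVlt; apply/orP; left; apply/eqP; ring.
rewrite normrM ger0_norm ?invr_ge0//.
apply: (@le_trans _ _ (n%:R^-1 * (n%:R * (n%:R * (384 * B ^+ 3 * ep))))).
  rewrite ler_wpM2l ?invr_ge0//; apply: le_trans (ler_norm_sum _ _ _) _.
  rewrite -sum_ord_const; apply: ler_sum => i _; apply: le_trans (ler_norm_sum _ _ _) _.
  by rewrite -sum_ord_const; apply: ler_sum => j _.
have [->|n0] := eqVneq n 0%N; first by rewrite invr0 mul0r sqrtr0 invr0 mulr0.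
have n1 : (n%:R : R) != 0 by rewrite pnatr_eq0.
have n2 : Num.sqrt (n%:R : R) != 0 by rewrite sqrtr_eq0 -ltNge ltr0n lt0n.
by rewrite mulKf// /ep le_eqVlt; apply/orP; left; apply/eqP; field; rewrite n1 n2.
Qed.

(** Each rho_ii - 1 has order n^(-3/2), hence so has the bias of Q_n, and sqrt n times it is
    O(1/n). *)
Lemma cvg_diagonal_bias :
  (fun n => Num.sqrt n%:R * (n%:R^-1 * \sum_(i < n) (rho i i ^+ 2 - 1))) @ \oo --> (0 : R).
Proof.
pose B := 2 + E.
have B0 : 0 <= B by rewrite addr_ge0.
apply: (@squeeze_cvgr _ _ _ _ (fun n => - (2 * B * E * n%:R^-1)) (fun n => 2 * B * E * n%:R^-1)); last 2 first.
- by rewrite -oppr0; apply: cvgN; rewrite -(mulr0 (2 * B * E)); exact/cvg_scale/cvg_invn.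
- by rewrite -(mulr0 (2 * B * E)); exact/cvg_scale/cvg_invn.
apply: nearW => n; rewrite -ler_norml.
have [->|n0] := eqVneq n 0%N; first by rewrite sqrtr0 mul0r normr0 invr0 mulr0.
have n1 : (n%:R : R) != 0 by rewrite pnatr_eq0.
have n2 : Num.sqrt (n%:R : R) != 0 by rewrite sqrtr_eq0 -ltNge ltr0n lt0n.
set ep := E * n%:R^-1 * (Num.sqrt n%:R)^-1.
have rB (i j : 'I_n) : `|rho i j| <= B := row_bounded_le i j (@row_bounded_fbm n).
have oneB : `|1 : R| <= B by rewrite normr1 (le_trans (ler1n _ 2)) // lerDl.
have T (i : 'I_n) : `|rho i i ^+ 2 - 1| <= B * (ep + ep).
  have dB : `|rho i i - 1| <= ep by have := rhoE i i; rewrite subrr r_fbm0.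
  by rewrite expr2 -[X in _ - X]mulr1; apply: norm_mulB_le.
rewrite !normrM normfV !(ger0_norm (ler0n _ _), ger0_norm (sqrtr_ge0 _)).
apply: (@le_trans _ _ (Num.sqrt n%:R * (n%:R^-1 * (n%:R * (B * (ep + ep)))))).
  rewrite !ler_wpM2l ?invr_ge0 ?sqrtr_ge0//; apply: le_trans (ler_norm_sum _ _ _) _.
  by rewrite -sum_ord_const; apply: ler_sum.
by rewrite mulKf// /ep le_eqVlt; apply/orP; left; apply/eqP; field; rewrite n1 n2.
Qed.

End quarter_fbm_approximation.

Definition heat_cov {R : rcfType} (t s : R) := Num.sqrt (t + s) - Num.sqrt `|t - s|.

(** In the mixed second difference of [heat_cov], the part sqrt|t - s| scales exactly to r(i - j).
    The part sqrt(t + s) is a second difference of sqrt with step h at t_i + t_j >= c, hence O(h^2),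
    and the division by 2 sqrt h leaves h^(3/2). *)
Lemma increment_correlation {R : realType} (c d : R) n i j : 0 < c -> c < d -> (0 < n)%N ->
  `|(2 * Num.sqrt ((d - c) / n%:R))^-1 *
     (heat_cov (grid c d n i.+1) (grid c d n j.+1) - heat_cov (grid c d n i.+1) (grid c d n j)
      - heat_cov (grid c d n i) (grid c d n j.+1) + heat_cov (grid c d n i) (grid c d n j))
   - r_fbm (i%:R - j%:R)| <=
  (d - c) * Num.sqrt (d - c) / (c * Num.sqrt c) * n%:R^-1 * (Num.sqrt n%:R)^-1.
Proof.
move=> c0 cd n0; have n1 : 0 < n%:R :> R by rewrite ltr0n.
set h := (d - c) / n%:R.
have dc : 0 < d - c by rewrite subr_gt0.
have h0 : 0 < h by rewrite /h divr_gt0.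
have G k : grid c d n k = c + h * k%:R by rewrite /grid /h; ring.
rewrite !G /heat_cov -!natr1.
set a := (c + h * i%:R) + (c + h * j%:R).
have -> : c + h * (i%:R + 1) + (c + h * (j%:R + 1)) = a + 2 * h by rewrite /a; ring.
have -> : c + h * (i%:R + 1) + (c + h * j%:R) = a + h by rewrite /a; ring.
have -> : c + h * i%:R + (c + h * (j%:R + 1)) = a + h by rewrite /a; ring.
have N k : Num.sqrt `|h * k| = Num.sqrt h * Num.sqrt `|k|.
  by rewrite normrM sqrtrM ?normr_ge0// ger0_norm// ltW.
have -> : c + h * (i%:R + 1) - (c + h * (j%:R + 1)) = h * (i%:R - j%:R) by ring.
have -> : c + h * (i%:R + 1) - (c + h * j%:R) = h * (i%:R - j%:R + 1) by ring.
have -> : c + h * i%:R - (c + h * (j%:R + 1)) = h * (i%:R - j%:R - 1) by ring.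
have -> : c + h * i%:R - (c + h * j%:R) = h * (i%:R - j%:R) by ring.
rewrite !N /r_fbm.
have sh0 : 0 < Num.sqrt h by rewrite sqrtr_gt0.
rewrite (_ : _ - _ = (2 * Num.sqrt h)^-1 *
   (Num.sqrt (a + 2 * h) - 2 * Num.sqrt (a + h) + Num.sqrt a)); last first.
  by field; rewrite lt0r_neq0.
have ca : c <= a.
  have : 0 <= h * i%:R by rewrite mulr_ge0// ltW.
  have : 0 <= h * j%:R by rewrite mulr_ge0// ltW.
  by rewrite /a; lra.
rewrite normrM ger0_norm; last by rewrite invr_ge0 mulr_ge0// ltW.
apply: le_trans (ler_wpM2l _ (second_difference_sqrt c0 ca (ltW h0))) _.
  by rewrite invr_ge0 mulr_ge0// ltW.
have hs : h = Num.sqrt h ^+ 2 by rewrite sqr_sqrtr// ltW.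
have sE : Num.sqrt h = Num.sqrt (d - c) / Num.sqrt n%:R by rewrite /h sqrtrM ?ltW// sqrtrV ?ltW.
have sc0 : 0 < Num.sqrt c by rewrite sqrtr_gt0.
have sn0 : 0 < Num.sqrt (n%:R : R) by rewrite sqrtr_gt0.
have -> : (2 * Num.sqrt h)^-1 * (h ^+ 2 / (c * Num.sqrt c)) =
  2^-1 * (h * Num.sqrt h / (c * Num.sqrt c)).
  have -> : h ^+ 2 = Num.sqrt h ^+ 2 * h by rewrite -hs.
  by field; rewrite !lt0r_neq0.
apply: (@le_trans _ _ (h * Num.sqrt h / (c * Num.sqrt c))).
  by rewrite ler_piMl ?invf_le1 ?ler1n// divr_ge0// mulr_ge0// ltW.
by rewrite sE /h le_eqVlt; apply/orP; left; apply/eqP; field; rewrite !lt0r_neq0.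
Qed.

Lemma sigma_check_l2_ge0 {R : realType} l : ~~ odd l -> (0 < l)%N -> 0 <= (sigma_check_l2 l : R).
Proof.
move=> el l0; apply: limr_ge; first by apply/cvg_ex; eexists; exact: cvg_sigma_check_l2.
apply: nearW => n; rewrite mulr_ge0 ?invr_ge0//.
by apply: sumr_ge0 => i _; apply: sumr_ge0 => j _; exact: exprn_even_ge0.
Qed.

Lemma sigma_check2_ge0 {R : realType} : 0 <= (sigma_check2 : R).
Proof. by rewrite addr_ge0 ?mulr_ge0 ?sigma_check_l2_ge0. Qed.

(** * Strong law and central limit theorem for the quartic mean *)

Section quartic_functionals.
Context {R : realType} {dT : measure_display} {T : measurableType dT}.
Variables (P : probability T R).
Variables (rho : forall n : nat, 'I_n -> 'I_n -> R) (Y : forall n : nat, 'I_n -> T -> R) (E : R).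
Hypothesis E0 : 0 <= E.
Hypothesis rhoE : forall n (i j : 'I_n),
  `|rho i j - r_fbm (i%:R - j%:R)| <= E * n%:R^-1 * (Num.sqrt n%:R)^-1.
Hypothesis rhoC : forall n (i j : 'I_n), rho i j = rho j i.
Hypothesis GF : forall n, gaussian_family P (@rho n) (@Y n).

Definition quartic_mean n (w : T) : R := (3 * n%:R)^-1 * \sum_(i < n) Y i w ^+ 4.

Let S n := quartic_sum (@rho n) (@Y n).
Let b n : R := n%:R^-1 * \sum_(i < n) (rho i i ^+ 2 - 1).

Let quartic_meanE n w : (0 < n)%N ->
  quartic_mean n w = 1 + S n w / (3 * Num.sqrt n%:R) + b n.
Proof.
move=> n0; rewrite /S /b /quartic_mean /quartic_sum !sumrB -mulr_sumr sum_ord_const mulr1.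
have n1 : (n%:R : R) != 0 by rewrite pnatr_eq0 -lt0n.
have n2 : Num.sqrt (n%:R : R) != 0 by rewrite sqrtr_eq0 -ltNge ltr0n.
have e : n%:R = Num.sqrt n%:R ^+ 2 :> R by rewrite sqr_sqrtr.
move: (Num.sqrt _) n2 e => s s0 e; rewrite !e.
by field.
Qed.

Let all_moments_S n : all_moments P (S n).
Proof. exact: all_moments_quartic_sum. Qed.

Let B0 : 0 <= 2 + E.
Proof. by rewrite addr_ge0. Qed.

Let S_bounded := quartic_sum_bounded GF rhoC (row_bounded_fbm E0 rhoE) B0.

Let measurable_quartic_mean n : measurable_fun setT (quartic_mean n).
Proof.
apply: all_moments_meas; apply/all_momentsZ/all_moments_sum => i.
by apply: all_momentsX; case: (GF n).
Qed.

(** The fourth moment of S_n / sqrt n is O(n^(-2)) and summable; the second moment would only give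
    1/n. *)
Lemma ae_cvg_quartic_mean : {ae P, forall w, (fun n => quartic_mean n w) @ \oo --> (1 : R)}.
Proof.
have [C C0 HC] := S_bounded 4.
pose U n w := (Num.sqrt n.+1%:R)^-1 * S n.+1 w.
have := @ae_cvg0_of_moment4 R _ _ P U C.
have aU n : all_moments P (U n) by exact: all_momentsZ.
have U4 n : \int[P]_w (U n w ^+ 4) <= C * n.+1%:R^-1 ^+ 2.
  under eq_Rintegral do rewrite exprMn.
  rewrite expectZ; last exact: all_momentsX.
  rewrite -[4%N]/(2 * 2)%N exprM (exprVn (Num.sqrt _)) sqr_sqrtr// mulrC ler_wpM2r ?exprn_ge0 ?invr_ge0//.
  exact: le_trans (ler_norm _) (HC _).
move=> /(_ aU U4); apply: filterS => w Uw.
have b0 : b @ \oo --> (0 : R).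
  rewrite (_ : b = fun n => (Num.sqrt n%:R)^-1 * (Num.sqrt n%:R * b n)).
    by rewrite -[X in _ --> X](mulr0 0); apply: cvgM; [exact: cvg_invsqrt|exact: (cvg_diagonal_bias E0 rhoE)].
  apply/funext => -[|n]; first by rewrite /b sqrtr0 !invr0 !mul0r.
  by rewrite mulKf// sqrtr_eq0 -ltNge.
rewrite -cvg_shiftS.
rewrite [X in X @ _ --> _](_ : _ = fun n => 1 + (3^-1 * U n w + b n.+1)).
  have c1 : (fun n => 3^-1 * U n w + b n.+1) @ \oo --> (3^-1 * 0 + 0 : R).
    by apply: cvgD; [exact: cvg_scale|rewrite (cvg_shiftS b)].
  have c2 : (fun n => 1 + (3^-1 * U n w + b n.+1)) @ \oo --> (1 + (3^-1 * 0 + 0) : R).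
    by apply: cvgD => //; exact: cvg_cst.
  by move: c2; rewrite mulr0 !addr0.
apply/funext => n; rewrite [LHS](quartic_meanE w (ltn0Sn n)) -addrA; congr (_ + (_ + _)).
by rewrite /U invfM mulrC mulrA.
Qed.

(** The moments of lam S_n / 3, hence its laws, converge to those of the normal law; [delta_method]
    carries this over to F. *)
Lemma quartic_mean_clt (F : R -> R) (lam : R) :
  measurable_fun setT F ->
  (forall e, 0 < e -> exists2 g, 0 < g &
     forall q, `|q - 1| <= g -> `|F q - F 1 - lam * (q - 1)| <= e * `|q - 1|) ->
  conv_in_distribution P (fun n w => Num.sqrt n%:R * (F (quartic_mean n w) - F 1))
    (gauss_law ((lam / 3) ^+ 2 * sigma_check2)).
Proof.
move=> mF dF; have [m [mE am mk]] := gauss_law_measure (mulr_ge0 (sqr_ge0 (lam / 3)) (@sigma_check2_ge0 R)).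
apply: (conv_in_distribution_expect mE) => [n|f cf bf].
  apply: measurable_funM => //; apply: measurable_funB => //.
  exact: (measurableT_comp mF).
have [C C0 HC] := S_bounded 2.
have SC n : \int[P]_w (S n w ^+ 2) <= C := le_trans (ler_norm _) (HC n).
have D := delta_method all_moments_S SC quartic_meanE (cvg_diagonal_bias E0 rhoE)
  mF dF measurable_quartic_mean cf bf.
have [B fB] := bf.
have aX n : all_moments P (fun w => lam / 3 * S n w) by exact: all_momentsZ.
have cX k : (fun n => \int[P]_w (lam / 3 * S n w) ^+ k) @ \oo --> \int[m]_x (x ^+ k).
  rewrite mk -gauss_momentZ.
  rewrite [X in X @ _ --> _](_ : _ = fun n => (lam / 3) ^+ k * \int[P]_w (S n w ^+ k)).
    apply: cvg_scale; apply: (cvg_quartic_sum GF rhoC (row_bounded_fbm E0 rhoE) B0).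
    exact: cvg_wick_variance E0 rhoE.
  apply/funext => n; under eq_Rintegral do rewrite exprMn.
  by rewrite expectZ//; exact: all_momentsX.
have gr t : (fun N => t ^+ (2 * N) / (2 * N)`!%:R * \int[m]_x (x ^+ (2 * N))) @ \oo --> (0 : R).
  by under eq_fun do rewrite mk; exact: gauss_moment_growth.
have := cvg_expect_continuous aX am cX gr cf fB => cS.
rewrite -[X in _ --> X]add0r.
rewrite [X in X @ _ --> _](_ : _ = fun n =>
  (\int[P]_w f (Num.sqrt n%:R * (F (quartic_mean n w) - F 1)) - \int[P]_w f (lam / 3 * S n w)) +
  \int[P]_w f (lam / 3 * S n w)); last by apply/funext => n; rewrite subrK.
exact: cvgD.
Qed.

End quartic_functionals.

(** * The estimators *)

Section heat_increments.
Context {R : realType} {dT : measure_display} {T : measurableType dT}.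
Variables (P : probability T R) (W : (R * R -> R) -> T -> R) (theta sigma x c d : R).
Hypotheses (theta0 : 0 < theta) (sigma0 : 0 < sigma) (c0 : 0 < c) (cd : c < d).
Hypothesis HW : is_white_noise P W.

Let g t := heat_integrand theta t x.
Let u t := mild_solution W theta sigma t x.
Let t n i := grid c d n i.

(** The contribution of the part sqrt|t - s| of the covariance to the variance of an increment; the
    exact variance differs by a relative O(n^(-3/2)). *)
Definition increment_var n : R :=
  2 * (sigma ^+ 2 / Num.sqrt (4 * pi * theta) * Num.sqrt ((d - c) / n%:R)).

Definition increment_noise n (i : 'I_n) (p : R * R) : R :=
  sigma / Num.sqrt (increment_var n) * g (t n i.+1) p +
  - (sigma / Num.sqrt (increment_var n)) * g (t n i) p.

Definition unit_increment n (i : 'I_n) (w : T) : R :=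
  (u (t n i.+1) w - u (t n i) w) / Num.sqrt (increment_var n).

Definition increment_cov n (i j : 'I_n) := inner (increment_noise i) (increment_noise j).

Let t_gt0 n i : 0 < t n i.
Proof.
by apply: (lt_le_trans c0); rewrite /t /grid lerDl -mulrA mulr_ge0 ?subr_ge0 ?(ltW cd)// divr_ge0.
Qed.

Let inner_heat s r : 0 < s -> 0 < r ->
  inner (g s) (g r) = (Num.sqrt (4 * pi * theta))^-1 * heat_cov s r.
Proof. by move=> s0 r0; rewrite /inner /Rintegral [X in fine X](heat_inner x theta0 r0 s0). Qed.

Let sq_integrable_heat s : 0 < s -> sq_integrable (g s).
Proof.
move=> s0; split.
  by apply: (@measurable_funTS _ _ _ _ _ _); exact: measurable_heat_integrand.
under eq_integral do rewrite expr2.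
by rewrite heat_inner// ltry.
Qed.

Let sq_integrable_increment n (i : 'I_n) : sq_integrable (increment_noise i).
Proof. by apply: sq_integrableD; exact: sq_integrable_heat. Qed.

Let increment_var_gt0 n : (0 < n)%N -> 0 < increment_var n.
Proof.
move=> n0; have p0 := @pi_gt0 R.
have h0 : 0 < (d - c) / n%:R by rewrite divr_gt0 ?subr_gt0 ?ltr0n.
have k0 : 0 < 4 * pi * theta by rewrite !mulr_gt0.
apply: mulr_gt0 => //; apply: mulr_gt0; last by rewrite sqrtr_gt0.
by rewrite divr_gt0 ?exprn_gt0// sqrtr_gt0.
Qed.

Lemma gaussian_increments n : gaussian_family P (@increment_cov n) (@unit_increment n).
Proof.
apply: (gaussian_family_white_noise HW) => // i.
  have aW s : 0 < s -> all_moments P (W (g s)).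
    by move=> s0; case: (white_noise_moments HW (sq_integrable_heat s0)).
  rewrite (_ : unit_increment i = fun w => (Num.sqrt (increment_var n))^-1 *
     (sigma * W (g (t n i.+1)) w + (- sigma) * W (g (t n i)) w)).
    by apply/all_momentsZ/all_momentsD; apply/all_momentsZ/aW.
  by apply/funext => w; rewrite /unit_increment /u /mild_solution mulrC mulNr.
have := HW.2 _ _ (sigma / Num.sqrt (increment_var n)) (- (sigma / Num.sqrt (increment_var n)))
  (sq_integrable_heat (t_gt0 n i.+1)) (sq_integrable_heat (t_gt0 n i)).
apply: filterS => w; rewrite /increment_noise => ->.
by rewrite /unit_increment /u /mild_solution /g; ring.
Qed.

Lemma increment_covC n (i j : 'I_n) : increment_cov i j = increment_cov j i.
Proof. exact: innerC. Qed.

Lemma increment_cov_fbm n (i j : 'I_n) :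
  `|increment_cov i j - r_fbm (i%:R - j%:R)| <=
  (d - c) * Num.sqrt (d - c) / (c * Num.sqrt c) * n%:R^-1 * (Num.sqrt n%:R)^-1.
Proof.
have n0 : (0 < n)%N by apply: leq_ltn_trans (ltn_ord i).
have v0 := increment_var_gt0 n0.
have gt0 := t_gt0 n.
have iD (k : 'I_n) s : 0 < s -> inner (increment_noise k) (g s) =
  sigma / Num.sqrt (increment_var n) * (inner (g (t n k.+1)) (g s) - inner (g (t n k)) (g s)).
  move=> s0; have hs r := sq_integrable_heat (t_gt0 n r).
  rewrite [LHS](innerDl _ _ (hs _) (hs _) (sq_integrable_heat s0)).
  by rewrite mulNr mulrBr.
suff -> : increment_cov i j = (2 * Num.sqrt ((d - c) / n%:R))^-1 *
     (heat_cov (t n i.+1) (t n j.+1) - heat_cov (t n i.+1) (t n j)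
      - heat_cov (t n i) (t n j.+1) + heat_cov (t n i) (t n j)).
  exact: increment_correlation.
rewrite /increment_cov innerDl; try exact: sq_integrable_heat; try exact: sq_integrable_increment.
rewrite !(innerC (g _)) !iD// !inner_heat//.
have vE : Num.sqrt (increment_var n) ^+ 2 = increment_var n by rewrite sqr_sqrtr// ltW.
have hC (s r : R) : heat_cov s r = heat_cov r s by rewrite /heat_cov (addrC s) (distrC s).
have p0 := @pi_gt0 R.
have q0 : 0 < Num.sqrt (4 * pi * theta) by rewrite sqrtr_gt0; rewrite !mulr_gt0.
have k0 : 0 < Num.sqrt ((d - c) / n%:R).
  by rewrite sqrtr_gt0 divr_gt0 ?subr_gt0 ?ltr0n.
have s0 : 0 < Num.sqrt (increment_var n) by rewrite sqrtr_gt0.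
rewrite (hC (t n j.+1)) (hC (t n j)) (hC (t n j) (t n i)) (hC (t n j.+1) (t n i)).
transitivity (sigma ^+ 2 / Num.sqrt (increment_var n) ^+ 2 / Num.sqrt (4 * pi * theta) *
 (heat_cov (t n i.+1) (t n j.+1) - heat_cov (t n i.+1) (t n j)
      - heat_cov (t n i) (t n j.+1) + heat_cov (t n i) (t n j))).
  by field; rewrite !lt0r_neq0.
rewrite vE /increment_var; congr (_ * _); field.
by rewrite !lt0r_neq0.
Qed.

Let q n w : R := quartic_mean unit_increment n w.

(** The square of [increment_var] is sigma^4 (d - c)/(pi theta n), and 3 is the fourth moment of a
    standard normal variable: this is the origin of the constants in the estimators. *)
Lemma quartic_varE n w : quartic_var u c d n w = 3 * (d - c) * sigma ^+ 4 / (pi * theta) * q n w.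
Proof.
case: n => [|n]; first by rewrite /quartic_var /q /quartic_mean !big_ord0 !mulr0.
have v0 := increment_var_gt0 (ltn0Sn n).
have p0 := @pi_gt0 R.
have n0 : (n.+1%:R : R) != 0 by rewrite pnatr_eq0.
have sE : Num.sqrt (increment_var n.+1) ^+ 4 = sigma ^+ 4 * (d - c) / (pi * theta * n.+1%:R).
  rewrite -[4%N]/(2 * 2)%N exprM sqr_sqrtr ?ltW// /increment_var.
  rewrite !exprMn exprVn !sqr_sqrtr ?mulr_ge0 ?divr_ge0 ?subr_ge0 ?invr_ge0 ?ltW//.
  move: n.+1%:R n0 (@pi R) p0 => m m0 p p0.
  by field; rewrite m0 !lt0r_neq0.
have -> : quartic_var u c d n.+1 w =
    Num.sqrt (increment_var n.+1) ^+ 4 * \sum_(i < n.+1) unit_increment i w ^+ 4.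
  rewrite mulr_sumr; apply: eq_bigr => i _; rewrite /unit_increment -exprMn mulrC divfK//.
  by rewrite lt0r_neq0// sqrtr_gt0.
rewrite sE /q /quartic_mean.
move: n.+1%:R n0 (@pi R) p0 => m m0 p p0.
by field; rewrite m0 !lt0r_neq0.
Qed.

Lemma theta_hatE n w : theta_hat u sigma c d n w = theta / q n w.
Proof.
have p0 := @pi_gt0 R; have dc : 0 < d - c by rewrite subr_gt0.
rewrite /theta_hat quartic_varE.
(* If Q_n = 0, both sides are 0 by the convention for the inverse of 0. *)
have [->|q0] := eqVneq (q n w) 0; first by rewrite !mulr0 invr0 !mulr0.
move: (@pi R) p0 => p p0.
by field; rewrite q0 !lt0r_neq0.
Qed.

Lemma sigma2_hatE n w : sigma2_hat u theta c d n w = sigma ^+ 2 * Num.sqrt (q n w).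
Proof.
have p0 := @pi_gt0 R; have dc : 0 < d - c by rewrite subr_gt0.
rewrite /sigma2_hat quartic_varE.
rewrite (_ : _ * _ = (sigma ^+ 2) ^+ 2 * q n w); last first.
  by move: (@pi R) p0 => p p0; field; rewrite !lt0r_neq0.
by rewrite sqrtrM ?sqr_ge0// sqrtr_sqr ger0_norm// sqr_ge0.
Qed.

End heat_increments.

(** The error is exactly (a/q)(q - 1)^2. Within 1/2 of 1 one has a/q <= 2a, which explains
    e/(2a). *)
Lemma inv_differentiable1 {R : realType} (a : R) : 0 < a -> forall e, 0 < e ->
  exists2 g, 0 < g &
    forall q, `|q - 1| <= g -> `|a / q - a / 1 - (- a) * (q - 1)| <= e * `|q - 1|.
Proof.
move=> a0 e e0; exists (Num.min 2^-1 (e / (2 * a))).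
  by rewrite lt_min invr_gt0 ltr0n /= divr_gt0// mulr_gt0.
move=> q; rewrite le_min => /andP[h1 h2].
have q2 : 2^-1 <= q by move: h1; rewrite ler_norml; lra.
have q0 : 0 < q by lra.
have -> : a / q - a / 1 - - a * (q - 1) = (a / q * (q - 1)) * (q - 1).
  by field; rewrite lt0r_neq0.
rewrite normrM ler_wpM2r// normrM ger0_norm; last by rewrite divr_ge0// ltW.
have qi : q^-1 <= 2 by rewrite invf_ple ?posrE.
apply: (@le_trans _ _ (2 * a * (e / (2 * a)))).
  apply: ler_pM => //; first by rewrite divr_ge0 // ltW.
  by rewrite mulrC ler_wpM2r // ltW.
by rewrite mulrC divfK// lt0r_neq0// mulr_gt0.
Qed.

(** With s = sqrt q the error is exactly -(a/2)(s - 1)^2, and |s - 1| <= |s^2 - 1| = |q - 1|. *)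
Lemma sqrt_differentiable1 {R : realType} (a : R) : 0 < a -> forall e, 0 < e ->
  exists2 g, 0 < g &
    forall q, `|q - 1| <= g ->
      `|a * Num.sqrt q - a * Num.sqrt 1 - a / 2 * (q - 1)| <= e * `|q - 1|.
Proof.
move=> a0 e e0; exists (Num.min 1 (e / a)); first by rewrite lt_min ltr01 divr_gt0.
move=> q; rewrite le_min sqrtr1 => /andP[h1 h2].
have q0 : 0 <= q by move: h1; rewrite ler_norml; lra.
have qE := sqr_sqrtr q0; have s0 := sqrtr_ge0 q.
move: (Num.sqrt q) qE s0 => s qE s0; rewrite -qE in h1 h2 *.
have -> : a * s - a * 1 - a / 2 * (s ^+ 2 - 1) = - (a / 2 * (s - 1) ^+ 2) by field.
have e1 : `|s ^+ 2 - 1| = `|s - 1| * (s + 1).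
  by rewrite (_ : s ^+ 2 - 1 = (s - 1) * (s + 1)); [rewrite normrM (ger0_norm (_ : 0 <= s + 1))// addr_ge0|ring].
have e2 : `|s - 1| <= `|s ^+ 2 - 1| by rewrite e1 ler_peMr// lerDr.
rewrite normrN ger0_norm; last by rewrite mulr_ge0 ?sqr_ge0 // divr_ge0 // ltW.
rewrite -(real_normK (num_real (s - 1))) expr2.
have e3 : a * `|s - 1| <= e.
  by rewrite mulrC -ler_pdivlMr//; exact: le_trans e2 h2.
have n0 := normr_ge0 (s - 1).
apply: (@le_trans _ _ (a * `|s - 1| * `|s - 1|)).
  rewrite -[leRHS]mulrA ler_wpM2r ?mulr_ge0//; lra.
by apply: ler_pM => //; rewrite mulr_ge0// ltW.
Qed.

Unset Implicit Arguments.

Theorem theorem3p3 (R : realType) (dT : measure_display) (T : measurableType dT)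
    (P : probability T R) (W : (R * R -> R) -> T -> R)
    (theta sigma x c d : R) :
  0 < theta -> 0 < sigma -> 0 < c -> c < d ->
  is_white_noise P W ->
  let u : R -> T -> R := fun t => mild_solution W theta sigma t x in
  {ae P, forall w, (fun n => theta_hat u sigma c d n w) @ \oo --> theta} /\
  {ae P, forall w, (fun n => sigma2_hat u theta c d n w) @ \oo --> sigma ^+ 2} /\
  conv_in_distribution P
    (fun n w => Num.sqrt n%:R * (theta_hat u sigma c d n w - theta))
    (gauss_law (theta ^+ 2 * sigma_check2 / 9)) /\
  conv_in_distribution P
    (fun n w => Num.sqrt n%:R * (sigma2_hat u theta c d n w - sigma ^+ 2))
    (gauss_law (sigma ^+ 4 * sigma_check2 / 36)).
Proof.
move=> theta0 sigma0 c0 cd HW u.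
pose rho := increment_cov theta sigma x c d.
pose Y := unit_increment W theta sigma x c d.
pose q := quartic_mean Y.
have GF n : gaussian_family P (@rho n) (@Y n) by exact: gaussian_increments.
have rhoC n (i j : 'I_n) : rho n i j = rho n j i by exact: increment_covC.
have E0 : 0 <= (d - c) * Num.sqrt (d - c) / (c * Num.sqrt c).
  by rewrite divr_ge0 ?mulr_ge0 ?sqrtr_ge0 ?subr_ge0// ltW.
have rhoE n (i j : 'I_n) := increment_cov_fbm x theta0 sigma0 c0 cd i j.
have q1 : {ae P, forall w, (fun n => q n w) @ \oo --> (1 : R)}.
  exact: (ae_cvg_quartic_mean E0 rhoE rhoC GF).
have clt := quartic_mean_clt E0 rhoE rhoC GF.
have tE n w : theta_hat u sigma c d n w = theta / q n w by exact: theta_hatE.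
have sE n w : sigma2_hat u theta c d n w = sigma ^+ 2 * Num.sqrt (q n w) by exact: sigma2_hatE.
split.
  apply: filterS q1 => w qw; under eq_fun do rewrite tE.
  have : (fun n => theta * (q n w)^-1) @ \oo --> (theta * 1^-1 : R).
    by apply: cvg_scale; apply: cvgV => //; exact: oner_neq0.
  by rewrite invr1 mulr1.
split.
  apply: filterS q1 => w qw; under eq_fun do rewrite sE.
  have : (fun n => sigma ^+ 2 * Num.sqrt (q n w)) @ \oo --> (sigma ^+ 2 * Num.sqrt 1 : R).
    by apply: cvg_scale; apply: (cvg_comp _ _ qw); exact: sqrt_continuous.
  by rewrite sqrtr1 mulr1.
split.
  (* The map theta / q has slope -theta at q = 1, and Q_n - 1 is S_n / (3 sqrt n) to leading
     order. *)
  rewrite (_ : theta ^+ 2 * sigma_check2 / 9 = (- theta / 3) ^+ 2 * sigma_check2); last by field.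
  have mF : measurable_fun [set: R] (fun r : R => theta / r).
    by apply: measurable_funM => //; exact: measurable_inv.
  have := clt _ _ mF (inv_differentiable1 theta0); rewrite divr1.
  by under eq_fun do under eq_fun do rewrite -tE.
(* The map sigma^2 sqrt(q) has slope sigma^2 / 2 at q = 1, whence 36 = (2 * 3)^2. *)
rewrite (_ : sigma ^+ 4 * sigma_check2 / 36 = (sigma ^+ 2 / 2 / 3) ^+ 2 * sigma_check2); last by field.
have mF : measurable_fun [set: R] (fun r : R => sigma ^+ 2 * Num.sqrt r).
  by apply: measurable_funM => //; exact: measurable_sqrt.
have := clt _ _ mF (sqrt_differentiable1 (exprn_gt0 2 sigma0)); rewrite sqrtr1 mulr1.
by under eq_fun do under eq_fun do rewrite -sE.
Qed.
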